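(* Let $1<\alpha<2$ and let $\{X_t,\ t\ge 0\}$ be a spectrally positive $\alpha$-stable Lévy process with $X_0=0$, normalized so that $\mathbb{E}[e^{-\lambda X_t}]=e^{t\lambda^{\alpha}}$ for all $t,\lambda\ge 0$. Let $T_1=\inf\{t>0:\ X_t>1\}$. Then for every $s\in(-1,\ 1-1/\alpha)$, $$\mathbb{E}[T_1^s]=\frac{\Gamma(1+s)\,\sin(\pi/\alpha)}{\Gamma(1+s\alpha)\,\sin\big(\pi(s+1/\alpha)\big)},$$ where at $s=-1/\alpha$ the right-hand side is understood as its limit as $s\to-1/\alpha$.
   Context: Spectrally positive means that the process has no negative jumps. $\Gamma$ is the Euler Gamma function, and $1/\Gamma$ is the entire reciprocal Gamma function. *)

(* Defs.v *)
From HB Require Import structures.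
From mathcomp Require Export all_boot all_order all_algebra.
From mathcomp Require Export all_classical all_reals all_analysis.
Export Order.TTheory GRing.Theory Num.Theory.
Export numFieldNormedType.Exports.

Set Implicit Arguments.
Unset Strict Implicit.
Unset Printing Implicit Defensive.

Local Open Scope classical_set_scope.
Local Open Scope ring_scope.

Section gamma.
Context {R : realType}.

(* Euler's integral of the second kind; meaningful for 0 < x. *)
Definition euler_gamma (x : R) : R :=
  \int[@lebesgue_measure R]_(t in `]0, +oo[%classic)
    (t `^ (x - 1) * expR (- t)).

(* The Gamma function on the real line: Euler's integral for 0 < x, continued
   to x <= 0 by Gamma(x + n) = x (x + 1) ... (x + n - 1) Gamma(x), where n is
   the least natural number such that 0 < x + n.  At the poles 0, -1, -2, ...
   the convention 0^-1 = 0 gives the value 0, so that (Gamma x)^-1 is the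
   entire reciprocal Gamma function at every real x. *)
Definition Gamma (x : R) : R :=
  let n := if 0 < x then 0%N else (Num.truncn (- x)).+1 in
  euler_gamma (x + n%:R) / \prod_(i < n) (x + i%:R).

End gamma.

(* Real power of a nonnegative extended real, with the usual conventions
   0^s = +oo and (+oo)^s = 0 for s < 0, 0^s = 0 and (+oo)^s = +oo for 0 < s, and
   x^0 = 1 for all x.  (The library's poweR takes the value 0 at x = 0 and +oo
   at x = +oo when s < 0.) *)
Definition epower {R : realType} (x : \bar R) (s : R) : \bar R :=
  expeR (s%:E * lne x)%E.

(* In what follows a process indexed by [0, +oo[ is encoded by a family indexed
   by the whole real line of which only the members with index 0 <= t are ever
   constrained or used. *)
Section processes.
Context {d : measure_display} {T : measurableType d} {R : realType}.
Variable P : probability T R.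
Implicit Type X : R -> {RV P >-> R}.

Definition eq_distribution (Y Z : T -> R) : Prop :=
  forall A : set R, measurable A -> P (Y @^-1` A) = P (Z @^-1` A).

(* Since the A i may be the whole line, the product rule for the full family
   contains that for its subfamilies. *)
Definition mutually_independent (n : nat) (Y : 'I_n -> T -> R) : Prop :=
  forall A : 'I_n -> set R, (forall i, measurable (A i)) ->
    P (\bigcap_(i in [set: 'I_n]) (Y i @^-1` A i)) =
    (\prod_(i < n) P (Y i @^-1` A i))%E.

Definition independent_increments X : Prop :=
  forall (n : nat) (t : nat -> R),
    0 <= t 0%N -> (forall i, t i <= t i.+1) ->
    mutually_independent (fun (i : 'I_n) w => X (t i.+1) w - X (t i) w).

Definition stationary_increments X : Prop :=
  forall s h : R, 0 <= s -> 0 <= h ->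
    eq_distribution (fun w => X (s + h) w - X s w) (X h).

Definition cadlag (x : R -> R) : Prop :=
  (forall t, 0 <= t -> x u @[u --> t^'+] --> x t) /\
  (forall t, 0 < t -> cvg (x u @[u --> t^'-])).

Record levy_process X : Prop := LevyProcess {
  levy_start : {ae P, forall w, X 0 w = 0} ;
  levy_independent : independent_increments X ;
  levy_stationary : stationary_increments X ;
  levy_cadlag : {ae P, forall w, cadlag (fun t => X t w)} }.

(* Stability of index alpha, in the wide sense (a drift is allowed).  For a
   Levy process, equality of the one-dimensional marginals amounts to equality
   in law of the processes. *)
Definition stable (alpha : R) X : Prop :=
  forall a : R, 0 < a -> exists b : R, forall t : R, 0 <= t ->
    eq_distribution (X (a * t)) (fun w => a `^ alpha^-1 * X t w + b * t).

Definition spectrally_positive X : Prop :=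
  {ae P, forall w, forall t, 0 < t -> lim (X u w @[u --> t^'-]) <= X t w}.

(* The infimum of the empty set is +oo. *)
Definition first_passage X (x : R) (w : T) : \bar R :=
  ereal_inf [set t%:E | t in [set t : R | 0 < t /\ x < X t w]].

End processes.

(* The Mellin transform s |-> E[T_1^s] in closed form, away from the removable
   singularity s = - 1 / alpha. *)
Definition passage_moment {R : realType} (alpha s : R) : R :=
  (Gamma (1 + s) * sin (pi / alpha)) /
  (Gamma (1 + s * alpha) * sin (pi * (s + alpha^-1))).

(* Main.v *)
Require Import Defs.
From HB Require Import structures.
From mathcomp Require Import measurable_realfun ring lra.

(** Write T for the first passage time above 1, phi(q) = E exp(- q T), and
    g(x) = exp(x - exp x) for the density gumbel.  Half lines are
    parametrized by logarithms throughout, so that Mellin transforms are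
    integrals of exp(p x) against a function of x.

    Everything follows from one identity, integral_gumbel_passage_laplace: for
    v <> 0,

      int g(x + v) phi(exp(alpha x)) dx
        = (exp v - exp(alpha v)) / (1 - exp(alpha v)).

    By self-similarity phi(exp(alpha x)) is the probability that X exceeds
    exp x before an independent exponential time, so the identity says that
    the maximum S up to this time satisfies, for l = exp v,
    E exp(- l S) = (1 - l) / (1 - l^alpha).  It is obtained from random walks.
    The maximum W_n of n steps of size h satisfies W_(n+1) = max(0, Y + W_n) in
    law, Y being an increment independent of W_n, whence a linear recursion for
    E exp(- l W_n) whose source term is the excess E exp(l U) - 1 of the
    undershoot U = max(0, - Y - W_n) (skeleton_recursion).  Only the negative
    part of Y enters U.  It is of order h^(1/alpha) with exponential moments,
    so the excess is l times its value at l = 1, up to h^(2/alpha) = o(h)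
    (undershoot_excess_bound).  At l = 1 the growth factor exp(h l^alpha) of the
    recursion is exactly compensated by the discount factor exp(- h) of an
    exponential time, and this determines the excess (abel_lindley).  It remains
    to let h tend to 0: for a right-continuous path, passage on dyadic grids
    approximates passage in continuous time (grid_weight_cvg).

    Multiplying by exp(alpha s v) and integrating over v factorizes the
    left-hand side (mellin_equation).  For - 1/alpha < s < 0 this gives

      Gamma(1 + alpha s) Gamma(- s) E T^s
        = int (exp((s + 1/alpha) x) - exp((s + 1) x)) / (1 - exp x) dx,

    and the integral is a difference of cotangents (integral_exp_ratio), proved
    by Herglotz's trick.  For the other values of s the strip of
    convergence is moved by subtracting a leading term: 1 - phi replaces phi if
    s > 0, and exp - g replaces g if s < - 1/alpha.  Euler's reflection formula
    (euler_gamma_reflection) brings the quotient into its final form.  At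
    s = - 1/alpha the formula is extended by continuity of u |-> E T^u.

    The first passage time is measurable only up to a null set; passage_time
    is a measurable version of it, and eq_integral_ae transfers the result. *)

Local Open Scope classical_set_scope.
Local Open Scope ring_scope.

Set Implicit Arguments.
Unset Strict Implicit.
Unset Printing Implicit Defensive.

(** * Maxima of random walks *)

(** The maximum of the partial sums of [y 0, y 1, ...] up to n terms, the empty
    sum included (see lt_lindley). Recursion on the first term, rather than a
    maximum over an index, exposes the one-step recursion on which the whole
    argument runs. *)
Fixpoint lindley {R : realType} (n : nat) (y : nat -> R) : R :=
  if n is m.+1 then Num.max 0 (y 0%N + lindley m (fun i => y i.+1)) else 0.

Lemma lindley_ge0 {R : realType} n (y : nat -> R) : 0 <= lindley n y.
Proof. by case: n => [|n] //=; rewrite le_max lexx. Qed.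

Lemma lt_lindley {R : realType} n (y : nat -> R) (x : R) : 0 <= x ->
  x < lindley n y <-> exists2 k, (k <= n)%N & x < \sum_(i < k) y i.
Proof.
elim: n x y => [|n IH] x y x0 /=.
  split=> [|[k]]; first by rewrite ltNge x0.
  by rewrite leqn0 => /eqP ->; rewrite big_ord0.
rewrite lt_max ltNge x0 /=.
have E k : \sum_(i < k.+1) y i = y 0%N + \sum_(i < k) y i.+1.
  by rewrite big_ord_recl.
have [xy|yx] := ltP x (y 0%N).
  split=> _; first by exists 1%N => //; rewrite big_ord1.
  by rewrite ltr_wpDr ?lindley_ge0.
rewrite -ltrBlDl IH ?subr_ge0//; split=> [[k kn]|[[|k] kn]].
- by rewrite ltrBlDl -E => ?; exists k.+1.
- by rewrite big_ord0 ltNge x0.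
- by rewrite E -ltrBlDl; exists k.
Qed.

Lemma lindleyZ {R : realType} n (c : R) (y : nat -> R) : 0 <= c ->
  lindley n (fun i => c * y i) = c * lindley n y.
Proof.
move=> c0; elim: n y => [|n IH] y /=; first by rewrite mulr0.
by rewrite IH -mulrDr maxr_pMr// mulr0.
Qed.

Lemma measurable_lindley {d} {T : measurableType d} {R : realType} n
    (Y : nat -> T -> R) : (forall i, measurable_fun setT (Y i)) ->
  measurable_fun setT (fun w => lindley n (Y ^~ w)).
Proof.
elim: n Y => [|n IH] Y mY /=; first exact: measurable_cst.
apply: measurable_maxr; first exact: measurable_cst.
by apply: measurable_funD => //; exact: (IH (fun i => Y i.+1)).
Qed.

Section iid.
Context {d : measure_display} {T : measurableType d} {R : realType}.
Variable P : probability T R.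

Lemma indep_prefix (Y : nat -> T -> R) n (B : nat -> set R) :
  mutually_independent P (fun i : 'I_n => Y i) ->
  (forall i, measurable (B i)) ->
  P (\bigcap_(i in `I_n) (Y i @^-1` B i)) = (\prod_(i < n) P (Y i @^-1` B i))%E.
Proof.
move=> /(_ (fun i => B i)) I mB; rewrite -I//; congr (P _).
by apply/seteqP; split=> w /= H i /= ni; [exact: H (ltn_ord i) | exact: (H (Ordinal ni))].
Qed.

Lemma rectangles_measure_unique (m1 m2 : {measure set (R * R) -> \bar R}) :
  (m1 setT < +oo)%E ->
  (forall A B, measurable A -> measurable B -> m1 (A `*` B) = m2 (A `*` B)) ->
  forall C, measurable C -> m1 C = m2 C.
Proof.
move=> m1f E C mC.
apply: (measure_unique [set D | exists2 A, measurable A & exists2 B, measurable B & A `*` B = D] (fun=> setT)) => //.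
- by rewrite measurable_prod_measurableType.
- move=> _ _ [A mA [B mB <-]] [A' mA' [B' mB' <-]].
  exists (A `&` A'); first exact: measurableI.
  by exists (B `&` B'); [exact: measurableI | rewrite setXI].
- by move=> _; exists setT => //; exists setT => //; rewrite setXTT.
- by rewrite bigcup_const.
- by move=> _ [A mA [B mB <-]]; exact: E.
Qed.

(** The maximum taken from index j on is a function of [Y j] and of the maximum
    taken from j + 1 on. By induction on n the latter is independent of the
    variables up to j and its law does not depend on j, so the joint law of that
    pair is known on rectangles, hence everywhere. Carrying a second sequence Y'
    with the same marginals through the induction gives at the same time
    equality in law of the two maxima (lindley_law). *)
Lemma lindley_indep n : forall (Y Y' : nat -> T -> R),
  (forall i, measurable_fun setT (Y i)) ->
  (forall i, measurable_fun setT (Y' i)) ->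
  (forall n, mutually_independent P (fun i : 'I_n => Y i)) ->
  (forall n, mutually_independent P (fun i : 'I_n => Y' i)) ->
  (forall i j, eq_distribution P (Y i) (Y' j)) ->
  forall j j' (B : nat -> set R) A, (forall i, measurable (B i)) ->
    measurable A ->
    P ((\bigcap_(i in `I_j) (Y i @^-1` B i)) `&`
       (fun w => lindley n (fun i => Y (j + i)%N w)) @^-1` A) =
    (P (\bigcap_(i in `I_j) (Y i @^-1` B i)) *
     P ((fun w => lindley n (fun i => Y' (j' + i)%N w)) @^-1` A))%E.
Proof.
elim: n => [|n IH] Y Y' mY mY' iY iY' YY' j j' B A mB mA /=.
  have [A0|A0] := pselect (A 0).
    rewrite (_ : _ @^-1` A = setT); last by apply/seteqP; split.
    by rewrite setIT probability_setT mule1.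
  rewrite (_ : _ @^-1` A = set0); last by apply/seteqP; split.
  by rewrite setI0 measure0 mule0.
have mpre Z (k : nat) D : (forall i, measurable_fun setT (Z i : T -> R)) ->
    (forall i, measurable (D i)) ->
    measurable (\bigcap_(i in `I_k) (Z i @^-1` D i)).
  move=> mZ mD; apply: bigcap_measurableType => i _.
  by rewrite -[X in measurable X]setTI; exact: mZ.
(* The pair that determines the maximum from index k on. *)
pose Q (Z : nat -> T -> R) (k : nat) w :=
  (Z k w, lindley n (fun i => Z (k.+1 + i)%N w)).
have mQ Z k : (forall i, measurable_fun setT (Z i)) -> measurable_fun setT (Q Z k).
  move=> mZ; apply: measurable_fun_pair => //=.
  exact: (@measurable_lindley _ _ _ n (fun i => Z (k.+1 + i)%N)).
have rect (Z : nat -> T -> R) (k : nat) (D : nat -> set R) (C E : set R) : (forall i, measurable_fun setT (Z i)) ->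
  (forall n, mutually_independent P (fun i : 'I_n => Z i)) ->
  (forall i j, eq_distribution P (Z i) (Y' j)) ->
  (forall i, measurable (D i)) -> measurable C -> measurable E ->
  P ((\bigcap_(i in `I_k) (Z i @^-1` D i)) `&` Q Z k @^-1` (C `*` E)) =
  (P (\bigcap_(i in `I_k) (Z i @^-1` D i)) * (P (Y' 0%N @^-1` C) *
   P ((fun w => lindley n (fun i => Y' (j'.+1 + i)%N w)) @^-1` E)))%E.
  move=> mZ iZ ZY' mD mC mE.
  pose D' i := if i == k then C else D i.
  have mD' i : measurable (D' i) by rewrite /D'; case: ifP.
  have split_pre : \bigcap_(i in `I_k.+1) (Z i @^-1` D' i) =
      \bigcap_(i in `I_k) (Z i @^-1` D i) `&` Z k @^-1` C.
    apply/seteqP; split=> w /= => [H|[H HC] i /=].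
      split=> [i /= ik|].
        by have := H i (ltnW ik); rewrite /D' ltn_eqF.
      by have := H k (ltnSn k); rewrite /D' eqxx.
    rewrite ltnS leq_eqVlt /D' => /orP[/eqP ->|ik]; first by rewrite eqxx.
    by rewrite ltn_eqF//; exact: H.
  have -> : (\bigcap_(i in `I_k) (Z i @^-1` D i)) `&` Q Z k @^-1` (C `*` E) =
     \bigcap_(i in `I_k.+1) (Z i @^-1` D' i) `&`
       (fun w => lindley n (fun i => Z (k.+1 + i)%N w)) @^-1` E.
    by rewrite split_pre -setIA; congr (_ `&` _).
  rewrite (IH Z Y' _ _ _ _ _ k.+1 j'.+1)// muleA; congr (_ * _)%E.
  rewrite !indep_prefix// big_ord_recr/=; congr (_ * _)%E.
    by apply: eq_bigr => i _; rewrite /D' ltn_eqF.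
  by rewrite /D' eqxx; exact: ZY'.
pose f (p : R * R) := Num.max 0 (p.1 + p.2).
have mf : measurable_fun setT f.
  by apply: measurable_maxr => //; exact: measurable_funD.
have mfA : measurable (f @^-1` A) by rewrite -[X in measurable X]setTI; exact: mf.
pose pre := \bigcap_(i in `I_j) (Y i @^-1` B i).
have mp : measurable pre by exact: mpre.
(* Equality of two finite measures on the plane: the law of the pair restricted
   to the event pre, and the law of the pair built from Y', multiplied by the
   probability of pre. *)
have H C : measurable C ->
    pushforward (mrestr P mp) (Q Y j) C =
    mscale (NngNum (fine_ge0 (measure_ge0 P pre))) (pushforward P (Q Y' j')) C.
  move: C; apply: rectangles_measure_unique; try by exact: mQ.
    move=> ?.
    by rewrite /= /pushforward /= preimage_setT /mrestr setTI ltey_eq fin_num_measure.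
  move=> ? C E mC mE; rewrite /= /pushforward /mrestr /mscale/=.
  rewrite fineK ?fin_num_measure// setIC rect//; congr (_ * _)%E.
  have Y'Y' i i' : eq_distribution P (Y' i) (Y' i').
    by move=> S mS; rewrite -(YY' 0%N i S mS) (YY' 0%N i').
  have := rect Y' j' (fun=> setT) C E mY' iY' Y'Y' (fun=> measurableT) mC mE.
  rewrite (_ : \bigcap_(i in _) _ = setT) ?setTI ?probability_setT ?mul1e; last first.
    by apply/seteqP; split.
  by move=> <-.
have := H (mQ Y' j' mY') _ mfA; rewrite /pushforward /mrestr /mscale/= fineK ?fin_num_measure//.
have adj Z k : (fun w => Num.max 0 (Z (k + 0)%N w + lindley n (fun i => Z (k + i.+1)%N w))) =
    f \o Q Z k.
  by apply/funext => w; rewrite /f /Q /= addn0; under eq_fun do rewrite addnS -addSn.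
by rewrite adj adj setIC.
Qed.

Lemma ge0_integral_indep (U V : T -> R) (f g : R -> \bar R) :
  measurable_fun setT U -> measurable_fun setT V ->
  (forall B C, measurable B -> measurable C ->
    P (U @^-1` B `&` V @^-1` C) = (P (U @^-1` B) * P (V @^-1` C))%E) ->
  measurable_fun setT f -> measurable_fun setT g ->
  (forall x, 0 <= f x)%E -> (forall x, 0 <= g x)%E ->
  (\int[P]_w (f (U w) * g (V w)) = \int[P]_w f (U w) * \int[P]_w g (V w))%E.
Proof.
move=> mU mV ind mf mg f0 g0.
pose U' : {mfun T >-> R} := HB.pack U (isMeasurableFun.Build _ _ _ _ U mU).
pose V' : {mfun T >-> R} := HB.pack V (isMeasurableFun.Build _ _ _ _ V mV).
have mUV : measurable_fun setT (fun w => (U w, V w)) by exact: measurable_fun_pair.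
pose UV : {mfun T >-> (R * R)%type} :=
  HB.pack (fun w => (U w, V w)) (isMeasurableFun.Build _ _ _ _ (fun w => (U w, V w)) mUV).
have mfg : measurable_fun setT (fun p : R * R => f p.1 * g p.2)%E.
  by apply: emeasurable_funM; exact: measurableT_comp.
transitivity (\int[distribution P UV]_p (f p.1 * g p.2))%E.
  by rewrite ge0_integral_distribution// => y; exact: mule_ge0.
transitivity (\int[(distribution P U' \x distribution P V')%E]_p (f p.1 * g p.2))%E.
  apply: eq_measure_integral => //= C mC _; apply/esym.
  by apply: product_measure_unique => //= B D mB mD; rewrite -ind.
rewrite fubini_tonelli1//; last by move=> x; exact: mule_ge0.
rewrite /fubini_F /=.
under eq_integral do rewrite ge0_integralZl//.
rewrite ge0_integralZr//; last exact: integral_ge0.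
by rewrite !ge0_integral_distribution.
Qed.

Lemma lindley_law n (Y Y' : nat -> T -> R) j j' A :
  (forall i, measurable_fun setT (Y i)) ->
  (forall i, measurable_fun setT (Y' i)) ->
  (forall n, mutually_independent P (fun i : 'I_n => Y i)) ->
  (forall n, mutually_independent P (fun i : 'I_n => Y' i)) ->
  (forall i j, eq_distribution P (Y i) (Y' j)) -> measurable A ->
  P ((fun w => lindley n (fun i => Y (j + i)%N w)) @^-1` A) =
  P ((fun w => lindley n (fun i => Y' (j' + i)%N w)) @^-1` A).
Proof.
move=> mY mY' iY iY' YY' mA.
have := @lindley_indep n _ _ mY mY' iY iY' YY' j j' (fun=> setT) A (fun=> measurableT) mA.
rewrite (_ : \bigcap_(i in _) _ = setT) ?setTI ?probability_setT ?mul1e//.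
by apply/seteqP; split.
Qed.

(** Conditioning on the first increment: what follows it is independent of it
    and is, in law, a maximum of the same kind. *)
Lemma lindley_step n (Y : nat -> T -> R) (f g : R -> \bar R) :
  (forall i, measurable_fun setT (Y i)) ->
  (forall n, mutually_independent P (fun i : 'I_n => Y i)) ->
  (forall i j, eq_distribution P (Y i) (Y j)) ->
  measurable_fun setT f -> measurable_fun setT g ->
  (forall x, 0 <= f x)%E -> (forall x, 0 <= g x)%E ->
  (\int[P]_w (f (Y 0%N w) * g (lindley n (fun i => Y i.+1 w))) =
   \int[P]_w f (Y 0%N w) * \int[P]_w g (lindley n (Y ^~ w)))%E.
Proof.
move=> mY iY YY mf mg f0 g0.
have mW : measurable_fun setT (fun w => lindley n (fun i => Y i.+1 w)).
  exact: (@measurable_lindley _ _ _ n (fun i => Y i.+1) (fun i => mY i.+1)).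
have mW0 : measurable_fun setT (fun w => lindley n (Y ^~ w)) by exact: measurable_lindley.
rewrite (ge0_integral_indep (mY 0%N) mW _ mf mg f0 g0); last first.
  move=> B C mB mC.
  have := @lindley_indep n _ _ mY mY iY iY YY 1%N 1%N (fun=> B) C (fun=> mB) mC.
  rewrite (_ : \bigcap_(i in _) _ = Y 0%N @^-1` B)//.
  by apply/seteqP; split=> [w /(_ 0%N)|w /= Bw [|i]//]; exact.
congr (_ * _)%E.
pose W1 : {mfun T >-> R} := HB.pack (fun w => lindley n (fun i => Y i.+1 w)) (isMeasurableFun.Build _ _ _ _ _ mW).
pose W0 : {mfun T >-> R} := HB.pack (fun w => lindley n (Y ^~ w)) (isMeasurableFun.Build _ _ _ _ _ mW0).
transitivity (\int[distribution P W1]_p g p)%E; first by rewrite ge0_integral_distribution.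
transitivity (\int[distribution P W0]_p g p)%E; last by rewrite ge0_integral_distribution.
apply: eq_measure_integral => C mC _.
exact: (@lindley_law n Y Y 1%N 0%N C).
Qed.

End iid.

(** * Integrals over the line and the Gumbel density *)

Section calculus.
Context {R : realType}.
Local Notation mu := (@lebesgue_measure R).

Lemma ge0_integral_opp (f : R -> \bar R) :
  measurable_fun setT f -> (forall x, 0 <= f x)%E ->
  (\int[mu]_x f (- x)%R = \int[mu]_x f x)%E.
Proof.
move=> mf f0.
transitivity (\int[pushforward mu (-%R : _ -> measurableTypeR R)]_x f x)%E.
  by rewrite ge0_integral_pushforward.
by apply: eq_measure_integral => //= A mA _; exact: lebesgue_measureN.
Qed.

(** Holds because the image of Lebesgue measure under an affine map agrees with
    a multiple of it on intervals. *)
Lemma ge0_integral_affine (p c : R) (f : R -> \bar R) : 0 < p ->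
  measurable_fun setT f -> (forall x, 0 <= f x)%E ->
  (p%:E * \int[mu]_x f (p * x + c)%R = \int[mu]_x f x)%E.
Proof.
move=> p0 mf f0.
pose phi (x : measurableTypeR R) : measurableTypeR R := p * (x : R) + c.
have mphi : measurable_fun [set: measurableTypeR R] phi.
  by apply: (@measurable_funD _ R R) => //; exact: mulrl_measurable.
have E A : measurable A -> mu A =
    mscale (NngNum (ltW p0)) (pushforward mu phi) A.
  apply: lebesgue_measure_unique => // _ [[a b]] _ <-.
  transitivity (p%:E * mu [set x : R | (p * x + c)%R \in `]a, b]])%E; last by [].
  have -> : [set x : R | p * x + c \in `]a, b]] = `](a - c) / p, (b - c) / p]%classic.
    have E x : (a < p * x + c <= b) = ((a - c) / p < x <= (b - c) / p).
      by rewrite ltr_pdivrMr// ler_pdivlMr// [x * p]mulrC ltrBlDr lerBrDr.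
    by apply/seteqP; split=> x /=; rewrite !in_itv/= E.
  rewrite !lebesgue_measure_itv/= !lte_fin ltr_pM2r ?invr_gt0// ltrD2r.
  case: ifP => _; last by rewrite mule0.
  rewrite -!EFinB -EFinM; congr (_%:E).
  by field; exact: lt0r_neq0.
have E' : (\int[mscale (NngNum (ltW p0)) (pushforward mu phi)]_x f x =
    \int[mu]_x f x)%E.
  by move=> m; apply: eq_measure_integral => A mA _; exact/esym/E.
rewrite -(E' mphi) ge0_integral_mscale//=; congr (_ * _)%E.
by rewrite ge0_integral_pushforward.
Qed.

Lemma is_derive_continuous (f F : R -> R) : (forall x : R, is_derive x 1 F (f x)) ->
  continuous F.
Proof.
move=> dF x; apply: differentiable_continuous; apply/derivable1_diffP.
exact: ex_derive.
Qed.

Lemma is_derive_conv (f g : R -> R) (x a b : R) : is_derive x 1 f a ->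
  f =1 g -> a = b -> is_derive x 1 g b.
Proof. by move=> d /funext <- <-. Qed.

Lemma ge0_FTCy (f F : R -> R) (a l : R) : (forall x, 0 <= f x) ->
  continuous f -> (forall x : R, is_derive x 1 F (f x)) ->
  F x @[x --> +oo] --> l ->
  (\int[mu]_(x in `[a, +oo[) (f x)%:E)%E = (l - F a)%:E.
Proof.
move=> f0 cf dF Fl.
rewrite (@ge0_continuous_FTC2y _ f F a l)//.
- exact: continuous_subspaceT.
- by apply: cvg_at_right_filter; exact: (is_derive_continuous dF).
- by move=> x _; rewrite derive1E; exact: derive_val.
Qed.

Lemma ge0_FTCNy (f F : R -> R) (a l : R) : (forall x, 0 <= f x) ->
  continuous f -> (forall x : R, is_derive x 1 F (f x)) ->
  F x @[x --> -oo] --> l ->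
  (\int[mu]_(x in `]-oo, a]) (f x)%:E)%E = (F a - l)%:E.
Proof.
move=> f0 cf dF Fl.
rewrite -[a in LHS]opprK ge0_integration_by_substitutionNy; last 2 first.
- exact: continuous_subspaceT.
- by move=> x _; exact: f0.
have dG (x : R) : is_derive x 1 (fun x => - F (- x)) ((f \o -%R) x).
  have d1 : is_derive x 1 (F \o -%R) (f (- x) * -1).
    by apply: is_derive1_comp; exact: is_deriveNid.
  by have d2 := is_deriveN d1; rewrite mulrN1 opprK in d2; exact: d2.
rewrite (ge0_FTCy (- a) _ _ dG (l := - l)).
- by rewrite opprK opprK addrC.
- by move=> x /=.
- by move=> x; apply: continuous_comp; [exact: opp_continuous | exact: cf].
- by apply: cvgN; rewrite -cvgyNP.
Qed.

Lemma ge0_integral_halves (f : R -> \bar R) (a : R) : measurable_fun setT f ->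
  (forall x, 0 <= f x)%E ->
  (\int[mu]_x f x = \int[mu]_(x in `]-oo, a]) f x + \int[mu]_(x in `[a, +oo[) f x)%E.
Proof.
move=> mf f0.
rewrite -(@integral_itv_obnd_cbnd _ a +oo%O f); last exact: measurable_funTS.
rewrite -ge0_integral_setU//=.
- by rewrite -itv_bndbnd_setU// set_itvNyy.
- exact: measurable_funTS.
- by apply/disj_setPS => x /= []; rewrite !in_itv/= => h; rewrite andbT ltNge h.
Qed.

Lemma ge0_FTCT (f F : R -> R) (l l' : R) : (forall x, 0 <= f x) ->
  continuous f -> (forall x : R, is_derive x 1 F (f x)) ->
  F x @[x --> -oo] --> l -> F x @[x --> +oo] --> l' ->
  (\int[mu]_x (f x)%:E)%E = (l' - l)%:E.
Proof.
move=> f0 cf dF Fl Fl'.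
rewrite (@ge0_integral_halves _ 0); last first.
- by move=> x; rewrite lee_fin.
- by apply/measurable_EFinP; exact: continuous_measurable_fun.
rewrite (ge0_FTCNy _ f0 cf dF Fl) (ge0_FTCy _ f0 cf dF Fl') -EFinD.
by congr (_%:E); ring.
Qed.

Lemma is_derive_expR_comp (f : R -> R) (x df : R) : is_derive x 1 f df ->
  is_derive x 1 (fun y => expR (f y)) (df * expR (f x)).
Proof.
move=> d; rewrite mulrC; apply: (@is_derive1_comp _ expR f) => //.
Qed.

(** The standard exponential density written in the variable log u, the Jacobian
    included: the density of the Gumbel law, up to reflection. *)
Definition gumbel (x : R) := expR (x - expR x).

Lemma gumbel_ge0 x : 0 <= gumbel x. Proof. exact: expR_ge0. Qed.

Lemma is_derive_gumbel (x : R) :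
  is_derive x 1 (fun y => - expR (- expR y)) (gumbel x).
Proof.
have d1 : is_derive x 1 (fun y => - expR y) (- expR x) by exact: is_deriveN.
have d2 := is_deriveN (is_derive_expR_comp d1).
by rewrite -mulNr opprK -expRD in d2; exact: d2.
Qed.

Lemma continuous_gumbel : continuous gumbel.
Proof.
move=> x; apply: continuous_comp; last exact: continuous_expR.
by apply: cvgB => //; exact: continuous_expR.
Qed.

Lemma measurable_gumbel : measurable_fun setT gumbel.
Proof. by apply: continuous_measurable_fun; exact: continuous_gumbel. Qed.

Lemma cvgNy_shift (v : R) : x + v @[x --> -oo] --> -oo.
Proof.
apply/cvgrNyPle => A; near=> x; rewrite -lerBrDr; near: x.
by apply: nbhs_ninfty_le; exact: num_real.
Unshelve. all: by end_near. Qed.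

Lemma cvgNy_expR : @expR R x @[x --> -oo] --> 0.
Proof. by rewrite cvgNy_compNP; exact: cvgr_expR. Qed.

Lemma cvgy_expR : @expR R x @[x --> +oo] --> +oo.
Proof.
apply: (ger_cvgy _ cvg_id); near=> x.
by rewrite (le_trans _ (expR_ge1Dx x))// lerDr.
Unshelve. all: by end_near. Qed.

Lemma cvgNy_gumbel_primitive : - expR (- @expR R x) @[x --> -oo] --> (-1 : R).
Proof.
apply: cvgN; rewrite -[X in _ --> X]expR0 -oppr0.
apply: continuous_cvg; first exact: continuous_expR.
by apply: cvgN; exact: cvgNy_expR.
Qed.

Lemma cvgy_gumbel_primitive : - expR (- @expR R x) @[x --> +oo] --> (0 : R).
Proof.
rewrite -[X in _ --> X]oppr0; apply: cvgN.
exact: (cvg_comp _ _ cvgy_expR (@cvgr_expR R)).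
Qed.

Lemma integral_gumbel : (\int[mu]_x (gumbel x)%:E = 1)%E.
Proof.
rewrite (ge0_FTCT gumbel_ge0 continuous_gumbel is_derive_gumbel
  cvgNy_gumbel_primitive cvgy_gumbel_primitive).
by rewrite opprK add0r.
Qed.

Lemma integral_gumbel_tail (v m : R) : 0 <= m ->
  (\int[mu]_x (gumbel (x + v) * (expR x < m)%R%:R)%:E =
   (1 - expR (- (expR v * m)))%:E)%E.
Proof.
rewrite le_eqVlt => /predU1P[<-|m0].
  rewrite mulr0 oppr0 expR0 subrr integral0_eq// => x _.
  by rewrite ltNge expR_ge0 mulr0.
have dG (x : R) : is_derive x 1 (fun x => - expR (- expR (x + v))) (gumbel (x + v)).
  have d1 : is_derive x 1 (fun y : R => y + v) 1.
    by rewrite -[X in is_derive _ _ _ X]addr0; exact: is_deriveD.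
  have := @is_derive1_comp _ (fun y => - expR (- expR y)) (fun y => y + v) x _ _ (is_derive_gumbel (x + v)) d1.
  by rewrite mulr1.
have cG : continuous (fun x => gumbel (x + v)).
  by move=> x; apply: continuous_comp; [by apply: cvgD; [exact: cvg_id|exact: cvg_cst]|exact: continuous_gumbel].
have lG : - expR (- @expR R (x + v)) @[x --> -oo] --> (-1 : R).
  apply: (cvg_comp (fun x => x + v) _ _ cvgNy_gumbel_primitive).
  exact: cvgNy_shift.
transitivity (\int[mu]_(x in `]-oo, ln m]) (gumbel (x + v))%:E)%E; last first.
  rewrite (ge0_FTCNy (ln m) _ cG dG lG)//; last by move=> x; exact: gumbel_ge0.
  by rewrite expRD lnK ?posrE// opprK addrC [m * _]mulrC.
rewrite -integral_itv_bndo_bndc; last first.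
  by apply/measurable_EFinP; apply: measurable_funTS; exact: continuous_measurable_fun.
rewrite [RHS]integral_mkcond; apply: eq_integral => x _.
rewrite patchE mem_setE in_itv/= -[X in (_ < X)%R%:R]lnK ?posrE// ltr_expR.
by case: ifP; rewrite ?mulr1 ?mulr0.
Qed.

Lemma continuous_expR_affine (z : R) : continuous (fun x => expR (z * x - expR x)).
Proof.
move=> x; apply: continuous_comp; last exact: continuous_expR.
apply: cvgB; last exact: continuous_expR.
exact: mulrl_continuous.
Qed.

Lemma integral_expR_halfline (p : R) : 0 < p ->
  (\int[mu]_(x in `[0%R, +oo[) (expR (- (p * x)))%:E = (p^-1)%:E)%E.
Proof.
move=> p0.
have dG (x : R) : is_derive x 1 (fun x => - p^-1 * expR (- (p * x))) (expR (- (p * x))).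
  have d1 : is_derive x 1 (fun y => - (p * y)) (- p).
    have := is_deriveN (is_deriveZ p (is_derive_id x 1)).
    by rewrite scaler1.
  have := is_deriveZ (- p^-1) (is_derive_expR_comp d1).
  by rewrite scalerA mulrNN mulVf ?scale1r ?gt_eqF.
rewrite (ge0_FTCy 0 _ _ dG (l := 0)).
- by rewrite mulr0 oppr0 expR0 mulr1 sub0r opprK.
- by move=> x; exact: expR_ge0.
- exact: (is_derive_continuous (fun x => is_derive_expR_comp _)).
- rewrite -[X in _ --> X](mulr0 (- p^-1)); apply: cvgMl_tmp.
  apply: (cvg_comp (fun x => p * x) _ _ (@cvgr_expR R)).
  apply/cvgryPge => A; near=> x; rewrite -ler_pdivrMl//; near: x.
Unshelve. all: by end_near.
Qed.

(** The substitution t = exp x. It is made on [exp (-n), exp n], and n then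
    tends to infinity on both sides by monotone convergence. *)
Lemma gamma_logE (z : R) : 0 < z ->
  (\int[mu]_(t in `]0%R, +oo[) (t `^ (z - 1) * expR (- t))%:E =
   \int[mu]_x (expR (z * x - expR x))%:E)%E.
Proof.
move=> z0.
pose G (t : R) := t `^ (z - 1) * expR (- t).
have mG : measurable_fun setT G.
  apply: measurable_funM; first exact: measurable_powR.
  by apply: measurableT_comp => //; exact: measurable_expR.
have mH : measurable_fun setT (fun x => expR (z * x - expR x)).
  by apply: continuous_measurable_fun; exact: continuous_expR_affine.
have G0 t : 0 <= G t by rewrite mulr_ge0 ?powR_ge0 ?expR_ge0.
have E n : (\int[mu]_(t in `[expR (- n%:R), expR n%:R]) (G t)%:E =
    \int[mu]_(x in `[(- n%:R)%R, n%:R]) (expR (z * x - expR x))%:E)%E.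
  have -> := @integration_by_substitution_increasing R expR G (- n%:R) n%:R.
  - apply: eq_integral => x _ /=; congr (_%:E).
    rewrite /G !fctE derive1E derive_val -expRM -!expRD.
    by congr (expR _); ring.
  - by rewrite -subr_ge0 opprK -natrD ler0n.
  - by move=> x y _ _; rewrite ltr_expR.
  - move=> x _; rewrite [X in continuous_at _ X](_ : _ = expR).
      exact: continuous_expR.
    by apply/funext => y; rewrite derive1E derive_val.
  - rewrite [X in cvg (X @ _)](_ : _ = expR); last first.
      by apply/funext => y; rewrite derive1E derive_val.
    apply/cvg_ex; exists (expR (- n%:R)); apply: cvg_at_right_filter.
    exact: continuous_expR.
  - rewrite [X in cvg (X @ _)](_ : _ = expR); last first.
      by apply/funext => y; rewrite derive1E derive_val.
    apply/cvg_ex; exists (expR n%:R); apply: cvg_at_left_filter.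
    exact: continuous_expR.
  - split=> //.
    + by apply: cvg_at_right_filter; exact: continuous_expR.
    + by apply: cvg_at_left_filter; exact: continuous_expR.
  - apply: continuous_in_subspaceT => t; rewrite inE/= in_itv/= => /andP[t0 _].
    have {}t0 : 0 < t by rewrite (lt_le_trans _ t0)// expR_gt0.
    apply: cvgM.
      have : derivable ((fun y : R => y `^ (z - 1)) : R -> R) (t : R) 1.
        by apply: derivable_powR; rewrite in_itv/= t0.
      by move/derivable1_diffP/differentiable_continuous; exact.
    by apply: continuous_comp; [exact: opp_continuous|exact: continuous_expR].
have cvgG : (\int[mu]_(t in `[expR (- n%:R), expR n%:R]) (G t)%:E @[n --> \oo] -->
    \int[mu]_(t in `]0%R, +oo[) (G t)%:E)%E.
  have -> : (`]0%R, +oo[%classic : set R) = \bigcup_n `[expR (- n%:R), expR n%:R]%classic.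
    apply/seteqP; split=> x /=.
      rewrite in_itv/= andbT => x0; exists (Num.truncn `|ln x|).+1 => //=.
      have h : `|ln x| < (Num.truncn `|ln x|).+1%:R by rewrite truncnS_gt.
      move: h; rewrite ltr_norml => /andP[h1 h2].
      rewrite in_itv/=; apply/andP; split.
        by rewrite -[leRHS]lnK ?posrE// ler_expR ltW.
      by rewrite -[leLHS]lnK ?posrE// ler_expR ltW.
    case=> n _ /=; rewrite !in_itv/= andbT => /andP[h _].
    by rewrite (lt_le_trans _ h)// expR_gt0.
  apply: ge0_nondecreasing_set_cvg_integral => //.
  - apply/nondecreasing_seqP => n; rewrite subsetEset => x /=.
    rewrite !in_itv/= => /andP[h1 h2]; apply/andP; split.
      by rewrite (le_trans _ h1)// ler_expR lerN2 ler_nat.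
    by rewrite (le_trans h2)// ler_expR ler_nat.
  - by move=> n; apply/measurable_EFinP; exact: measurable_funTS.
  - by move=> n x _; rewrite lee_fin.
have cvgH : (\int[mu]_(x in `[(- n%:R)%R, n%:R]) (expR (z * x - expR x))%:E @[n --> \oo] -->
    \int[mu]_x (expR (z * x - expR x))%:E)%E.
  have -> : [set: R] = \bigcup_n `[(- n%:R)%R, n%:R]%classic.
    apply/seteqP; split=> x //= _; exists (Num.truncn `|x|).+1 => //=.
    have h : `|x| < (Num.truncn `|x|).+1%:R by rewrite truncnS_gt.
    move: h; rewrite ltr_norml => /andP[h1 h2].
    by rewrite in_itv/= !ltW.
  apply: ge0_nondecreasing_set_cvg_integral => //.
  - apply/nondecreasing_seqP => n; rewrite subsetEset => x /=.
    rewrite !in_itv/= => /andP[h1 h2]; apply/andP; split.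
      by rewrite (le_trans _ h1)// lerN2 ler_nat.
    by rewrite (le_trans h2)// ler_nat.
  - by move=> n; apply/measurable_EFinP; exact: measurable_funTS.
rewrite -(cvg_lim (@ereal_hausdorff R) cvgG) -(cvg_lim (@ereal_hausdorff R) cvgH).
by congr (limn _); apply/funext => n; rewrite E.
Qed.

(** The integrand is at most exp (z x) on the left half line; on the right one,
    exp x >= 1 + x^2 / 2 bounds it by a multiple of exp (- x). *)
Lemma gamma_log_lty (z : R) : 0 < z ->
  (\int[mu]_x (expR (z * x - expR x))%:E < +oo)%E.
Proof.
move=> z0.
have mH : measurable_fun setT (fun x => expR (z * x - expR x)).
  by apply: continuous_measurable_fun; exact: continuous_expR_affine.
have mE (p : R) : measurable_fun setT (fun x : R => expR (p * x)).
  by apply: measurableT_comp; [exact: measurable_expR|exact: mulrl_measurable].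
rewrite (@ge0_integral_halves _ 0); last 2 first.
- exact/measurable_EFinP.
- by move=> x; rewrite lee_fin expR_ge0.
rewrite lte_add_pinfty//.
  apply: (@le_lt_trans _ _ (\int[mu]_(x in `]-oo, 0%R]) (expR (z * x))%:E)%E).
    apply: ge0_le_integral => //=.
    - by apply/measurable_EFinP; exact: measurable_funTS.
    - by apply/measurable_EFinP; apply: measurable_funTS; exact: mE.
    - by move=> x _; rewrite lee_fin ler_expR gerDl oppr_le0 expR_ge0.
  have -> : (\int[mu]_(x in `]-oo, 0%R]) (expR (z * x))%:E =
      \int[mu]_(x in `[0%R, +oo[) (expR (- (z * x)))%:E)%E.
    rewrite -[X in `]-oo, X]]oppr0 ge0_integration_by_substitutionNy.
    - by apply: eq_integral => x _ /=; rewrite mulrN.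
    - apply: continuous_subspaceT => x.
      apply: continuous_comp; last exact: continuous_expR.
      exact: mulrl_continuous.
    - by move=> x _; exact: expR_ge0.
  by rewrite integral_expR_halfline// ltry.
apply: (@le_lt_trans _ _ (\int[mu]_(x in `[0%R, +oo[)
    ((expR ((z + 1) ^+ 2 / 2))%:E * (expR (- (1 * x)))%:E))%E).
  apply: ge0_le_integral => //=.
  - by apply/measurable_EFinP; exact: measurable_funTS.
  - apply/measurable_EFinP; apply: measurable_funTS; apply: measurable_funM => //.
    under eq_fun do rewrite -mulNr; exact: mE.
  - move=> x; rewrite in_itv/= andbT => x0; rewrite lee_fin -expRD ler_expR.
    have h1 := expR_ge1Dxn 1%N x0.
    rewrite lerBlDr (le_trans _ (lerD (lexx _) h1))// !factS fact0 -subr_ge0.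
    have h2 : 0 <= 2^-1 * (z + 1 - x) ^+ 2 by rewrite mulr_ge0 ?sqr_ge0.
    suff -> : (z + 1) ^+ 2 / 2 - 1 * x + (1 + x ^+ 2 / (2 * (1 * 1))%:R) - z * x =
      2^-1 * (z + 1 - x) ^+ 2 + 1 by rewrite addr_ge0.
    by rewrite !muln1; field.
rewrite ge0_integralZl//=.
- by rewrite integral_expR_halfline// -EFinM ltry.
- apply/measurable_EFinP; apply: measurable_funTS.
  under eq_fun do rewrite -mulNr; exact: mE.
Qed.

Lemma euler_gammaE (z : R) : 0 < z ->
  (\int[mu]_x (expR (z * x - expR x))%:E = (euler_gamma z)%:E)%E.
Proof.
move=> z0; rewrite /euler_gamma /Rintegral gamma_logE// fineK//.
rewrite ge0_fin_numE ?gamma_log_lty// integral_ge0//.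
Qed.

Lemma euler_gamma_gt0 (z : R) : 0 < z -> 0 < euler_gamma z.
Proof.
move=> z0; rewrite -lte_fin -euler_gammaE//.
have mH : measurable_fun setT (fun x => expR (z * x - expR x)).
  by apply: continuous_measurable_fun; exact: continuous_expR_affine.
apply: (@lt_le_trans _ _ (\int[mu]_(x in `[0%R, 1%R]) (cst (expR (- expR 1))%:E) x)%E).
  rewrite integral_cst//= lebesgue_measure_itv/= lte_fin ltr01 sube0 mule1.
  by rewrite lte_fin expR_gt0.
apply: (@le_trans _ _ (\int[mu]_(x in `[0%R, 1%R]) (expR (z * x - expR x))%:E)%E).
  apply: ge0_le_integral => //=.
  - by apply/measurable_EFinP; exact: measurable_funTS.
  - move=> x; rewrite in_itv/= => /andP[x0 x1]; rewrite lee_fin ler_expR.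
    by rewrite -[leLHS]add0r lerD ?mulr_ge0 ?(ltW z0)// lerN2 ler_expR.
by apply: ge0_subset_integral => //=; exact/measurable_EFinP.
Qed.

End calculus.

(** * The cotangent as an integral *)

Section cotangent.
Context {R : realType}.
Local Notation mu := (@lebesgue_measure R).

Lemma ge0_derive_homo (f df : R -> R) : (forall x : R, is_derive x 1 f (df x)) ->
  (forall x, 0 <= x -> 0 <= df x) -> forall x, 0 <= x -> f 0 <= f x.
Proof.
move=> dF df0 x; rewrite le_eqVlt => /predU1P[<-//|x0].
have cf : {within `[0, x], continuous f}.
  by apply: continuous_subspaceT; exact: is_derive_continuous dF.
have [c cx E] := @MVT R f df 0 x x0 (fun y _ => dF y) cf.
rewrite -subr_ge0 E subr0 mulr_ge0 ?(ltW x0)// df0//.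
by move: cx; rewrite in_itv/= => /andP[/ltW].
Qed.

Lemma sin_le (x : R) : 0 <= x -> sin x <= x.
Proof.
move=> x0; rewrite -subr_ge0.
have := @ge0_derive_homo (fun x => x - sin x) (fun x => 1 - cos x) _ _ x x0.
by rewrite sin0 subrr; apply=> // y _; rewrite subr_ge0 cos_le1.
Qed.

Lemma cos_ge (x : R) : 0 <= x -> 1 - x ^+ 2 / 2 <= cos x.
Proof.
move=> x0; rewrite -subr_ge0.
have := @ge0_derive_homo (fun x => cos x + x ^+ 2 / 2) (fun x => x - sin x) _ _ x x0.
rewrite cos0 expr0n/= mul0r addr0 => H.
have -> : cos x - (1 - x ^+ 2 / 2) = cos x + x ^+ 2 / 2 - 1 by ring.
rewrite subr_ge0; apply: H.
- move=> y.
  have d1 : is_derive y 1 (fun x : R => x ^+ 2 / 2) y.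
    have D := is_deriveM (is_deriveX 2%N (is_derive_id y 1)) (is_derive_cst (2^-1 : R) y 1).
    by apply: (is_derive_conv D) => //; rewrite scaler0 add0r /= /GRing.scale/=; field.
  by rewrite addrC; exact: (is_deriveD (is_derive_cos y) d1).
- by move=> y y0; rewrite subr_ge0 sin_le.
Qed.

Lemma sin_ge (x : R) : 0 <= x -> x - x ^+ 3 / 6 <= sin x.
Proof.
move=> x0; rewrite -subr_ge0.
have := @ge0_derive_homo (fun x => sin x - (x - x ^+ 3 / 6)) (fun x => cos x - (1 - x ^+ 2 / 2)) _ _ x x0.
rewrite sin0 expr0n/= mul0r !subr0; apply.
- move=> y.
  have d1 : is_derive y 1 (fun x : R => x ^+ 3 / 6) (y ^+ 2 / 2).
    have D := is_deriveM (is_deriveX 3%N (is_derive_id y 1)) (is_derive_cst (6^-1 : R) y 1).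
    by apply: (is_derive_conv D) => //; rewrite scaler0 add0r /= /GRing.scale/=; field.
  exact: (is_deriveB (is_derive_sin y) (is_deriveB (is_derive_id y 1) d1)).
- by move=> y y0; rewrite subr_ge0 cos_ge.
Qed.

(** Both squares are compared through x - x^3 / 6 <= sin x <= x. The double pole
    at 0 cancels, and this is what makes the remainder of the cotangent below
    Lipschitz. *)
Lemma inv_sin2_bound (x : R) : 0 < x -> x <= 2 ->
  0 <= (sin x ^+ 2)^-1 - (x ^+ 2)^-1 <= 3.
Proof.
move=> x0 x2.
have s1 := sin_le (ltW x0); have s2 := sin_ge (ltW x0).
have s3 : x / 3 <= sin x.
  apply: le_trans s2; rewrite -subr_ge0.
  have -> : x - x ^+ 3 / 6 - x / 3 = x * (2 - x) * (2 + x) / 6 by field.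
  have h0 := ltW x0; have h2 : 0 <= 2 - x by rewrite subr_ge0.
  by rewrite !mulr_ge0// addr_ge0.
have s0 : 0 < sin x by rewrite (lt_le_trans _ s3)// divr_gt0.
have xx : 0 < x ^+ 2 by rewrite exprn_gt0.
have ss : 0 < sin x ^+ 2 by rewrite exprn_gt0.
have -> : (sin x ^+ 2)^-1 - (x ^+ 2)^-1 =
    ((x - sin x) * (x + sin x)) / (x ^+ 2 * sin x ^+ 2).
  by field; rewrite !gt_eqF.
apply/andP; split.
  by rewrite divr_ge0// ?mulr_ge0// ?subr_ge0// ?addr_ge0// ltW.
rewrite ler_pdivrMr ?mulr_gt0//.
have h1 : x - sin x <= x ^+ 3 / 6 by rewrite lerBlDr -lerBlDl.
apply: (@le_trans _ _ ((x ^+ 3 / 6) * (x + x))).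
  by apply: ler_pM; rewrite ?subr_ge0// ?addr_ge0 ?lerD2l// ltW.
have h2 : (x / 3) ^+ 2 <= sin x ^+ 2 by rewrite lerXn2r ?nnegrE ?divr_ge0// ltW.
apply: (@le_trans _ _ (3 * (x ^+ 2 * (x / 3) ^+ 2))).
  by rewrite le_eqVlt; apply/orP; left; apply/eqP; field.
by rewrite !ler_pM2l.
Qed.

Definition cot (x : R) := cos x / sin x.

Lemma sinpi_gt0 (a : R) : 0 < a < 1 -> 0 < sin (pi * a).
Proof.
case/andP=> a0 a1; apply: sin_gt0_pi.
by rewrite mulr_gt0 ?pi_gt0//= gtr_pMr ?pi_gt0.
Qed.

Lemma sinpi_compl (a : R) : sin (pi * (1 - a)) = sin (pi * a).
Proof. by rewrite mulrBr mulr1 sinB sinpi cospi mul0r sub0r mulN1r opprK. Qed.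

Lemma cospi_compl (a : R) : cos (pi * (1 - a)) = - cos (pi * a).
Proof. by rewrite mulrBr mulr1 cosB sinpi cospi mul0r addr0 mulN1r. Qed.

(** pi cot (pi a) relieved of its two poles in [0, 1]. *)
Definition cot_remainder (a : R) := pi * cot (pi * a) - a^-1 + (1 - a)^-1.

Lemma is_derive_cot_remainder (a : R) : 0 < a < 1 -> is_derive a 1 cot_remainder
  (- pi ^+ 2 * (sin (pi * a) ^+ 2)^-1 + (a ^+ 2)^-1 + ((1 - a) ^+ 2)^-1).
Proof.
move=> a01; have /andP[a0 a1] := a01; have s0 := sinpi_gt0 a01.
have dl : is_derive a 1 (fun y : R => pi * y) (pi : R).
  by have := is_deriveZ (pi : R) (is_derive_id a 1); rewrite scaler1.
have ds := @is_derive1_comp _ (@sin R) _ _ _ _ (is_derive_sin _) dl.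
have dc := @is_derive1_comp _ (@cos R) _ _ _ _ (is_derive_cos _) dl.
have di := is_deriveV (f := fun y => sin (pi * y)) (lt0r_neq0 s0) ds.
have dm := is_deriveM dc di.
have dz := is_deriveZ (pi : R) dm.
have da := is_deriveV (f := @id R) (lt0r_neq0 a0) (is_derive_id a 1).
have d1 : is_derive a 1 (fun y : R => 1 - y) (-1).
  have := is_deriveB (is_derive_cst (1 : R) a 1) (is_derive_id a 1).
  by rewrite sub0r.
have a1' : 1 - a != 0 by rewrite subr_eq0 gt_eqF.
have db := is_deriveV (f := fun y : R => 1 - y) a1' d1.
apply: (is_derive_conv (is_deriveD (is_deriveB dz da) db)) => //.
rewrite /GRing.scale/=.
have := cos2Dsin2 (pi * a) => h.
have -> : cos (pi * a) * (- sin (pi * a) ^- 2 * (cos (pi * a) * pi)) +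
   (sin (pi * a))^-1 * (- sin (pi * a) * pi) =
   - pi * (cos (pi * a) ^+ 2 + sin (pi * a) ^+ 2) / sin (pi * a) ^+ 2.
  by field; rewrite gt_eqF.
by rewrite h; field; rewrite !gt_eqF// subr_gt0.
Qed.

(** The derivative is bounded on ]0, 1/2] by inv_sin2_bound, and on the other
    half by the symmetry a |-> 1 - a. *)
Lemma cot_remainder_lipschitz (a b : R) : 0 < a -> a <= b -> b < 1 ->
  `|cot_remainder a - cot_remainder b| <= (3 * pi ^+ 2 + 4) * (b - a).
Proof.
move=> a0 ab b1.
have bnd (x : R) : 0 < x -> x <= 1 / 2 ->
   0 <= pi ^+ 2 * (sin (pi * x) ^+ 2)^-1 - (x ^+ 2)^-1 <= 3 * pi ^+ 2.
  move=> x0 x2.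
  have px : 0 < pi * x by rewrite mulr_gt0 ?pi_gt0.
  have px2 : pi * x <= 2.
    by apply: le_trans (ltW (pihalf_lt2 R)); rewrite ler_pM2l ?pi_gt0// -div1r.
  have := inv_sin2_bound px px2.
  have pp : 0 < (pi : R) ^+ 2 by rewrite exprn_gt0 ?pi_gt0.
  have -> : pi ^+ 2 * (sin (pi * x) ^+ 2)^-1 - (x ^+ 2)^-1 =
    pi ^+ 2 * ((sin (pi * x) ^+ 2)^-1 - ((pi * x) ^+ 2)^-1).
    rewrite mulrBr exprMn [((pi ^+ 2 * _)^-1)]invfM mulrA divff ?mul1r//.
    by rewrite gt_eqF.
  move=> /andP[h1 h2]; rewrite mulr_ge0 ?(ltW pp)//=.
  by rewrite mulrC ler_pM2r.
have inv4 (x : R) : 1 / 2 <= x -> 0 <= (x ^+ 2)^-1 <= 4.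
  move=> x2; have x0 : 0 < x by rewrite (lt_le_trans _ x2).
  rewrite invr_ge0 sqr_ge0/= -[leRHS]invrK lef_pV2 ?posrE ?exprn_gt0//.
  have -> : (4 : R)^-1 = (1 / 2) ^+ 2 by field.
  by rewrite lerXn2r ?nnegrE ?(ltW x0).
have dbnd (x : R) : 0 < x < 1 -> `|(- pi ^+ 2 * (sin (pi * x) ^+ 2)^-1 +
    (x ^+ 2)^-1 + ((1 - x) ^+ 2)^-1)| <= 3 * pi ^+ 2 + 4.
  case/andP=> x0 x1; rewrite ler_norml.
  have pp : 0 <= (pi : R) ^+ 2 by rewrite sqr_ge0.
  have [x2|x2] := leP x (1 / 2).
    have /andP[h1 h2] := bnd x x0 x2.
    have /andP[h3 h4] : 0 <= ((1 - x) ^+ 2)^-1 <= 4.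
      by apply: inv4; rewrite lerBrDr -lerBrDl (le_trans x2)//; lra.
    by apply/andP; split; lra.
  have h5 : 1 - x <= 1 / 2 by lra.
  have h6 : 0 < 1 - x by lra.
  have /andP[h1 h2] := bnd (1 - x) h6 h5.
  have /andP[h3 h4] := inv4 x (ltW x2).
  by rewrite sinpi_compl in h1 h2; apply/andP; split; lra.
have dc (x : R) : x \in `]a, b[ -> is_derive x 1 cot_remainder
    (- pi ^+ 2 * (sin (pi * x) ^+ 2)^-1 + (x ^+ 2)^-1 + ((1 - x) ^+ 2)^-1).
  rewrite in_itv/= => /andP[ax xb]; apply: is_derive_cot_remainder.
  by rewrite (lt_trans a0 ax)/= (lt_trans xb).
have cc : {within `[a, b], continuous cot_remainder}.
  apply: derivable_within_continuous => x; rewrite in_itv/= => /andP[ax xb].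
  have := @is_derive_cot_remainder x.
  by rewrite (lt_le_trans a0 ax) (le_lt_trans xb b1) => /(_ isT)[].
have [c] := MVT_segment ab dc cc.
rewrite in_itv/= => /andP[ac cb] E.
rewrite distrC E normrM [X in _ * X]ger0_norm ?subr_ge0//.
rewrite ler_wpM2r ?subr_ge0// dbnd//.
by rewrite (lt_le_trans a0 ac) (le_lt_trans cb b1).
Qed.

Lemma measurable_invr : measurable_fun setT (fun x : R => x^-1).
Proof.
rewrite (_ : (fun x : R => x^-1) =
  (fun x => if x < 0 then - powR (- x) (-1) else powR x (-1))); last first.
  apply/funext => x; case: ltP => x0; last by rewrite powR_inv1.
  by rewrite powR_inv1 ?oppr_ge0 ?(ltW x0)// invrN opprK.
apply: measurable_fun_ifT.
- by apply: measurable_fun_ltr => //; exact: measurable_id.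
- apply: measurableT_comp => //.
  exact: (measurableT_comp (measurable_powR (-1)) (@oppr_measurable R setT)).
- exact: measurable_powR.
Qed.

Lemma measurable_expR_lin (p : R) : measurable_fun setT (fun x : R => expR (- (p * x))).
Proof.
apply: measurableT_comp; first exact: measurable_expR.
by apply: measurableT_comp => //; exact: mulrl_measurable.
Qed.

Definition half_exp (p x : R) := if 0 < x then expR (- (p * x)) else 0.

(** The integrand of Gauss's integral for psi b - psi a, with psi the digamma
    function. Here and in half_exp the half line is built into the integrand, so
    that translations and dilations of the line apply directly. *)
Definition frullani (a b x : R) :=
  if 0 < x then (expR (- (a * x)) - expR (- (b * x))) / (1 - expR (- x)) else 0.

Lemma measurable_pos : measurable_fun setT (fun x : R => 0 < x).
Proof. by apply: measurable_fun_ltr => //; exact: measurable_id. Qed.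

Lemma measurable_half_exp p : measurable_fun setT (half_exp p).
Proof.
apply: measurable_fun_ifT => //; first exact: measurable_pos.
exact: measurable_expR_lin.
Qed.

Lemma measurable_frullani a b : measurable_fun setT (frullani a b).
Proof.
apply: measurable_fun_ifT => //; first exact: measurable_pos.
apply: measurable_funM.
  by apply: measurable_funB; exact: measurable_expR_lin.
apply: (measurableT_comp measurable_invr).
apply: measurable_funB => //.
by apply: measurableT_comp => //; exact: measurable_expR.
Qed.

Lemma half_exp_ge0 p x : 0 <= half_exp p x.
Proof. by rewrite /half_exp; case: ifP; rewrite ?expR_ge0. Qed.

Lemma subr_expRN_gt0 (x : R) : 0 < x -> 0 < 1 - expR (- x).
Proof. by move=> x0; rewrite subr_gt0 expR_lt1 oppr_lt0. Qed.

Lemma frullani_ge0 a b x : a <= b -> 0 <= frullani a b x.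
Proof.
move=> ab; rewrite /frullani; case: ifP => // x0.
rewrite divr_ge0// ?(ltW (subr_expRN_gt0 x0))//.
by rewrite subr_ge0 ler_expR lerN2 ler_pM2r.
Qed.

Lemma integral_half_exp (p : R) : 0 < p ->
  (\int[mu]_x (half_exp p x)%:E = (p^-1)%:E)%E.
Proof.
move=> p0; rewrite -(integral_expR_halfline p0).
rewrite -integral_itv_obnd_cbnd; last first.
  by apply/measurable_EFinP; apply: measurable_funTS; exact: measurable_expR_lin.
rewrite [RHS]integral_mkcond; apply: eq_integral => x _.
by rewrite patchE mem_setE in_itv/= andbT /half_exp; case: ifP.
Qed.

(** The functional equation psi (a + 1) = psi a + 1 / a, in a form without
    subtraction so that infinite values need not be excluded. *)
Lemma frullani_shift (a b : R) : 0 < a -> a <= b ->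
  (\int[mu]_x (frullani a b x)%:E + (b^-1)%:E =
   (a^-1)%:E + \int[mu]_x (frullani (a + 1) (b + 1) x)%:E)%E.
Proof.
move=> a0 ab; have b0 : 0 < b by rewrite (lt_le_trans a0).
have mh p : measurable_fun setT (EFin \o half_exp p).
  by apply/measurable_EFinP; exact: measurable_half_exp.
have mf p q : measurable_fun setT (EFin \o frullani p q).
  by apply/measurable_EFinP; exact: measurable_frullani.
rewrite -(integral_half_exp a0) -(integral_half_exp b0) -!ge0_integralD//=;
  try exact: mh; try exact: mf;
  try by move=> x _; rewrite lee_fin ?half_exp_ge0 ?frullani_ge0 ?lerD2r.
apply: eq_integral => x _; rewrite -!EFinD; congr (_%:E).
rewrite /frullani /half_exp; case: ifP => x0; last by rewrite addr0.
rewrite !mulrDl !mul1r !opprD !expRD; field.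
by rewrite gt_eqF// subr_expRN_gt0.
Qed.

(** Away from the poles the integral is of the order of b - a: its numerator is
    at most (b - a) x exp (- x), and x exp (- x) / (1 - exp (- x)) <= 2 exp (- x
    / 2). *)
Lemma frullani_small (a b : R) : 0 < a -> a <= b ->
  (\int[mu]_x (frullani (a + 1) (b + 1) x)%:E <= (4 * (b - a))%:E)%E.
Proof.
move=> a0 ab.
have -> : (4 * (b - a))%:E = ((2 * (b - a))%:E * \int[mu]_x (half_exp (1 / 2) x)%:E)%E.
  by rewrite integral_half_exp// -EFinM; congr (_%:E); field.
have ba : 0 <= 2 * (b - a) by rewrite mulr_ge0// subr_ge0.
rewrite -ge0_integralZl//=; last 2 first.
- by apply/measurable_EFinP; exact: measurable_half_exp.
- by move=> x _; rewrite lee_fin half_exp_ge0.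
apply: ge0_le_integral => //=.
- by move=> x _; rewrite lee_fin frullani_ge0// lerD2r.
- by apply/measurable_EFinP; exact: measurable_frullani.
- by apply/measurable_EFinP; apply: measurable_funM => //; exact: measurable_half_exp.
move=> x _; rewrite -EFinM lee_fin /frullani /half_exp; case: ifP => x0; last by rewrite mulr0.
rewrite ler_pdivrMr ?subr_expRN_gt0//.
set E := expR (- (1 / 2 * x)).
have E0 : 0 < E by exact: expR_gt0.
have EE : expR (- x) = E * E by rewrite -expRD; congr (expR _); field.
have E1 : (x / 2) * E <= 1 - E.
  have := expR_ge1Dx (x / 2); rewrite -(ler_pM2r E0) -expRD.
  have -> : x / 2 + - (1 / 2 * x) = 0 by field.
  by rewrite expR0 mulrDl mul1r -lerBrDl.
have E2 : E < 1 by rewrite expR_lt1 oppr_lt0 mulr_gt0.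
have n1 : expR (- ((a + 1) * x)) - expR (- ((b + 1) * x)) <= expR (- x) * ((b - a) * x).
  have -> : - ((b + 1) * x) = - ((a + 1) * x) - (b - a) * x by ring.
  rewrite expRD.
  have h := expR_ge1Dx (- ((b - a) * x)).
  apply: (@le_trans _ _ (expR (- ((a + 1) * x)) * ((b - a) * x))).
    rewrite -subr_ge0.
    have -> : expR (- ((a + 1) * x)) * ((b - a) * x) -
      (expR (- ((a + 1) * x)) - expR (- ((a + 1) * x)) * expR (- ((b - a) * x))) =
      expR (- ((a + 1) * x)) * (expR (- ((b - a) * x)) - (1 + - ((b - a) * x))) by ring.
    by rewrite mulr_ge0 ?expR_ge0// subr_ge0.
  rewrite ler_wpM2r ?mulr_ge0 ?subr_ge0 ?(ltW x0)//.
  by rewrite ler_expR lerN2 mulrDl mul1r lerDr mulr_ge0 ?ltW.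
apply: (le_trans n1); rewrite EE.
have -> : E * E * ((b - a) * x) = 2 * (b - a) * E * ((x / 2) * E) by field.
rewrite ler_wpM2l ?mulr_ge0 ?subr_ge0 ?(ltW E0)//.
apply: (le_trans E1); rewrite lerD2l lerN2.
by rewrite ger_pMl// ltW.
Qed.

(** The duplication formula of the digamma function: after the dilation x |-> x
    / 2 it is the factorization of 1 - exp (- x) as a difference of squares. *)
Lemma frullani_dup (a b : R) : a <= b ->
  (\int[mu]_x (frullani (a / 2) (b / 2) x)%:E +
   \int[mu]_x (frullani ((a + 1) / 2) ((b + 1) / 2) x)%:E =
   2%:E * \int[mu]_x (frullani a b x)%:E)%E.
Proof.
move=> ab.
have mf p q : measurable_fun setT (EFin \o frullani p q).
  by apply/measurable_EFinP; exact: measurable_frullani.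
rewrite -ge0_integralD//=; try exact: mf;
  try by move=> x _; rewrite lee_fin frullani_ge0// ler_pM2r// lerD2r.
rewrite -(@ge0_integral_affine _ (1 / 2) 0 (fun x => (frullani a b x)%:E))//; last 2 first.
- exact: mf.
- by move=> x; rewrite lee_fin frullani_ge0.
rewrite muleA -EFinM mulrA mulr1 divff// mul1e.
apply: eq_integral => x _; rewrite -EFinD; congr (_%:E).
rewrite /frullani addr0 pmulr_rgt0//; case: ifP => x0; last by rewrite addr0.
have -> : - (a / 2 * x) = - (a * (1 / 2 * x)) by field.
have -> : - (b / 2 * x) = - (b * (1 / 2 * x)) by field.
have -> : - ((a + 1) / 2 * x) = - (a * (1 / 2 * x)) + - (1 / 2 * x) by field.
have -> : - ((b + 1) / 2 * x) = - (b * (1 / 2 * x)) + - (1 / 2 * x) by field.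
have EE : expR (- x) = expR (- (1 / 2 * x)) * expR (- (1 / 2 * x)).
  by rewrite -expRD; congr (expR _); field.
have h1 : 0 < 1 - expR (- (1 / 2 * x)) by apply: subr_expRN_gt0; rewrite mulr_gt0.
have h2 := expR_gt0 (- (1 / 2 * x)).
rewrite !expRD EE; field.
have -> : 1 - expR (- (1 / 2 * x)) * expR (- (1 / 2 * x)) =
  (1 - expR (- (1 / 2 * x))) * (1 + expR (- (1 / 2 * x))) by ring.
by rewrite mulf_neq0 ?gt_eqF// addr_gt0.
Qed.

Definition kappa (a b : R) := fine (\int[mu]_x (frullani a b x)%:E)%E.

Lemma kappaE (a b : R) : 0 < a -> a <= b ->
  (\int[mu]_x (frullani a b x)%:E = (kappa a b)%:E)%E.
Proof.
move=> a0 ab; have b0 : 0 < b by rewrite (lt_le_trans a0).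
rewrite /kappa fineK// ge0_fin_numE; last first.
  by apply: integral_ge0 => x _; rewrite lee_fin frullani_ge0.
have := frullani_shift a0 ab; have := frullani_small a0 ab.
case: (\int[mu]_x (frullani (a + 1) (b + 1) x)%:E)%E => [r| |] //= _.
  by case: (\int[mu]_x (frullani a b x)%:E)%E => [r'| |]//; rewrite ltry.
by case: (\int[mu]_x (frullani a b x)%:E)%E => [r'| |]//; rewrite ltry.
Qed.

Lemma kappa_bound (a b : R) : 0 < a -> a <= b ->
  0 <= kappa a b - (a^-1 - b^-1) <= 4 * (b - a).
Proof.
move=> a0 ab; have b0 : 0 < b by rewrite (lt_le_trans a0).
have := frullani_shift a0 ab; have := frullani_small a0 ab.
have h0 : 0 <= kappa (a + 1) (b + 1).
  by apply: fine_ge0; apply: integral_ge0 => x _; rewrite lee_fin frullani_ge0// lerD2r.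
have -> : (\int[mu]_x (frullani (a + 1) (b + 1) x)%:E = (kappa (a + 1) (b + 1))%:E)%E.
  by apply: kappaE; rewrite ?addr_gt0 ?lerD2r.
rewrite (kappaE a0 ab) -!EFinD lee_fin => h [E].
move: (kappa a b) (kappa (a + 1) (b + 1)) E h h0 => k1 k2 E h h0.
by apply/andP; split; lra.
Qed.

Lemma kappa_dup (a b : R) : 0 < a -> a <= b ->
  kappa (a / 2) (b / 2) + kappa ((a + 1) / 2) ((b + 1) / 2) = 2 * kappa a b.
Proof.
move=> a0 ab; have := frullani_dup ab.
have a1 : 0 < a + 1 by rewrite addr_gt0.
have -> : (\int[mu]_x (frullani (a / 2) (b / 2) x)%:E = (kappa (a / 2) (b / 2))%:E)%E.
  by apply: kappaE; rewrite ?divr_gt0 ?ler_pM2r.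
have -> : (\int[mu]_x (frullani ((a + 1) / 2) ((b + 1) / 2) x)%:E =
    (kappa ((a + 1) / 2) ((b + 1) / 2))%:E)%E.
  by apply: kappaE; rewrite ?divr_gt0 ?ler_pM2r ?lerD2r.
by rewrite (kappaE a0 ab) -EFinD -EFinM => -[].
Qed.

Lemma cot_dup (a : R) : 0 < a < 1 ->
  cot (pi * (a / 2)) + cot (pi * ((a + 1) / 2)) = 2 * cot (pi * a).
Proof.
move=> /andP[a0 a1].
have s0 : 0 < sin (pi * (a / 2)) by apply: sinpi_gt0; apply/andP; split; lra.
have c0 : 0 < cos (pi * (a / 2)).
  rewrite -sinDpihalf.
  have -> : pi * (a / 2) + pi / 2 = pi * ((a + 1) / 2) by field.
  by apply: sinpi_gt0; apply/andP; split; lra.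
rewrite /cot.
have -> : pi * ((a + 1) / 2) = pi * (a / 2) + pi / 2 by field.
rewrite cosDpihalf sinDpihalf.
have -> : pi * a = pi * (a / 2) + pi * (a / 2) by field.
rewrite cosD sinD; field.
by rewrite (mulrC (cos _)) !gt_eqF// addr_gt0// mulr_gt0.
Qed.

(** What has to vanish for the reflection formula of the digamma function to
    hold. *)
Definition cot_defect (a b : R) :=
  kappa a b + kappa (1 - b) (1 - a) - (pi * cot (pi * a) - pi * cot (pi * b)).

Lemma cot_defect_dup (a b : R) : 0 < a -> a <= b -> b < 1 ->
  cot_defect (a / 2) (b / 2) + cot_defect ((a + 1) / 2) ((b + 1) / 2) = 2 * cot_defect a b.
Proof.
move=> a0 ab b1.
have b0 : 0 < b by rewrite (lt_le_trans a0).
have a1 : a < 1 by rewrite (le_lt_trans ab).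
have k1 := kappa_dup a0 ab.
have b1' : 0 < 1 - b by rewrite subr_gt0.
have ab' : 1 - b <= 1 - a by rewrite lerD2l lerN2.
have k2 := kappa_dup b1' ab'.
have ca : cot (pi * (a / 2)) + cot (pi * ((a + 1) / 2)) = 2 * cot (pi * a).
  by apply: cot_dup; rewrite a0.
have cb : cot (pi * (b / 2)) + cot (pi * ((b + 1) / 2)) = 2 * cot (pi * b).
  by apply: cot_dup; rewrite b0.
rewrite /cot_defect.
have -> : 1 - b / 2 = (1 - b + 1) / 2 by field.
have -> : 1 - a / 2 = (1 - a + 1) / 2 by field.
have -> : 1 - (b + 1) / 2 = (1 - b) / 2 by field.
have -> : 1 - (a + 1) / 2 = (1 - a) / 2 by field.
move: kappa cot pi k1 k2 ca cb => k c p k1 k2 ca cb.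
have -> : 2 * (k a b + k (1 - b) (1 - a) - (p * c (p * a) - p * c (p * b))) =
  2 * k a b + 2 * k (1 - b) (1 - a) - (p * (2 * c (p * a)) - p * (2 * c (p * b))) by ring.
by rewrite -k1 -k2 -ca -cb; ring.
Qed.

Lemma cot_defect_lipschitz (a b : R) : 0 < a -> a <= b -> b < 1 ->
  `|cot_defect a b| <= (3 * pi ^+ 2 + 12) * (b - a).
Proof.
move=> a0 ab b1.
have /andP[h1 h2] := kappa_bound a0 ab.
have b1' : 0 < 1 - b by rewrite subr_gt0.
have ab' : 1 - b <= 1 - a by rewrite lerD2l lerN2.
have /andP[h3 h4] := kappa_bound b1' ab'.
have := cot_remainder_lipschitz a0 ab b1.
rewrite ler_norml => /andP[h5 h6].
rewrite /cot_defect ler_norml; rewrite /cot_remainder in h5 h6.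
move: (kappa a b) (kappa (1 - b) (1 - a)) (cot (pi * a)) (cot (pi * b)) (pi) h1 h2 h3 h4 h5 h6
  => k1 k2 c1 c2 p h1 h2 h3 h4 h5 h6.
by apply/andP; split; lra.
Qed.

(** Herglotz's trick: by duplication the defect on [a, b] is the mean of two
    defects on intervals of half the length, so that a Lipschitz bound can be
    halved indefinitely. *)
Lemma cot_defect_eq0 (a b : R) : 0 < a -> a <= b -> b < 1 -> cot_defect a b = 0.
Proof.
set C : R := 3 * pi ^+ 2 + 12.
have H n : forall a b : R, 0 < a -> a <= b -> b < 1 -> `|cot_defect a b| <= C * (b - a) / 2 ^+ n.
  elim: n => [|n IH] {}a {}b a0 ab b1.
    by rewrite expr0 divr1; exact: cot_defect_lipschitz.
  have E := cot_defect_dup a0 ab b1.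
  have i1 : `|cot_defect (a / 2) (b / 2)| <= C * (b / 2 - a / 2) / 2 ^+ n by apply: IH; lra.
  have i2 : `|cot_defect ((a + 1) / 2) ((b + 1) / 2)| <= C * ((b + 1) / 2 - (a + 1) / 2) / 2 ^+ n.
    by apply: IH; lra.
  have -> : cot_defect a b = (cot_defect (a / 2) (b / 2) + cot_defect ((a + 1) / 2) ((b + 1) / 2)) / 2.
    by rewrite E; field.
  rewrite normrM [X in _ * X]ger0_norm// ler_pdivrMr//.
  apply: (le_trans (ler_normD _ _)); apply: (le_trans (lerD i1 i2)).
  rewrite le_eqVlt; apply/orP; left; apply/eqP; rewrite exprS; field.
  by rewrite expf_neq0.
move=> a0 ab b1; apply/eqP; rewrite -normr_le0.
have L : (C * (b - a)) * (2^-1) ^+ n @[n --> \oo] --> (0 : R).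
  rewrite -[X in _ --> X](mulr0 (C * (b - a))); apply: cvgMr.
  by apply: cvg_expr; rewrite ger0_norm// invf_lt1// ltr1n.
rewrite -(cvg_lim (@Rhausdorff R) L); apply: limr_ge; first by apply/cvg_ex; eexists; exact: L.
by near=> n; rewrite exprVn; exact: H.
Unshelve. all: by end_near. Qed.

(** Each half line contributes a Frullani integral, and these two add up to the
    cotangents by cot_defect_eq0. *)
Lemma integral_exp_ratio (a b : R) : 0 < a -> a <= b -> b < 1 ->
  (\int[mu]_x ((expR (a * x) - expR (b * x)) / (1 - expR x))%:E =
   (pi * cot (pi * a) - pi * cot (pi * b))%:E)%E.
Proof.
move=> a0 ab b1.
have mf p q : measurable_fun setT (EFin \o frullani p q).
  by apply/measurable_EFinP; exact: measurable_frullani.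
have ba1 : 1 - b <= 1 - a by lra.
have -> : pi * cot (pi * a) - pi * cot (pi * b) = kappa a b + kappa (1 - b) (1 - a).
  by apply/esym/eqP; rewrite -subr_eq0; apply/eqP; exact: cot_defect_eq0.
rewrite EFinD -!kappaE//; last by rewrite subr_gt0.
rewrite -[X in (X + _)%E]ge0_integral_opp//; last 2 first.
- exact: mf.
- by move=> x; rewrite lee_fin frullani_ge0.
rewrite -ge0_integralD//=; try exact: mf;
  try by move=> x _; rewrite lee_fin frullani_ge0.
- apply: eq_integral => x _; rewrite -EFinD; congr (_%:E).
  rewrite /frullani oppr_gt0; case: (ltgtP x 0) => [x0|x0|->].
  + by rewrite !mulrN !opprK addr0.
  + rewrite add0r.
    have e1 : - ((1 - b) * x) = b * x + - x by ring.
    have e2 : - ((1 - a) * x) = a * x + - x by ring.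
    rewrite e1 e2 !expRD expRN.
    have h := expR_gt0 x.
    have h2 : 1 < expR x by rewrite expR_gt1.
    field; rewrite gt_eqF//=; apply/andP; split.
      by rewrite subr_eq0 gt_eqF.
    by rewrite subr_eq0 lt_eqF.
  + by rewrite !mulr0 subrr mul0r addr0.
- by apply: (measurableT_comp (mf a b)) => //; exact: oppr_measurable.
Qed.

End cotangent.

(** * The reflection formula and Mellin kernels *)

Section kernels.
Context {R : realType}.
Local Notation mu := (@lebesgue_measure R).

Lemma eq_integral_except (c : R) (f g : R -> \bar R) :
  measurable_fun setT f -> measurable_fun setT g ->
  (forall x, 0 <= f x)%E -> (forall x, 0 <= g x)%E ->
  (forall x, x != c -> f x = g x) -> (\int[mu]_x f x = \int[mu]_x g x)%E.
Proof.
move=> mf mg f0 g0 fg; apply: ge0_ae_eq_integral => //.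
exists [set c]; split => //; first exact: lebesgue_measure_set1.
by move=> x /=; apply: contra_notP => /eqP xc _; exact: fg.
Qed.

Lemma lebesgue_tonelli (f : R -> R -> \bar R) :
  measurable_fun setT (fun p : R * R => f p.1 p.2) ->
  (forall x y, 0 <= f x y)%E ->
  (\int[mu]_x \int[mu]_y f x y = \int[mu]_y \int[mu]_x f x y)%E.
Proof.
move=> mf f0.
by have := @fubini_tonelli _ _ _ _ _ (@lebesgue_measure R) (@lebesgue_measure R) _ mf
  (fun p => f0 p.1 p.2).
Qed.

Lemma measurable_integral2 d1 d2 (T1 : measurableType d1) (T2 : measurableType d2)
  (m2 : {sigma_finite_measure set T2 -> \bar R}) (f : T1 -> T2 -> \bar R) :
  measurable_fun setT (fun p : T1 * T2 => f p.1 p.2) ->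
  (forall x y, 0 <= f x y)%E ->
  measurable_fun setT (fun x => (\int[m2]_y f x y)%E).
Proof.
move=> mf f0.
exact: (@measurable_fun_fubini_tonelli_F _ _ _ _ _ m2 _ mf (fun p => f0 p.1 p.2)).
Qed.

Lemma ge0_integral_shift (c : R) (f : R -> \bar R) :
  measurable_fun setT f -> (forall x, 0 <= f x)%E ->
  (\int[mu]_x f (x + c)%R = \int[mu]_x f x)%E.
Proof.
move=> mf f0; rewrite -(ge0_integral_affine c ltr01 mf f0) mul1e.
by under [in RHS]eq_integral do rewrite mul1r.
Qed.

Lemma integral_gumbel_mellin (p : R) : -1 < p ->
  (\int[mu]_z (expR (p * z) * gumbel z)%:E = (euler_gamma (1 + p))%:E)%E.
Proof.
move=> p1; rewrite -euler_gammaE; last by lra.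
apply: eq_integral => z _; rewrite /gumbel -expRD; congr (expR _)%:E; ring.
Qed.

Lemma measurable_expR_lin2 (p c : R) : measurable_fun setT (fun x : R => expR (p * x + c)).
Proof.
apply: measurableT_comp; first exact: measurable_expR.
by apply: measurable_funD => //; exact: mulrl_measurable.
Qed.

Lemma measurable_exp_ratio (a b : R) :
  measurable_fun setT (fun x : R => (expR (a * x) - expR (b * x)) / (1 - expR x)).
Proof.
apply: measurable_funM.
  apply: measurable_funB.
    apply: measurableT_comp; [exact: measurable_expR|exact: mulrl_measurable].
  apply: measurableT_comp; [exact: measurable_expR|exact: mulrl_measurable].
apply: (measurableT_comp measurable_invr).
by apply: measurable_funB => //; exact: measurable_expR.
Qed.

Lemma exp_ratio_ge0 (a b x : R) : a <= b -> 0 <= (expR (a * x) - expR (b * x)) / (1 - expR x).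
Proof.
move=> ab; case: (ltgtP x 0) => [x0|x0|->]; last by rewrite !mulr0 subrr mul0r.
  rewrite divr_ge0// ?subr_ge0 ?ler_expR ?ler_wnM2r ?(ltW x0)//.
  by rewrite -expR0 ler_expR ltW.
rewrite -mulrNN -invrN !opprB; apply: divr_ge0.
  by rewrite subr_ge0 ler_expR ler_wpM2r// ltW.
by rewrite subr_ge0 -[leLHS]expR0 ler_expR ltW.
Qed.

(** With w = x / 2 and u = exp w, the identity 1 / (1 + u) = (1 - u) / (1 - u^2)
    turns the integrand into one of integral_exp_ratio. *)
Lemma integral_logistic (z : R) : 0 < z < 1 ->
  (\int[mu]_w (expR ((1 - z) * w) / (1 + expR w))%:E = (pi / sin (pi * z))%:E)%E.
Proof.
move=> /andP[z0 z1].
have mf : measurable_fun setT (fun w : R => expR ((1 - z) * w) / (1 + expR w)).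
  apply: measurable_funM.
    by apply: measurableT_comp; [exact: measurable_expR|exact: mulrl_measurable].
  apply: (measurableT_comp measurable_invr).
  by apply: measurable_funD => //; exact: measurable_expR.
have f0 (w : R) : 0 <= expR ((1 - z) * w) / (1 + expR w).
  by rewrite divr_ge0// ?expR_ge0// addr_ge0// expR_ge0.
have h2 : 0 < 1 / 2 :> R by [].
rewrite -(ge0_integral_affine 0 h2); last 2 first.
- exact/measurable_EFinP.
- by move=> x; rewrite lee_fin.
rewrite (@eq_integral_except 0 _ (fun w => ((expR ((1 - z) / 2 * w) - expR ((2 - z) / 2 * w)) / (1 - expR w))%:E)); last 5 first.
- apply/measurable_EFinP; apply: (measurableT_comp mf).
  by apply: measurable_funD => //; exact: mulrl_measurable.
- by apply/measurable_EFinP; exact: measurable_exp_ratio.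
- by move=> x; rewrite lee_fin.
- by move=> x; rewrite lee_fin exp_ratio_ge0//; lra.
- move=> w w0; congr (_%:E); rewrite addr0.
  have e1 : (2 - z) / 2 * w = (1 - z) * (1 / 2 * w) + 1 / 2 * w by field.
  have e2 : (1 - z) / 2 * w = (1 - z) * (1 / 2 * w) by field.
  have e3 : expR w = expR (1 / 2 * w) * expR (1 / 2 * w) by rewrite -expRD; congr (expR _); field.
  rewrite e1 e2 e3 expRD; have h := expR_gt0 (1 / 2 * w).
  have n1 : expR (1 / 2 * w) != 1.
    apply: contra_neq w0 => H.
    have : expR (1 / 2 * w) = expR 0 by rewrite expR0.
    by move=> /expR_inj; lra.
  move: (expR (1 / 2 * w)) h n1 (expR _) => E E0 n1 B; field.
  apply/andP; split; last by rewrite gt_eqF// addr_gt0.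
  have -> : 1 - E * E = (1 - E) * (1 + E) by ring.
  rewrite mulf_neq0//; first by rewrite subr_eq0 eq_sym.
  by rewrite gt_eqF// addr_gt0.
rewrite integral_exp_ratio; [|lra|lra|lra].
rewrite -EFinM; congr (_%:E); rewrite /cot.
have zz : 0 < z / 2 < 1 by apply/andP; split; lra.
have s0 := sinpi_gt0 zz.
have c0 : 0 < cos (pi * (z / 2)).
  rewrite -sinDpihalf.
  have -> : pi * (z / 2) + pi / 2 = pi * ((z + 1) / 2) by field.
  by apply: sinpi_gt0; apply/andP; split; lra.
have -> : (2 - z) / 2 = 1 - z / 2 by field.
have -> : pi * ((1 - z) / 2) = - (pi * (z / 2) - pi / 2) by field.
rewrite sinpi_compl cospi_compl cosN sinN cosBpihalf sinBpihalf.
have -> : pi * z = pi * (z / 2) + pi * (z / 2) by field.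
rewrite sinD.
have := cos2Dsin2 (pi * (z / 2)).
move: (sin (pi * (z / 2))) (cos (pi * (z / 2))) s0 c0 => s c s0 c0 h.
have -> : 1 / 2 * (pi * (s / - - c) - pi * (- c / s)) = pi * (c ^+ 2 + s ^+ 2) / (s * c + c * s).
  by field; rewrite (mulrC c) !gt_eqF// addr_gt0// mulr_gt0.
by rewrite h mulr1.
Qed.

(** The product is a double integral; translating the variable of the second
    Gamma integral by that of the first makes it the logarithm of their ratio,
    and Tonelli's theorem then leaves a Gumbel integral inside a logistic one. *)
Lemma euler_gamma_reflection (z : R) : 0 < z < 1 ->
  euler_gamma z * euler_gamma (1 - z) = pi / sin (pi * z).
Proof.
move=> z01; have /andP[z0 z1] := z01.
have z1' : 0 < 1 - z by rewrite subr_gt0.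
apply: EFin_inj; rewrite -(integral_logistic z01) EFinM -(euler_gammaE z0).
have mg p : measurable_fun setT (fun x : R => expR (p * x - expR x)).
  by apply: continuous_measurable_fun; exact: continuous_expR_affine.
rewrite -ge0_integralZr//=; last 2 first.
- by apply/measurable_EFinP; exact: mg.
- by rewrite lee_fin ltW// euler_gamma_gt0.
pose f (x w : R) : \bar R := (expR (x + (1 - z) * w - expR x * (1 + expR w)))%:E.
have mf : measurable_fun setT (fun p : R * R => f p.1 p.2).
  apply/measurable_EFinP; apply: measurableT_comp; first exact: measurable_expR.
  apply: measurable_funB.
    apply: measurable_funD => //; apply: measurable_funM => //.
  apply: measurable_funM; first by apply: measurableT_comp => //; exact: measurable_expR.
  apply: measurable_funD => //.
  by apply: measurableT_comp => //; exact: measurable_expR.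
transitivity (\int[mu]_x \int[mu]_w f x w)%E.
  apply: eq_integral => x _.
  rewrite -(euler_gammaE z1') -(ge0_integral_shift x); last 2 first.
  - exact/measurable_EFinP.
  - by move=> y; rewrite lee_fin expR_ge0.
  rewrite -ge0_integralZl//=; last first.
    apply/measurable_EFinP; apply: (measurableT_comp (mg (1 - z))).
    exact: measurable_funD.
  apply: eq_integral => w _; rewrite -EFinM -expRD /f; congr (expR _)%:E.
  by rewrite expRD; ring.
rewrite (lebesgue_tonelli mf); last by move=> x y; rewrite lee_fin expR_ge0.
apply: eq_integral => w _.
have w1 : 0 < 1 + expR w by rewrite addr_gt0// expR_gt0.
have E x : f x w = ((expR ((1 - z) * w) / (1 + expR w))%:E * (gumbel (x + ln (1 + expR w)))%:E)%E.
  rewrite /f /gumbel -EFinM; congr (_%:E).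
  have e1 : expR (x + ln (1 + expR w)) = expR x * (1 + expR w) by rewrite expRD lnK ?posrE.
  rewrite (expRB (x + ln (1 + expR w))) e1.
  rewrite (expRB (x + (1 - z) * w)) (expRD x).
  by field; rewrite !gt_eqF// expR_gt0.
under eq_integral do rewrite E.
rewrite ge0_integralZl//=; last 2 first.
- apply/measurable_EFinP; apply: (measurableT_comp measurable_gumbel).
  exact: measurable_funD.
- by move=> x _; rewrite lee_fin gumbel_ge0.
rewrite (ge0_integral_shift _ (f := fun x => (gumbel x)%:E)) ?integral_gumbel ?mule1//.
- by apply/measurable_EFinP; exact: measurable_gumbel.
- by move=> x; rewrite lee_fin gumbel_ge0.
Qed.

Lemma integral_expR_lin_pinfty (p : R) : p != 0 ->
  (\int[mu]_x (expR (p * x))%:E = +oo)%E.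
Proof.
wlog p0 : p / 0 < p.
  move=> H pn0; case: (ltgtP p 0) pn0 => // [p0|p0] _; last by rewrite H// gt_eqF.
  rewrite -ge0_integral_opp; last 2 first.
  - by apply/measurable_EFinP; under eq_fun do rewrite -[X in expR X]addr0; exact: measurable_expR_lin2.
  - by move=> x; rewrite lee_fin expR_ge0.
  under eq_integral do rewrite mulrN -mulNr.
  by rewrite H ?oppr_gt0// oppr_eq0 lt_eqF.
move=> _; apply/eqP; rewrite -leye_eq.
apply: (@le_trans _ _ (\int[mu]_(x in `[0%R, +oo[) (cst 1%:E) x)%E).
  by rewrite integral_cst//= lebesgue_measure_itv/= ltry mul1e.
have mE : measurable_fun setT (fun x : R => expR (p * x)).
  by under eq_fun do rewrite -[X in expR X]addr0; exact: measurable_expR_lin2.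
apply: (@le_trans _ _ (\int[mu]_(x in `[0%R, +oo[) (expR (p * x))%:E)%E).
  apply: ge0_le_integral => //=.
  - by apply/measurable_EFinP; exact: measurable_funTS.
  - move=> x; rewrite in_itv/= andbT => x0.
    by rewrite lee_fin -expR0 ler_expR mulr_ge0// ltW.
by apply: ge0_subset_integral => //=; exact/measurable_EFinP.
Qed.

(** A translation by the logarithm of t reduces this to the Gamma integral. At t
    = 0 and at t = +oo the integral is +oo and 0, in agreement with the
    conventions of epower. *)
Lemma mellin_survival (s : R) (t : \bar R) : s < 0 -> (0 <= t)%E ->
  (\int[mu]_x ((expR (- s * x))%:E * expeR (- ((expR x)%:E * t))) =
   (euler_gamma (- s))%:E * epower t s)%E.
Proof.
move=> s0; have s0' : 0 < - s by rewrite oppr_gt0.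
have g0 := euler_gamma_gt0 s0'.
case: t => [r| |]//.
- rewrite lee_fin le_eqVlt => /predU1P[<-|r0].
    under eq_integral do rewrite mule0 oppe0 expeR0 mule1.
    rewrite integral_expR_lin_pinfty ?oppr_eq0 ?lt_eqF// /epower le0_lneNy//.
    by rewrite lt0_muleNy ?lte_fin//= gt0_muley ?lte_fin.
  rewrite /epower lne_EFin//= -(euler_gammaE s0').
  have mg : measurable_fun setT (fun x : R => expR (- s * x - expR x)).
    by apply: continuous_measurable_fun; exact: continuous_expR_affine.
  rewrite -(ge0_integral_shift (ln r)); last 2 first.
  - exact/measurable_EFinP.
  - by move=> x; rewrite lee_fin expR_ge0.
  rewrite -ge0_integralZr//=; last first.
    apply/measurable_EFinP; apply: (measurableT_comp mg).
    exact: measurable_funD.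
  apply: eq_integral => x _; rewrite -!EFinM -!expRD; congr (expR _)%:E.
  by rewrite expRD lnK ?posrE//; ring.
- move=> _; rewrite integral0_eq => [|x _].
    by rewrite /epower /= lt0_muley ?lte_fin//= mule0.
  by rewrite gt0_muley ?lte_fin ?expR_gt0//= mule0.
Qed.

(** 1 - exp (- exp x) is the integral of the Gumbel density up to x; exchange
    the two integrations. *)
Lemma integral_mellin_distribution (s : R) : 0 < s -> s < 1 ->
  (\int[mu]_x (expR (- s * x) * (1 - expR (- expR x)))%:E =
   (euler_gamma (1 - s) / s)%:E)%E.
Proof.
move=> s0 s1.
pose f (x z : R) : \bar R := (expR (- s * x) * (gumbel z * (z < x)%R%:R))%:E.
have mf : measurable_fun setT (fun p : R * R => f p.1 p.2).
  apply/measurable_EFinP; apply: measurable_funM.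
    apply: measurableT_comp; first exact: measurable_expR.
    exact: measurable_funM.
  apply: measurable_funM; first by apply: (measurableT_comp measurable_gumbel).
  rewrite (_ : (fun p : R * R => _) = (fun p => if p.2 < p.1 then 1 else 0)); last first.
    by apply/funext => p; case: ifP.
  by apply: measurable_fun_ifT => //; exact: measurable_fun_ltr.
have f0 x z : (0 <= f x z)%E.
  by rewrite lee_fin !mulr_ge0 ?expR_ge0 ?gumbel_ge0.
transitivity (\int[mu]_x \int[mu]_z f x z)%E.
  apply: eq_integral => x _; rewrite EFinM.
  have := integral_gumbel_tail 0 (expR_ge0 x); rewrite expR0 mul1r => <-.
  rewrite -ge0_integralZl//=; last 2 first.
  - apply/measurable_EFinP; apply: measurable_funM.
      by apply: (measurableT_comp measurable_gumbel); exact: measurable_funD.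
    rewrite (_ : (fun p : R => _) = (fun p => if expR p < expR x then 1 else 0)); last first.
      by apply/funext => p; case: ifP.
    by apply: measurable_fun_ifT => //; apply: measurable_fun_ltr => //; exact: measurable_expR.
  - by move=> z _; rewrite lee_fin mulr_ge0 ?gumbel_ge0.
  by apply: eq_integral => z _; rewrite addr0 ltr_expR -EFinM.
rewrite (lebesgue_tonelli mf f0).
have s1' : 0 < 1 - s by rewrite subr_gt0.
rewrite EFinM -(euler_gammaE s1') -ge0_integralZr//=; last 2 first.
- by apply/measurable_EFinP; apply: continuous_measurable_fun; exact: continuous_expR_affine.
- by rewrite lee_fin invr_ge0 ltW.
apply: eq_integral => z _.
rewrite -(integral_half_exp s0) -(ge0_integral_shift (- z)); last 2 first.
- by apply/measurable_EFinP; exact: measurable_half_exp.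
- by move=> x; rewrite lee_fin half_exp_ge0.
rewrite -ge0_integralZl//=; last 2 first.
- apply/measurable_EFinP; apply: (measurableT_comp (measurable_half_exp s)).
  exact: measurable_funD.
- by move=> x _; rewrite lee_fin half_exp_ge0.
apply: eq_integral => x _; rewrite /f -EFinM; congr (_%:E).
rewrite /half_exp subr_gt0; case: ifP => _; last by rewrite !mulr0.
by rewrite mulr1 -!expRD; congr (expR _); ring.
Qed.

(** The counterpart of mellin_survival for positive exponents, where the kernel
    has to vanish at t = 0. *)
Lemma mellin_distribution (s : R) (t : \bar R) : 0 < s -> s < 1 -> (0 <= t)%E ->
  (\int[mu]_x ((expR (- s * x))%:E * (1 - expeR (- ((expR x)%:E * t)))) =
   (euler_gamma (1 - s) / s)%:E * epower t s)%E.
Proof.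
move=> s0 s1; have s1' : 0 < 1 - s by rewrite subr_gt0.
have g0 : 0 < euler_gamma (1 - s) / s by rewrite divr_gt0// euler_gamma_gt0.
case: t => [r| |]//.
- rewrite lee_fin le_eqVlt => /predU1P[<-|r0].
    under eq_integral do rewrite mule0 oppe0 expeR0 subee// mule0.
    by rewrite integral0 /epower le0_lneNy// gt0_muleNy ?lte_fin//= mule0.
  rewrite /epower lne_EFin//= -(integral_mellin_distribution s0 s1).
  have mg : measurable_fun setT (fun x : R => expR (- s * x) * (1 - expR (- expR x))).
    apply: measurable_funM.
      by under eq_fun do rewrite -[X in expR X]addr0; exact: measurable_expR_lin2.
    apply: measurable_funB => //; apply: measurableT_comp; first exact: measurable_expR.
    by apply: measurableT_comp => //; exact: measurable_expR.
  have g0' (x : R) : 0 <= expR (- s * x) * (1 - expR (- expR x)).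
    by rewrite mulr_ge0 ?expR_ge0// subr_ge0 -expR0 ler_expR oppr_le0 expR_ge0.
  rewrite -(ge0_integral_shift (ln r)); last 2 first.
  - exact/measurable_EFinP.
  - by move=> x; rewrite lee_fin.
  rewrite -ge0_integralZr//=; last first.
    apply/measurable_EFinP; apply: (measurableT_comp mg).
    exact: measurable_funD.
  apply: eq_integral => x _; rewrite -EFinB -!EFinM; congr (_%:E).
  rewrite [RHS]mulrAC -!expRD [expR (x + ln r)]expRD lnK ?posrE//.
  by congr (expR _ * _); ring.
- move=> _.
  under eq_integral.
    move=> x _; rewrite gt0_muley ?lte_fin ?expR_gt0//= sube0 mule1; over.
  rewrite integral_expR_lin_pinfty ?oppr_eq0 ?gt_eqF//.
  by rewrite /epower /= gt0_muley ?lte_fin//= gt0_muley ?lte_fin.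
Qed.

(** The Mellin transform of a multiplicative convolution is a product; in
    logarithmic variables this is a translation under Tonelli's theorem. *)
Lemma mellin_convolution (p : R) (h : R -> R) (psi : R -> \bar R) :
  measurable_fun setT h -> measurable_fun setT psi ->
  (forall x, 0 <= h x) -> (forall x, 0 <= psi x)%E ->
  (\int[mu]_v ((expR (p * v))%:E * \int[mu]_x ((h (x + v)%R)%:E * psi x)) =
   \int[mu]_z (expR (p * z) * h z)%:E * \int[mu]_x ((expR (- p * x))%:E * psi x))%E.
Proof.
move=> mh mpsi h0 psi0.
have mE q : measurable_fun setT (fun x : R => expR (q * x)).
  by under eq_fun do rewrite -[X in expR X]addr0; exact: measurable_expR_lin2.
pose f (v x : R) : \bar R := ((expR (p * v) * h (x + v)%R)%:E * psi x)%E.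
have mf : measurable_fun setT (fun q : R * R => f q.1 q.2).
  apply: emeasurable_funM; last by apply: measurableT_comp.
  apply/measurable_EFinP; apply: measurable_funM.
    by apply: (measurableT_comp (mE p)).
  apply: (measurableT_comp mh).
  exact: measurable_funD.
have f0 v x : (0 <= f v x)%E by rewrite mule_ge0// lee_fin mulr_ge0// expR_ge0.
transitivity (\int[mu]_v \int[mu]_x f v x)%E.
  apply: eq_integral => v _; rewrite -ge0_integralZl//=.
  - by apply: eq_integral => x _; rewrite /f EFinM muleA.
  - apply: emeasurable_funM => //; apply/measurable_EFinP.
    by apply: (measurableT_comp mh); exact: measurable_funD.
  - by move=> x _; rewrite mule_ge0// lee_fin.
rewrite (lebesgue_tonelli mf f0) -ge0_integralZl//=; last 3 first.
- by apply: emeasurable_funM => //; apply/measurable_EFinP; exact: mE.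
- by move=> x _; rewrite mule_ge0// lee_fin expR_ge0.
- by apply: integral_ge0 => x _; rewrite lee_fin mulr_ge0 ?expR_ge0.
apply: eq_integral => x _; rewrite muleA /f.
rewrite ge0_integralZr//=; last 2 first.
- apply/measurable_EFinP; apply: measurable_funM; first exact: mE.
  by apply: (measurableT_comp mh); exact: measurable_funD.
- by move=> v _; rewrite lee_fin mulr_ge0 ?expR_ge0.
congr (_ * _)%E.
rewrite -(ge0_integral_shift x (f := fun z => (expR (p * z) * h z)%:E)); last 2 first.
- by apply/measurable_EFinP; apply: measurable_funM => //; exact: mE.
- by move=> y; rewrite lee_fin mulr_ge0 ?expR_ge0.
rewrite -ge0_integralZr//=; last 2 first.
- apply/measurable_EFinP; apply: measurable_funM.
    by apply: (measurableT_comp (mE p)); exact: measurable_funD.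
  by apply: (measurableT_comp mh); exact: measurable_funD.
- by move=> y _; rewrite lee_fin mulr_ge0 ?expR_ge0.
apply: eq_integral => v _; rewrite -EFinM [v + x]addrC; congr (_%:E).
by rewrite mulrAC -expRD; congr (expR _ * _); ring.
Qed.

End kernels.

(** * Passage times seen on a grid *)

Section skeleton.
Context {R : realType}.

(** The weights (1 - r) r^n telescope, so those with r^n <= rho add up to at
    most rho. *)
Lemma geometric_weight_le (r rho : R) (b : nat -> bool) N : 0 <= r <= 1 -> 0 <= rho ->
  (forall n, b n -> r ^+ n <= rho) ->
  \sum_(n < N) (1 - r) * r ^+ n * (b n)%:R <= rho.
Proof.
move=> /andP[r0 r1] rho0 H.
(* The stronger bound keeps track of the mass already used and goes through by
   induction. *)
suff : \sum_(n < N) (1 - r) * r ^+ n * (b n)%:R <= Num.max 0 (rho - r ^+ N).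
  move/le_trans; apply; rewrite ge_max rho0 gerBl exprn_ge0//.
elim: N => [|N IH]; first by rewrite big_ord0 le_max lexx.
rewrite big_ord_recr/=.
have rN : r ^+ N.+1 <= r ^+ N by rewrite exprS ler_piMl// exprn_ge0.
case: (boolP (b N)) => bN; last first.
  rewrite mulr0 addr0 (le_trans IH)// ge_max le_max lexx/=.
  by rewrite le_max lerD2l lerN2 rN orbT.
have h := H _ bN.
rewrite le_max; apply/orP; right.
rewrite mulr1 (le_trans (lerD IH (lexx _)))// max_r ?subr_ge0//.
by rewrite exprS; lra.
Qed.

(** The weights (1 - r) r^n telescope, and from m to N they add up to r^m - r^N. *)
Lemma geometric_weight_ge (r : R) (b : nat -> bool) m N : 0 <= r <= 1 ->
  (forall n, (m <= n)%N -> b n) ->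
  r ^+ m - r ^+ N <= \sum_(n < N) (1 - r) * r ^+ n * (b n)%:R.
Proof.
move=> /andP[r0 r1] H.
have pos k : 0 <= \sum_(n < k) (1 - r) * r ^+ n * (b n)%:R.
  by apply: sumr_ge0 => n _; rewrite !mulr_ge0 ?subr_ge0// exprn_ge0.
elim: N => [|N IH].
  by rewrite big_ord0 expr0 subr_le0 exprn_ile1.
case: (boolP (b N)) => bN.
  rewrite big_ord_recr/= bN mulr1 exprS.
  have -> : r ^+ m - r * r ^+ N = r ^+ m - r ^+ N + (1 - r) * r ^+ N by ring.
  by rewrite lerD2r.
apply: le_trans (pos N.+1); rewrite subr_le0 ler_wiXn2l// ltnNge.
by apply: contra bN; exact: H.
Qed.

(** Stated with lindley, and not by the condition of grid_passageP, because
    lindley is what the random walk estimates are about. *)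
Definition grid_passage (x : R -> R) (h : R) n : bool :=
  (1 < lindley n (fun i => x (i.+1%:R * h) - x (i%:R * h))).

Lemma grid_passageP (x : R -> R) (h : R) n : x 0 = 0 ->
  grid_passage x h n <-> exists2 k, (k <= n)%N & 1 < x (k%:R * h).
Proof.
move=> x0; rewrite /grid_passage lt_lindley//.
have E k : \sum_(i < k) (x (i.+1%:R * h) - x (i%:R * h)) = x (k%:R * h).
  elim: k => [|k IH]; first by rewrite big_ord0 mul0r x0.
  by rewrite big_ord_recr/= IH addrC subrK.
by split=> -[k kn]; [rewrite E|rewrite -E] => h1; exists k.
Qed.

(** An approximation of exp (- q t), t the passage time above 1: the integral of
    q exp (- q u) over the times u up to N h by which the path has been seen
    above 1 on the grid of mesh h. *)
Definition grid_weight (x : R -> R) (q h : R) (N : nat) : R :=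
  \sum_(n < N) (1 - expR (- (q * h))) * expR (- (q * h)) ^+ n * (grid_passage x h n)%:R.

Lemma grid_weight_bounds (x : R -> R) (q h : R) N : 0 < q -> 0 < h ->
  0 <= grid_weight x q h N <= 1.
Proof.
move=> q0 h0.
have r01 : 0 <= expR (- (q * h)) <= 1.
  by rewrite expR_ge0 -expR0 ler_expR oppr_le0 mulr_ge0 ?ltW.
have /andP[r0 r1] := r01.
apply/andP; split.
  by apply: sumr_ge0 => n _; rewrite !mulr_ge0 ?subr_ge0// exprn_ge0.
by apply: geometric_weight_le => // n _; rewrite exprn_ile1.
Qed.

Definition path_passage (x : R -> R) : \bar R :=
  ereal_inf [set t%:E | t in [set t : R | 0 < t /\ 1 < x t]].

Lemma path_passage_ge0 (x : R -> R) : (0 <= path_passage x)%E.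
Proof. by apply/ereal_infP => _ [t [t0 _] <-]; rewrite lee_fin ltW. Qed.

Lemma expR_grid (q h : R) n : expR (- (q * h)) ^+ n = expR (- (q * (n%:R * h))).
Proof. by rewrite -expRM_natl; congr (expR _); ring. Qed.

(** A passage seen on the grid is a passage of the path, which bounds every grid
    weight by the limit. Conversely, if the path is above 1 at time t, it stays
    above 1 on some interval to the right of t by right-continuity, and this
    interval meets every fine enough grid. With 4^j steps of size of the order
    of 2^-j the horizon tends to infinity. *)
Lemma grid_weight_cvg (x : R -> R) (q c : R) : x 0 = 0 ->
  (forall t, 0 <= t -> x u @[u --> t^'+] --> x t) -> 0 < q -> 0 < c ->
  grid_weight x q (c * 2^-1 ^+ j) (4 ^ j) @[j --> \oo] -->
    fine (expeR (- (q%:E * path_passage x))).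
Proof.
move=> x0 rx q0 c0; set rho := fine _.
have T0 := path_passage_ge0 x.
have h0 j : 0 < c * 2^-1 ^+ j by rewrite mulr_gt0// exprn_gt0.
have r01 j : 0 <= expR (- (q * (c * 2^-1 ^+ j))) <= 1.
  by rewrite expR_ge0 expR_le1 oppr_le0 mulr_ge0 ?(ltW q0) ?(ltW (h0 j)).
have rho0 : 0 <= rho by apply: fine_ge0; exact: expeR_ge0.
have ub j : grid_weight x q (c * 2^-1 ^+ j) (4 ^ j) <= rho.
  apply: geometric_weight_le => // n /(grid_passageP _ _ x0)[k kn xk].
  have k0 : (0 < k)%N.
    by rewrite lt0n; apply: contraTN xk => /eqP ->; rewrite mul0r x0 -leNgt.
  have t0 : 0 < k%:R * (c * 2^-1 ^+ j) by rewrite mulr_gt0// ltr0n.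
  have : (path_passage x <= (k%:R * (c * 2^-1 ^+ j))%:E)%E.
    by apply: ereal_inf_lbound; exists (k%:R * (c * 2^-1 ^+ j)).
  move: T0; rewrite /rho expR_grid; case: (path_passage x) => [tau| |]//.
  rewrite !lee_fin /= => tau0 tauk; rewrite ler_expR lerN2 ler_pM2l//.
  by rewrite (le_trans tauk)// ler_pM2r// ler_nat.
have hN : (fun j => expR (- (q * (c * 2^-1 ^+ j))) ^+ (4 ^ j)) @ \oo --> (0 : R).
  have cvg2 : (fun j => (2 : R) ^+ j) @ \oo --> +oo.
    apply/cvgryPge => A; near=> j; apply: (@le_trans _ _ j%:R).
      by near: j; exact: nbhs_infty_ger.
    by rewrite -natrX ler_nat ltnW// ltn_expl.
  rewrite (_ : (fun j => _) = (fun j => expR (- (q * c * 2 ^+ j)))); last first.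
    apply/funext => j; rewrite expR_grid; congr (expR (- _)).
    rewrite natrX (_ : (4 : R) = 2 * 2); last by ring.
    rewrite exprMn exprVn; field.
    by rewrite expf_neq0.
  apply: (cvg_comp (fun j => q * c * 2 ^+ j) _ _ (@cvgr_expR R)).
  apply/cvgryPge => A; near=> j; rewrite -ler_pdivrMl ?mulr_gt0//.
  near: j; move/cvgryPge : cvg2; exact.
apply/cvgrPdist_le => eps eps0.
suff lb : \forall j \near \oo, rho - eps <= grid_weight x q (c * 2^-1 ^+ j) (4 ^ j).
  near=> j; rewrite ger0_norm ?subr_ge0// lerBlDr addrC -lerBlDr.
  by near: j.
have pos j : 0 <= grid_weight x q (c * 2^-1 ^+ j) (4 ^ j).
  by have /andP[] := grid_weight_bounds x (4 ^ j) q0 (h0 j).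
have [y0|y0] := leP (rho - eps) 0.
  by near=> j; exact: le_trans (pos j).
(* It suffices to find a grid passage before time sigma, which lies after the
   passage time. *)
have [sigma sE] : exists sigma, rho - eps = expR (- (q * sigma)).
  exists (- ln (rho - eps) / q).
  by rewrite mulrC divfK ?gt_eqF// opprK lnK.
have [t [[t0 xt] ts]] : exists t, (0 < t /\ 1 < x t) /\ t < sigma.
  have : (path_passage x < sigma%:E)%E.
    have : rho - eps < rho by rewrite gtrBl.
    rewrite sE /rho; move: T0; case: (path_passage x) => [tau| |]//=.
    - by rewrite !lee_fin lte_fin ltr_expR ltrN2 ltr_pM2l.
    - by rewrite gt0_muley ?lte_fin//= ltNge expR_ge0.
  move=> /ereal_inf_lt[_ [t tx <-]]; rewrite lte_fin => ts.
  by exists t.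
have [d d0 dx] : exists2 d : R, 0 < d & forall u, t < u -> u < t + d -> 1 < x u.
  have := rx t (ltW t0) => /cvgrPdist_lt /(_ (x t - 1)).
  rewrite subr_gt0 => /(_ xt) [d /= d0 dH]; exists d => // u tu ud.
  have := dH u; rewrite /ball_/= => /(_ _ tu).
  have -> : `|t - u| < d by rewrite distrC gtr0_norm ?subr_gt0// ltrBlDl.
  by move=> /(_ isT); rewrite ltr_norml => /andP[_]; lra.
pose s1 := (t + sigma) / 2.
have ts1 : t < s1 by rewrite /s1; lra.
have s1s : s1 < sigma by rewrite /s1; lra.
have e0 : 0 < expR (- (q * s1)) - expR (- (q * sigma)).
  by rewrite subr_gt0 ltr_expR ltrN2 ltr_pM2l.
near=> j.
have hd : c * 2^-1 ^+ j < Num.min d (s1 - t).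
  near: j.
  have L : (fun j => c * 2^-1 ^+ j) @ \oo --> (0 : R).
    rewrite -[X in _ --> X](mulr0 c); apply: cvgMr.
    by apply: cvg_expr; rewrite ger0_norm// invf_lt1// ltr1n.
  have m0 : 0 < Num.min d (s1 - t) by rewrite lt_min d0 subr_gt0.
  have /cvgrPdist_lt /(_ _ m0) := L.
  apply: filterS => k; rewrite sub0r normrN ger0_norm//.
  by rewrite mulr_ge0 ?(ltW c0)// exprn_ge0.
have rN : expR (- (q * (c * 2^-1 ^+ j))) ^+ (4 ^ j) <= expR (- (q * s1)) - expR (- (q * sigma)).
  near: j.
  have /cvgrPdist_le /(_ _ e0) := hN.
  by apply: filterS => k; rewrite sub0r normrN ger0_norm.
have := h0 j; have := r01 j; move: hd rN.
set h := c * 2^-1 ^+ j => hd rN r01j hh.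
pose k := (Num.truncn (t / h)).+1.
have k1 : t < k%:R * h by rewrite -ltr_pdivrMr// truncnS_gt.
have k2 : k%:R * h <= t + h.
  rewrite /k -natr1 mulrDl mul1r lerD2r -ler_pdivlMr//.
  by rewrite truncn_le// divr_ge0// ltW.
move: hd; rewrite lt_min => /andP[hd hs].
have xk : 1 < x (k%:R * h).
  by apply: dx => //; rewrite (le_lt_trans k2)// ltrD2l.
have := @geometric_weight_ge (expR (- (q * h))) (grid_passage x h) k (4 ^ j) r01j.
move=> H; apply: le_trans (H _); last first.
  by move=> n kn; apply/(grid_passageP _ _ x0); exists k.
rewrite sE expR_grid lerBrDl.
apply: (@le_trans _ _ (expR (- (q * s1)))); first by rewrite addrC -lerBrDl.
rewrite ler_expR lerN2 ler_pM2l// (le_trans k2)//.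
by rewrite -lerBrDl ltW.
Unshelve. all: by end_near. Qed.

End skeleton.

(** * Gamma, powers and Mellin transforms *)

Section gamma_powers.
Context {R : realType}.
Local Notation mu := (@lebesgue_measure R).

Lemma measurable_gumbel_shift (v : R) :
  measurable_fun setT (fun x : R => (gumbel (x + v))%:E).
Proof.
apply/measurable_EFinP; apply: (measurableT_comp measurable_gumbel).
exact: measurable_funD.
Qed.

Lemma integral_gumbel_shift (v : R) : (\int[mu]_x (gumbel (x + v))%:E = 1)%E.
Proof.
rewrite (ge0_integral_shift v (f := fun x => (gumbel x)%:E)) ?integral_gumbel//.
- by apply/measurable_EFinP; exact: measurable_gumbel.
- by move=> x; rewrite lee_fin gumbel_ge0.
Qed.

(** exp (- exp v) is the convolution of the Gumbel density with the indicator of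
    a half line, whose Mellin transform is 1 / s. *)
Lemma euler_gammaS (s : R) : 0 < s -> euler_gamma (1 + s) = s * euler_gamma s.
Proof.
move=> s0.
pose psi (x : R) : \bar R := ((0 <= x)%R%:R)%:E.
have psi0 x : (0 <= psi x)%E by rewrite lee_fin.
have mle : measurable_fun setT (fun x : R => (0 <= x)%R%:R : R).
  rewrite (_ : (fun x : R => _) = (fun x => if 0 <= x then 1 else 0)); last first.
    by apply/funext => x; case: ifP.
  by apply: measurable_fun_ifT => //; exact: measurable_fun_ler.
have mpsi : measurable_fun setT psi by exact/measurable_EFinP.
have tail v : (\int[mu]_x ((gumbel (x + v))%:E * psi x) = (expR (- expR v))%:E)%E.
  have mg := measurable_gumbel_shift v.
  have A := integral_gumbel_tail v (@ler01 R).
  have pA x : (0 <= (gumbel (x + v) * (expR x < 1)%R%:R)%:E)%E.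
    by rewrite lee_fin mulr_ge0 ?gumbel_ge0.
  have pB x : (0 <= (gumbel (x + v))%:E * psi x)%E.
    by rewrite mule_ge0 ?lee_fin ?gumbel_ge0.
  have eA x : ((gumbel (x + v) * (expR x < 1)%R%:R)%:E =
      (gumbel (x + v))%:E * (((expR x < 1)%R%:R)%:E))%E by rewrite EFinM.
  have S : (\int[mu]_x (gumbel (x + v) * (expR x < 1)%R%:R)%:E +
      \int[mu]_x ((gumbel (x + v))%:E * psi x) = 1)%E.
    rewrite -(integral_gumbel_shift v) -ge0_integralD//.
    - apply: eq_integral => x _; rewrite /psi -EFinM -EFinD -mulrDr expR_lt1.
      by case: ltP => _; rewrite ?addr0 ?add0r mulr1.
    - under eq_fun do rewrite eA; apply: emeasurable_funM => //.
      apply/measurable_EFinP.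
      under eq_fun do rewrite expR_lt1.
      rewrite (_ : (fun x : R => _) = (fun x => if x < 0 then 1 else 0)); last first.
        by apply/funext => x; case: ifP.
      by apply: measurable_fun_ifT => //; exact: measurable_fun_ltr.
    - exact: emeasurable_funM.
  move: S; rewrite A mulr1.
  case: (\int[mu]_x _)%E => [r| |]//; rewrite -EFinD => -[E].
  by congr (_%:E); lra.
have mg := @measurable_gumbel R.
have := mellin_convolution s mg mpsi (@gumbel_ge0 R) psi0.
rewrite integral_gumbel_mellin; last by lra.
under eq_integral do rewrite tail -EFinM -expRD.
rewrite euler_gammaE//.
have -> : (\int[mu]_x ((expR (- s * x))%:E * psi x) = \int[mu]_x (half_exp s x)%:E)%E.
  apply: (@eq_integral_except _ 0).
  - apply: emeasurable_funM => //; apply/measurable_EFinP.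
    apply: measurableT_comp; first exact: measurable_expR.
    exact: measurable_funM.
  - by apply/measurable_EFinP; exact: measurable_half_exp.
  - by move=> x; rewrite mule_ge0 ?lee_fin ?expR_ge0.
  - by move=> x; rewrite lee_fin half_exp_ge0.
  move=> x x0; rewrite /psi /half_exp -EFinM; congr (_%:E).
  by rewrite le_eqVlt eq_sym (negbTE x0)/= mulNr; case: ltP; rewrite ?mulr1 ?mulr0.
rewrite integral_half_exp// -EFinM => -[->].
by rewrite mulrCA divff ?mulr1// gt_eqF.
Qed.

Lemma Gamma_pos (x : R) : 0 < x -> Gamma x = euler_gamma x.
Proof. by move=> x0; rewrite /Gamma x0 big_ord0 divr1 addr0. Qed.

Lemma Gamma_neg (x : R) : -1 < x -> x < 0 -> Gamma x = euler_gamma (x + 1) / x.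
Proof.
move=> x1 x0; rewrite /Gamma ltNge (ltW x0)/=.
have -> : Num.truncn (- x) = 0%N.
  by apply: truncn_def; apply/andP; split; lra.
by rewrite big_ord1 addr0.
Qed.

(** er_map sends -oo to -oo, where expeR is 0. *)
Lemma measurable_expeR : measurable_fun setT (@expeR R).
Proof.
rewrite (_ : @expeR R = (fun x => maxe (0%E : \bar R) (er_map expR x))); last first.
  apply/funext => -[r| |] /=.
  - by rewrite max_r ?lee_fin ?expR_ge0.
  - by rewrite max_r ?leey.
  - by rewrite max_l ?leNye.
apply: measurable_maxe => //.
exact: (@measurable_er_map _ (measurableTypeR R) _ _ (@measurable_expR R)).
Qed.

Lemma measurable_lne : measurable_fun setT (@lne R).
Proof.
rewrite (_ : @lne R = (fun x => if (x <= 0)%E then -oo%E else er_map (@ln R) x)).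
  apply: measurable_fun_ifT => //; first exact: measurable_fun_lee.
  exact: (@measurable_er_map _ (measurableTypeR R) _ _ (@measurable_ln R)).
by apply/funext => -[r| |]; rewrite ?leNye ?lee_fin//= leye_eq.
Qed.

Lemma measurable_epower (s : R) : measurable_fun setT (fun x : \bar R => epower x s).
Proof.
apply: (measurableT_comp measurable_expeR); apply: emeasurable_funM => //.
exact: measurable_lne.
Qed.

Lemma epower_ge0 (x : \bar R) (s : R) : (0 <= epower x s)%E.
Proof. exact: expeR_ge0. Qed.

(** A power is monotone in its exponent, in one direction below 1 and in the
    other above 1. *)
Lemma epower_le (x : \bar R) (a b u : R) : a < 0 -> b < 0 -> a <= u <= b ->
  (epower x u <= epower x a + epower x b)%E.
Proof.
move=> a0 b0 /andP[au ub]; have u0 := le_lt_trans ub b0.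
rewrite /epower; case: (lne x) => [r| |].
- rewrite -!EFinM/= lee_fin; have [r0|r0] := leP 0 r.
    by rewrite -[leLHS]add0r lerD ?expR_ge0// ler_expR ler_wpM2r.
  by rewrite -[leLHS]addr0 lerD ?expR_ge0// ler_expR ler_wnM2r// ltW.
- by rewrite lt0_muley ?lte_fin//= adde_ge0 ?expeR_ge0.
- by rewrite !lt0_muleNy ?lte_fin//= leey.
Qed.

Lemma epower_cvg (x : \bar R) (s : R) (u : R^nat) : s < 0 -> (forall n, u n < 0) ->
  u n @[n --> \oo] --> s -> epower x (u n) @[n --> \oo] --> epower x s.
Proof.
move=> s0 u0 us; rewrite /epower; case: (lne x) => [r| |].
- rewrite -EFinM/=; apply: cvg_EFin; first exact: nearW.
  by apply: continuous_cvg; [exact: continuous_expR|exact: cvgMl].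
- rewrite (_ : (fun n => _) = (fun=> 0%E)); last first.
    by apply/funext => n; rewrite lt0_muley ?lte_fin.
  by rewrite lt0_muley ?lte_fin//; exact: cvg_cst.
- rewrite (_ : (fun n => _) = (fun=> +oo%E)); last first.
    by apply/funext => n; rewrite lt0_muleNy ?lte_fin.
  by rewrite lt0_muleNy ?lte_fin//; exact: cvg_cst.
Qed.

Lemma cot_sub (a b : R) : sin a != 0 -> sin b != 0 ->
  cot a - cot b = sin (b - a) / (sin a * sin b).
Proof.
move=> sa sb; rewrite /cot sinB.
move: (cos a) (cos b) (sin a) (sin b) sa sb => ca cb s1 s2 h1 h2.
by field; rewrite h1 h2.
Qed.

(** mellin_convolution after dilating v and x by alpha; the two Jacobians
    cancel. The point v = 0 is left out because the right-hand side of interest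
    has a removable singularity there. *)
Lemma mellin_equation (alpha s : R) (h : R -> R) (psi : R -> \bar R) (rhs : R -> R) :
  0 < alpha -> measurable_fun setT h -> measurable_fun setT psi ->
  measurable_fun setT rhs -> (forall x, 0 <= h x) -> (forall x, 0 <= psi x)%E ->
  (forall x, 0 <= rhs x) ->
  (forall v : R, v != 0 ->
    (\int[mu]_x ((h (x + v)%R)%:E * psi (alpha * x)%R) = (rhs (alpha * v))%:E)%E) ->
  (\int[mu]_z (expR (alpha * s * z) * h z)%:E *
   \int[mu]_x ((expR (- s * x))%:E * psi x) =
   \int[mu]_x (expR (s * x) * rhs x)%:E)%E.
Proof.
move=> a0 mh mpsi mrhs h0 psi0 rhs0 E.
have mexp (p : R) : measurable_fun setT (fun x : R => (expR (p * x))%:E).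
  apply/measurable_EFinP; apply: measurableT_comp; first exact: measurable_expR.
  exact: measurable_funM.
have mscale : measurable_fun setT (fun x : R => alpha * x) by exact: mulrl_measurable.
have mpsi' := measurableT_comp mpsi mscale.
have C := mellin_convolution (alpha * s) mh mpsi' h0 (fun x => psi0 (alpha * x)).
have A1 : (alpha%:E * \int[mu]_x ((expR (- (alpha * s) * x))%:E * (psi \o *%R alpha) x) =
    \int[mu]_x ((expR (- s * x))%:E * psi x))%E.
  have mf : measurable_fun setT (fun x => (expR (- s * x))%:E * psi x)%E.
    exact: emeasurable_funM.
  have f0 x : (0 <= (expR (- s * x))%:E * psi x)%E.
    by rewrite mule_ge0// lee_fin expR_ge0.
  rewrite -(ge0_integral_affine 0 a0 mf f0).
  apply: (congr1 (fun z => alpha%:E * z)%E); apply: eq_integral => x _.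
  by rewrite addr0 mulrA !mulNr [s * _]mulrC.
have A2 : (alpha%:E * \int[mu]_v ((expR (alpha * s * v))%:E * \int[mu]_x ((h (x + v)%R)%:E * (psi \o *%R alpha) x)) =
    \int[mu]_x (expR (s * x) * rhs x)%:E)%E.
  have mr : measurable_fun setT (fun x => (rhs (alpha * x))%:E).
    by apply/measurable_EFinP; exact: (measurableT_comp mrhs mscale).
  have mf : measurable_fun setT (fun x => (expR (s * x) * rhs x)%:E).
    by under eq_fun do rewrite EFinM; apply: emeasurable_funM => //; exact/measurable_EFinP.
  have f0 x : (0 <= (expR (s * x) * rhs x)%:E)%E.
    by rewrite lee_fin mulr_ge0 ?expR_ge0.
  rewrite -(ge0_integral_affine 0 a0 mf f0).
  congr (alpha%:E * _)%E; apply: (@eq_integral_except _ 0).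
  - apply: emeasurable_funM => //.
    apply: (@measurable_integral2 _ _ _ _ _ mu (fun v x => ((h (x + v)%R)%:E * psi (alpha * x)%R)%E)).
      apply: emeasurable_funM.
        apply/measurable_EFinP; apply: (measurableT_comp mh).
        exact: measurable_funD.
      exact: (measurableT_comp mpsi').
    by move=> x y; rewrite mule_ge0 ?lee_fin.
  - under eq_fun do rewrite addr0 EFinM; apply: emeasurable_funM => //.
    under eq_fun do rewrite mulrA [s * _]mulrC; exact: mexp.
  - move=> x; rewrite mule_ge0 ?lee_fin ?expR_ge0//; apply: integral_ge0 => y _.
    by rewrite mule_ge0 ?lee_fin//; exact: psi0.
  - by move=> x; rewrite lee_fin mulr_ge0 ?expR_ge0.
  by move=> v v0; rewrite E// addr0 EFinM mulrA [s * _]mulrC.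
by rewrite -A1 -A2 C muleCA.
Qed.

Lemma lebesgue_prob_tonelli d (T : measurableType d) (P : probability T R)
    (f : R -> T -> \bar R) :
  measurable_fun setT (fun p : R * T => f p.1 p.2) ->
  (forall x y, 0 <= f x y)%E ->
  (\int[mu]_x \int[P]_w f x w = \int[P]_w \int[mu]_x f x w)%E.
Proof.
move=> mf f0.
by have := @fubini_tonelli _ _ _ _ _ (@lebesgue_measure R) P _ mf
  (fun p => f0 p.1 p.2).
Qed.

(** Squeezed between c and c / (1 - c h) by exp (c h) >= 1 + c h and exp (- c h)
    >= 1 - c h. *)
Lemma expR_quotient_cvg (c : R) :
  (expR (c * 2^-1 ^+ j) - 1) / 2^-1 ^+ j @[j --> \oo] --> c.
Proof.
have h0 j : 0 < 2^-1 ^+ j :> R by rewrite exprn_gt0.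
have hc : 2^-1 ^+ j @[j --> \oo] --> (0 : R).
  by apply: cvg_expr; rewrite ger0_norm// invf_lt1// ltr1n.
have hc1 : 1 - c * 2^-1 ^+ j @[j --> \oo] --> (1 : R).
  rewrite -[X in _ --> X]subr0 -[X in _ --> _ - X](mulr0 c).
  by apply: cvgB; [exact: cvg_cst|exact: cvgMr hc].
apply: (@squeeze_cvgr _ _ _ _ (cst c) (fun j => c / (1 - c * 2^-1 ^+ j))).
- have : \forall j \near \oo, 0 < 1 - c * 2^-1 ^+ j.
    by apply: (cvgr_gt 1) => //; rewrite ltr01.
  apply: filterS => j p; rewrite /cst ler_pdivlMr// ler_pdivrMr//.
  move: (h0 j) p; move: (2^-1 ^+ j) => h hp p; apply/andP; split.
    by have := expR_ge1Dx (c * h); lra.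
  have e : expR (c * h) <= (1 - c * h)^-1.
    rewrite -[c * h]opprK expRN opprK lef_pV2 ?posrE ?expR_gt0//.
    by have := expR_ge1Dx (- (c * h)); lra.
  rewrite lerBlDr; apply: (le_trans e).
  rewrite le_eqVlt; apply/orP; left; apply/eqP; field.
  by rewrite gt_eqF.
- exact: cvg_cst.
- rewrite -[X in _ --> X]divr1.
  by apply: cvgMr; apply: cvgV => //; rewrite oner_neq0.
Qed.

Lemma expR_grid_tail_cvg : expR (- 2^-1 ^+ j) ^+ (4 ^ j) @[j --> \oo] --> (0 : R).
Proof.
apply: (@squeeze_cvgr _ _ _ _ (cst 0) (fun j => 2^-1 ^+ j)).
- apply: nearW => j; rewrite exprn_ge0 ?expR_ge0//=.
  rewrite -expRM_natl.
  have -> : (4 ^ j)%:R * - 2^-1 ^+ j = - 2 ^+ j :> R.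
    rewrite natrX mulrN -exprMn; congr (- _ ^+ _).
    by field.
  rewrite expRN exprVn lef_pV2 ?posrE ?expR_gt0 ?exprn_gt0//.
  by apply: le_trans (expR_ge1Dx _); rewrite lerDr.
- exact: cvg_cst.
- by apply: cvg_expr; rewrite ger0_norm// invf_lt1// ltr1n.
Qed.

Lemma measurable_expR_mul (p : R) : measurable_fun setT (fun x : R => (expR (p * x))%:E).
Proof.
apply/measurable_EFinP; apply: measurableT_comp; first exact: measurable_expR.
exact: measurable_funM.
Qed.

Lemma expR_nat_cvg (c : R) : 0 < c -> expR (- c * n.+1%:R) @[n --> \oo] --> (0 : R).
Proof.
move=> c0; rewrite (_ : (fun n => _) = (fun n => expR (- c) * expR (- c) ^+ n)).
  rewrite -[X in _ --> X](mulr0 (expR (- c))); apply: cvgMr; apply: cvg_expr.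
  by rewrite ger0_norm ?expR_ge0// expR_lt1 oppr_lt0.
by apply/funext => n; rewrite -exprS -expRM_natl mulrC.
Qed.

Lemma exp_ratio_mul (s a b x : R) :
  expR (s * x) * ((expR (a * x) - expR (b * x)) / (1 - expR x)) =
  (expR ((s + a) * x) - expR ((s + b) * x)) / (1 - expR x).
Proof. by rewrite mulrA mulrBr -!expRD -!mulrDl. Qed.

Lemma one_sub_expR_neq0 (x : R) : x != 0 -> 1 - expR x != 0.
Proof. by move=> x0; rewrite subr_eq0 eq_sym -expR0 (inj_eq (@expR_inj R)). Qed.

Lemma ereal_divisor (c c' k : R) (M : \bar R) : 0 < c -> 0 < c' ->
  (c%:E * (c'%:E * M) = k%:E)%E -> M = (k / (c * c'))%:E.
Proof.
move=> c0 c'0; have cc : 0 < c * c' by rewrite mulr_gt0.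
rewrite muleA -EFinM; case: M => [r| |].
- by rewrite -EFinM => -[<-]; congr (_%:E); rewrite mulrAC divff ?mul1r// gt_eqF.
- by rewrite gt0_muley ?lte_fin.
- by rewrite gt0_muleNy ?lte_fin.
Qed.

Lemma gamma_reflection s : -1 < s -> s < 0 ->
  pi = euler_gamma (1 + s) * euler_gamma (- s) * sin (pi * (s + 1)) :> R.
Proof.
move=> s1 s0; have z01 : 0 < 1 + s < 1 by apply/andP; split; lra.
have := euler_gamma_reflection z01.
rewrite opprD addrA subrr add0r [s + 1]addrC => ->.
by rewrite divfK// gt_eqF// sinpi_gt0.
Qed.

Import HBNNSimple.

(** Needed because a first passage time is only almost surely equal to a
    measurable function. The integral of f is a supremum over simple functions
    below f; such a function is almost everywhere below g, and one below g may
    be replaced by 0 on a null set. *)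
Lemma eq_integral_ae d (T : measurableType d) (P : {measure set T -> \bar R})
    (f g : T -> \bar R) :
  measurable_fun setT g -> (forall w, 0 <= f w)%E -> (forall w, 0 <= g w)%E ->
  {ae P, forall w, f w = g w} -> (\int[P]_w f w = \int[P]_w g w)%E.
Proof.
move=> mg f0 g0 fg; apply/eqP; rewrite eq_le; apply/andP; split.
  rewrite [leLHS]ge0_integralTE//; apply: ge_ereal_sup => _ [h /= hf <-].
  have -> : sintegral P h = (\int[P]_w (h w)%:E)%E.
    by rewrite integral_nnsfun// patch_setT.
  apply: ae_ge0_le_integral => //.
  - by move=> w _; rewrite lee_fin; exact: fun_ge0.
  - by apply/measurable_EFinP.
  - by move: fg; apply: filterS => w <- _; exact: hf.
case: fg => N [mN N0 sN].
have -> : (\int[P]_w g w = \int[P]_w (g \_ (~` N)) w)%E.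
  apply: ge0_ae_eq_integral => //.
  - apply/(measurable_restrictT _ (measurableC mN)); exact: measurable_funTS.
  - by move=> w _; rewrite patchE; case: ifP.
  exists N; split => // w /= H; apply: contrapT => nN; apply: H => _.
  by rewrite patchE mem_set.
rewrite !ge0_integralTE//; last by move=> w; rewrite patchE; case: ifP.
apply: ge_ereal_sup => _ [h /= hg <-]; apply: ereal_sup_ubound => /=.
exists h => // w; apply: (le_trans (hg w)); rewrite patchE; case: ifPn => // wN.
suff -> : f w = g w by [].
move: wN; rewrite inE; apply: contra_notP => ne; exact: sN.
Qed.

End gamma_powers.

(** * Estimates for the recursion *)

Section lindley_recursion.
Context {d : measure_display} {T : measurableType d} {R : realType}.
Variable P : probability T R.

Lemma ge0_integral_eq_distribution (Y Z : T -> R) (f : R -> \bar R) :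
  measurable_fun setT Y -> measurable_fun setT Z -> eq_distribution P Y Z ->
  measurable_fun setT f -> (forall x, 0 <= f x)%E ->
  (\int[P]_w f (Y w) = \int[P]_w f (Z w))%E.
Proof.
move=> mY mZ YZ mf f0.
pose Y' : {mfun T >-> R} := HB.pack Y (isMeasurableFun.Build _ _ _ _ Y mY).
pose Z' : {mfun T >-> R} := HB.pack Z (isMeasurableFun.Build _ _ _ _ Z mZ).
transitivity (\int[distribution P Y']_p f p)%E; first by rewrite ge0_integral_distribution.
transitivity (\int[distribution P Z']_p f p)%E; last by rewrite ge0_integral_distribution.
by apply: eq_measure_integral => C mC _; exact: YZ.
Qed.

Lemma mutually_independent_comp n (Y : 'I_n -> T -> R) (f : R -> R) :
  measurable_fun setT f -> mutually_independent P Y ->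
  mutually_independent P (fun i w => f (Y i w)).
Proof.
move=> mf iY A mA.
have mfA i : measurable (f @^-1` A i) by rewrite -[X in measurable X]setTI; exact: mf.
exact: (iY (fun i => f @^-1` A i) mfA).
Qed.

(** From (1 - x) exp x <= 1. *)
Lemma expR_second_order (x : R) : 0 <= x -> 0 <= expR x - 1 - x <= x ^+ 2 * expR x.
Proof.
move=> x0; have h1 := expR_ge1Dx x; have h2 := expR_ge1Dx (- x).
have e0 := expR_gt0 x.
have h3 : (1 - x) * expR x <= 1.
  by rewrite -[leRHS](expRxMexpNx_1 x) mulrC ler_pM2l.
have h4 : expR x - 1 <= x * expR x by lra.
apply/andP; split; first by lra.
have h5 : x * (expR x - 1) <= x * (x * expR x) by rewrite ler_wpM2l.
have h6 : x ^+ 2 * expR x = x * (x * expR x) by ring.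
rewrite h6; lra.
Qed.

(** Both terms of the difference equal l D up to second order in D. *)
Lemma exp_defect (l D : R) : 0 <= l -> 0 <= D ->
  `|(expR (l * D) - 1) - l * (expR D - 1)| <=
    (l ^+ 2 + l) * D ^+ 2 * (expR (l * D) + expR D).
Proof.
move=> l0 D0; have lD0 : 0 <= l * D by rewrite mulr_ge0.
have /andP[h1 h2] := expR_second_order lD0.
have /andP[h3 h4] := expR_second_order D0.
have h5 : l * (expR D - 1 - D) <= l * (D ^+ 2 * expR D) by rewrite ler_wpM2l.
have h6 : 0 <= l * (expR D - 1 - D) by rewrite mulr_ge0.
have p1 : 0 <= l ^+ 2 * D ^+ 2 * expR D by rewrite !mulr_ge0 ?expR_ge0 ?sqr_ge0.
have p2 : 0 <= l * D ^+ 2 * expR (l * D) by rewrite !mulr_ge0 ?expR_ge0 ?sqr_ge0.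
have p3 : 0 <= l * (D ^+ 2 * expR D) by rewrite !mulr_ge0 ?expR_ge0 ?sqr_ge0.
have p4 : 0 <= (l * D) ^+ 2 * expR (l * D) by rewrite !mulr_ge0 ?expR_ge0 ?sqr_ge0.
have -> : (l ^+ 2 + l) * D ^+ 2 * (expR (l * D) + expR D) =
  (l * D) ^+ 2 * expR (l * D) + l * (D ^+ 2 * expR D) +
  l ^+ 2 * D ^+ 2 * expR D + l * D ^+ 2 * expR (l * D) by ring.
have -> : (expR (l * D) - 1) - l * (expR D - 1) =
  (expR (l * D) - 1 - l * D) - l * (expR D - 1 - D) by ring.
by rewrite ler_norml; apply/andP; split; lra.
Qed.

(** exp_defect for a D which is small of order rho: the factor rho^2 is the
    gain, and eta^2 is absorbed by 2 exp eta. *)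
Lemma exp_defect_scaled (l rho eta D : R) : 0 <= l -> 0 <= rho <= 1 -> 0 <= D ->
  D <= rho * eta -> 0 <= eta ->
  `|(expR (l * D) - 1) - l * (expR D - 1)| <=
    rho ^+ 2 * (2 * (l ^+ 2 + l)) * (expR ((l + 1) * eta) + expR (2 * eta)).
Proof.
move=> l0 /andP[r0 r1] D0 Dr e0.
have Deta : D <= eta by rewrite (le_trans Dr)// ler_piMl.
apply: (le_trans (exp_defect l0 D0)).
have D2 : D ^+ 2 <= rho ^+ 2 * eta ^+ 2.
  by rewrite -exprMn lerXn2r ?nnegrE// mulr_ge0.
have eta2 : eta ^+ 2 <= 2 * expR eta.
  have := expR_ge1Dxn 1%N e0; rewrite !factS fact0 !muln1 => h.
  have : 0 <= 1 * 2 :> R by [].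
  by lra.
have el : expR (l * D) + expR D <= expR (l * eta) + expR eta.
  by rewrite lerD// ler_expR// ler_wpM2l.
have ll : 0 <= l ^+ 2 + l by rewrite addr_ge0// sqr_ge0.
have -> : expR ((l + 1) * eta) + expR (2 * eta) = expR eta * (expR (l * eta) + expR eta).
  rewrite mulrDr -!expRD; congr (expR _ + expR _); ring.
have -> : rho ^+ 2 * (2 * (l ^+ 2 + l)) * (expR eta * (expR (l * eta) + expR eta)) =
  (l ^+ 2 + l) * (rho ^+ 2 * (2 * expR eta)) * (expR (l * eta) + expR eta) by ring.
apply: ler_pM => //.
- by rewrite mulr_ge0// sqr_ge0.
by rewrite ler_wpM2l// (le_trans D2)// ler_wpM2l// sqr_ge0.
Qed.

(** L n will be the Laplace transform at l of the maximum of n steps, and L1 n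
    the one at 1. Summing the recursion against r^n gives (1 - r w) sum r^n L n
    in terms of sum r^n d0 n, an unknown. For L1 the factor 1 - r w vanishes,
    which determines sum r^n d1 n instead; as d0 is close to l d1, the unknown
    is known up to eps. *)
Lemma abel_lindley (L L1 d0 d1 : nat -> R) (w r l eps : R) N :
  L 0%N = 1 -> L1 0%N = 1 -> 0 < r -> r <= 1 -> 0 <= l ->
  (forall n, L n.+1 = w * L n - d0 n) ->
  (forall n, L1 n.+1 = r^-1 * L1 n - d1 n) ->
  (forall n, 0 <= L n <= 1) -> (forall n, 0 <= L1 n <= 1) ->
  (forall n, `|d0 n - l * d1 n| <= eps) ->
  `|(1 - r * w) * ((1 - r) * \sum_(n < N) r ^+ n * L n) - (1 - r) * (1 - l)| <=
  (1 - r) * (1 + l) * r ^+ N + eps.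
Proof.
move=> L0 L10 r0 r1 l0 rL rL1 bL bL1 bd.
have eps0 : 0 <= eps by exact: le_trans (normr_ge0 _) (bd 0%N).
have c1 M : (1 - r * w) * \sum_(n < M) r ^+ n * L n =
    1 - r ^+ M * L M - r * \sum_(n < M) r ^+ n * d0 n.
  elim: M => [|M IH]; first by rewrite !big_ord0 expr0 L0; ring.
  by rewrite !big_ord_recr/= mulrDr IH rL exprS; ring.
have c2 M : 0 = 1 - r ^+ M * L1 M - r * \sum_(n < M) r ^+ n * d1 n.
  elim: M => [|M IH]; first by rewrite !big_ord0 expr0 L10; ring.
  rewrite !big_ord_recr/= rL1 exprS [LHS]IH; field.
  by rewrite gt_eqF.
have -> : (1 - r * w) * ((1 - r) * \sum_(n < N) r ^+ n * L n) - (1 - r) * (1 - l) =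
  (1 - r) * (l * (r ^+ N * L1 N) - r ^+ N * L N) -
   r * ((1 - r) * \sum_(n < N) r ^+ n * (d0 n - l * d1 n)).
  have -> : \sum_(n < N) r ^+ n * (d0 n - l * d1 n) =
      \sum_(n < N) r ^+ n * d0 n - l * \sum_(n < N) r ^+ n * d1 n.
    rewrite mulr_sumr -sumrB; apply: eq_bigr => n _; ring.
  rewrite mulrCA c1.
  have := c2 N.
  move: (\sum_(n < N) r ^+ n * d0 n) (\sum_(n < N) r ^+ n * d1 n) => s0 s1 E.
  have -> : r ^+ N * L1 N = 1 - r * s1 by lra.
  ring.
have q0 : 0 <= 1 - r by rewrite subr_ge0.
have rN0 : 0 <= r ^+ N by rewrite exprn_ge0// ltW.
apply: (le_trans (ler_normB _ _)); apply: lerD.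
  rewrite normrM (ger0_norm q0) -mulrA ler_wpM2l//.
  have /andP[a1 a2] := bL N; have /andP[a3 a4] := bL1 N.
  have b1 : l * (r ^+ N * L1 N) <= l * r ^+ N by rewrite ler_wpM2l// ler_piMr.
  have b2 : r ^+ N * L N <= r ^+ N by rewrite ler_piMr.
  have b3 : 0 <= l * (r ^+ N * L1 N) by rewrite !mulr_ge0.
  have b4 : 0 <= r ^+ N * L N by rewrite mulr_ge0.
  by rewrite ler_norml; apply/andP; split; rewrite mulrDl mul1r; lra.
rewrite !normrM (ger0_norm q0) (gtr0_norm r0).
have h : `|\sum_(n < N) r ^+ n * (d0 n - l * d1 n)| <= eps * \sum_(n < N) r ^+ n.
  apply: (le_trans (ler_norm_sum _ _ _)); rewrite mulr_sumr.
  apply: ler_sum => n _; rewrite normrM ger0_norm ?exprn_ge0 ?(ltW r0)// mulrC.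
  by rewrite ler_wpM2r// exprn_ge0// ltW.
have g : (1 - r) * \sum_(n < N) r ^+ n = 1 - r ^+ N by rewrite -[RHS]opprB subrX1 -mulNr opprB.
have h2 : (1 - r) * `|\sum_(n < N) r ^+ n * (d0 n - l * d1 n)| <= eps.
  apply: (le_trans (ler_wpM2l q0 h)); rewrite mulrCA g ler_piMr//.
  by rewrite gerBl.
apply: le_trans h2; rewrite ler_piMl// mulr_ge0//.
Qed.

End lindley_recursion.

(** * The skeleton of a stable process *)

Section levy.
Context {d : measure_display} {T : measurableType d} {R : realType}.
Variable P : probability T R.
Variables (alpha : R) (X : R -> {RV P >-> R}).
Hypotheses (alpha1 : 1 < alpha) (alpha2 : alpha < 2).
Hypotheses (lX : levy_process X) (sX : stable alpha X).
Hypothesis laplaceX : forall t l : R, 0 <= t -> 0 <= l ->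
  ('E_P[fun w => expR (- l * X t w)])%E = (expR (t * l `^ alpha))%:E.
Local Notation mu := (@lebesgue_measure R).

Let alpha_gt0 : 0 < alpha. Proof. by rewrite (lt_trans ltr01). Qed.

Definition incr (h : R) (i : nat) (w : T) : R := X (i.+1%:R * h) w - X (i%:R * h) w.

Lemma measurable_incr h i : measurable_fun setT (incr h i).
Proof. exact: measurable_funB. Qed.

Lemma incr_independent h n : 0 <= h -> mutually_independent P (fun i : 'I_n => incr h i).
Proof.
move=> h0; have H := levy_independent lX; apply: (H n (fun i => i%:R * h)).
  by rewrite mul0r.
by move=> i; rewrite ler_wpM2r// ler_nat.
Qed.

Lemma incr_law h i : 0 <= h -> eq_distribution P (incr h i) (X h).
Proof.
move=> h0 A mA.
have ih : 0 <= i%:R * h by rewrite mulr_ge0.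
rewrite -(levy_stationary lX ih h0 mA); congr (P (_ @^-1` A)).
by apply/funext => w; rewrite /incr -natr1 mulrDl mul1r.
Qed.

Lemma incr_laws h i j : 0 <= h -> eq_distribution P (incr h i) (incr h j).
Proof. by move=> h0 A mA; rewrite !incr_law. Qed.

Lemma incr_laplace h i l : 0 <= h -> 0 <= l ->
  (\int[P]_w (expR (- l * incr h i w))%:E = (expR (h * l `^ alpha))%:E)%E.
Proof.
move=> h0 l0; have L := laplaceX h0 l0; rewrite unlock in L; rewrite -L.
apply: (@ge0_integral_eq_distribution _ _ _ _ _ _ (fun x => (expR (- l * x))%:E)) => //.
- exact: measurable_incr.
- exact: incr_law.
- exact: measurable_expR_mul.
Qed.

(** The drift allowed in the definition of stability is 0, since the Laplace
    transforms at 1 of the two sides agree only in that case. *)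
Lemma stable_scaling a t : 0 < a -> 0 <= t ->
  eq_distribution P (X (a * t)) (fun w => a `^ alpha^-1 * X t w).
Proof.
move=> a0 t0; have [b Eb] := sX a0.
suff bt : b * t = 0.
  move=> A mA; rewrite (Eb t t0 A mA); congr (P (_ @^-1` A)).
  by apply/funext => w; rewrite bt addr0.
have mY : measurable_fun setT (fun w => a `^ alpha^-1 * X t w + b * t).
  by apply: measurable_funD => //; exact: measurable_funM.
have at0 : 0 <= a * t by rewrite mulr_ge0// ltW.
have mX : measurable_fun setT (X (a * t)) by [].
have l1 := @laplaceX (a * t) 1 at0 ler01.
have l2 := @laplaceX t (a `^ alpha^-1) t0 (powR_ge0 _ _).
rewrite unlock in l1 l2.
have := @ge0_integral_eq_distribution _ _ _ P _ _ (fun x => (expR (- 1 * x))%:E)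
  mX mY (Eb t t0) (measurable_expR_mul (- 1)) (fun x => expR_ge0 _).
rewrite l1 powR1 mulr1.
under eq_integral.
  move=> w _.
  have -> : - 1 * (a `^ alpha^-1 * X t w + b * t) = - (b * t) + (- (a `^ alpha^-1) * X t w) by ring.
  rewrite expRD EFinM; over.
rewrite ge0_integralZl//=; last first.
  exact: (measurableT_comp (measurable_expR_mul (- (a `^ alpha^-1)))).
rewrite l2 -powRrM mulVf ?gt_eqF// powRr1 ?(ltW a0)// -EFinM -expRD => -[] /expR_inj.
by rewrite [t * a]mulrC; lra.
Qed.

(** The maximum of X over the first n + 1 points of the grid of mesh h. *)
Definition skeleton_max (h : R) n w : R := lindley n (incr h ^~ w).

Lemma measurable_skeleton_max h n : measurable_fun setT (skeleton_max h n).
Proof. by apply: measurable_lindley => i; exact: measurable_incr. Qed.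

Lemma skeleton_max_scaling a h n (x : R) : 0 < a -> 0 <= h ->
  P [set w | x * a `^ alpha^-1 < skeleton_max (a * h) n w] = P [set w | x < skeleton_max h n w].
Proof.
move=> a0 h0; have c0 : 0 < a `^ alpha^-1 by rewrite powR_gt0.
have ah0 : 0 <= a * h by rewrite mulr_ge0// ltW.
have mA : measurable `]x * a `^ alpha^-1, +oo[%classic by exact: measurable_itv.
pose Y i w := a `^ alpha^-1 * incr h i w.
have := @lindley_law _ _ _ P n (incr (a * h)) Y 0%N 0%N _ _ _ _ _ _ mA.
move=> H; transitivity (P ((fun w => skeleton_max (a * h) n w) @^-1` `]x * a `^ alpha^-1, +oo[%classic)).
  by congr (P _); apply/seteqP; split=> w /=; rewrite in_itv/= andbT.
rewrite [LHS]H.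
- have E w : lindley n (fun i => Y (0 + i)%N w) = a `^ alpha^-1 * skeleton_max h n w.
    exact: (lindleyZ n (incr h ^~ w) (ltW c0)).
  by congr (P _); apply/seteqP; split=> w /=; rewrite in_itv/= andbT E [x * _]mulrC ltr_pM2l.
- by move=> i; exact: measurable_incr.
- by move=> i; apply: measurable_funM => //; exact: measurable_incr.
- by move=> m; exact: incr_independent.
- move=> m; apply: (@mutually_independent_comp _ _ _ _ _ (fun i : 'I_m => incr h i) ( *%R (a `^ alpha^-1))).
    exact: mulrl_measurable.
  exact: incr_independent.
- move=> i j A mA'; rewrite incr_law// (stable_scaling a0 h0 mA').
  have mB : measurable ( *%R (a `^ alpha^-1) @^-1` A).
    by rewrite -[X in measurable X]setTI; exact: mulrl_measurable.
  exact: (esym (incr_law j h0 mB)).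
Qed.

Definition skeleton_laplace (h l : R) n : R :=
  fine (\int[P]_w (expR (- l * skeleton_max h n w))%:E)%E.

Lemma skeleton_laplaceE h l n : 0 <= l ->
  (\int[P]_w (expR (- l * skeleton_max h n w))%:E = (skeleton_laplace h l n)%:E)%E
  /\ 0 <= skeleton_laplace h l n <= 1.
Proof.
move=> l0; have ge0 : (0 <= \int[P]_w (expR (- l * skeleton_max h n w))%:E)%E.
  by apply: integral_ge0 => w _; rewrite lee_fin expR_ge0.
have le1 : (\int[P]_w (expR (- l * skeleton_max h n w))%:E <= 1)%E.
  rewrite -(@probability_setT _ _ _ P) -[leRHS]mul1e -integral_cst//.
  apply: ge0_le_integral => //=.
  - exact: (measurableT_comp (measurable_expR_mul (- l)) (measurable_skeleton_max h n)).
  - by move=> w _; rewrite lee_fin expR_le1 mulNr oppr_le0 mulr_ge0// lindley_ge0.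
have fin : (\int[P]_w (expR (- l * skeleton_max h n w))%:E)%E \is a fin_num.
  by rewrite ge0_fin_numE// (le_lt_trans le1)// ltry.
rewrite /skeleton_laplace; split; first by rewrite fineK.
by rewrite fine_ge0//= -lee_fin fineK.
Qed.

(** How far the first increment followed by the best continuation stays below 0. *)
Definition undershoot h n w : R :=
  Num.max 0 (- (incr h 0%N w + lindley n (fun i => incr h i.+1 w))).

Definition undershoot_excess h l n : R :=
  fine (\int[P]_w (expR (l * undershoot h n w) - 1)%:E)%E.

Lemma measurable_undershoot h n : measurable_fun setT (undershoot h n).
Proof.
apply: measurable_maxr => //; apply: measurableT_comp => //.
apply: measurable_funD; first exact: measurable_incr.
by apply: (@measurable_lindley _ _ _ n (fun i => incr h i.+1)) => i; exact: measurable_incr.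
Qed.

Lemma undershoot_ge0 h n w : 0 <= undershoot h n w.
Proof. by rewrite le_max lexx. Qed.

(** The maximum of n + 1 steps is max 0 Z with Z = Y + W, where W is independent
    of Y and has the law of the maximum of n steps. Since

        exp (- l max 0 z) + (exp (l max 0 (- z)) - 1) = exp (- l z),

    taking expectations gives a linear recursion with the undershoot as its
    source term. *)
Lemma skeleton_recursion h l n : 0 <= h -> 0 <= l ->
  (\int[P]_w (expR (l * undershoot h n w) - 1)%:E = (undershoot_excess h l n)%:E)%E /\
  skeleton_laplace h l n.+1 =
    expR (h * l `^ alpha) * skeleton_laplace h l n - undershoot_excess h l n.
Proof.
move=> h0 l0.
have mI i := measurable_incr h i.
have m1 : measurable_fun setT (fun w => (expR (- l * skeleton_max h n.+1 w))%:E).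
  exact: (measurableT_comp (measurable_expR_mul (- l)) (measurable_skeleton_max h n.+1)).
have m2 : measurable_fun setT (fun w => (expR (l * undershoot h n w) - 1)%:E).
  apply/measurable_EFinP; apply: measurable_funB => //.
  apply: measurableT_comp; first exact: measurable_expR.
  by apply: measurable_funM => //; exact: measurable_undershoot.
have pos w : (0 <= (expR (l * undershoot h n w) - 1)%:E)%E.
  by rewrite lee_fin subr_ge0 -expR0 ler_expR mulr_ge0// undershoot_ge0.
have E : ((skeleton_laplace h l n.+1)%:E + \int[P]_w (expR (l * undershoot h n w) - 1)%:E =
    (expR (h * l `^ alpha) * skeleton_laplace h l n)%:E)%E.
  have [<- _] := skeleton_laplaceE h n.+1 l0.
  rewrite -ge0_integralD//= EFinM -(incr_laplace 0 h0 l0).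
  have [<- _] := skeleton_laplaceE h n l0.
  rewrite -(@lindley_step _ _ _ P n (incr h) (fun x => (expR (- l * x))%:E) (fun x => (expR (- l * x))%:E)).
  - apply: eq_integral => w _; rewrite -EFinM -EFinD; congr (_%:E).
    rewrite -expRD -mulrDr /skeleton_max /undershoot /=.
    move: (incr h 0%N w + _) => z.
    case: (leP 0 z) => z0.
      by rewrite !max_l ?oppr_le0// ?max_r// mulr0 expR0 subrr addr0.
    rewrite max_r ?oppr_ge0 ?(ltW z0)// mulr0 expR0 mulrN mulNr.
    by ring.
  - exact: mI.
  - by move=> m; exact: incr_independent.
  - by move=> i j; exact: incr_laws.
  - exact: measurable_expR_mul.
  - exact: measurable_expR_mul.
  - by move=> x; rewrite lee_fin expR_ge0.
  - by move=> x; rewrite lee_fin expR_ge0.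
have fin : (\int[P]_w (expR (l * undershoot h n w) - 1)%:E = (undershoot_excess h l n)%:E)%E.
  rewrite /undershoot_excess fineK// ge0_fin_numE; last exact: integral_ge0.
  by case: (\int[P]_w _)%E E => [r| |]//; rewrite ltry.
split=> //; move: E; rewrite fin -EFinD => -[]; lra.
Qed.

(** A bound that does not depend on the mesh: the expectation of the right-hand
    side of exp_defect_scaled, apart from the factor rho^2. *)
Definition undershoot_bound (l : R) : R :=
  2 * (l ^+ 2 + l) * (2 + expR ((l + 1) `^ alpha) + expR (2 `^ alpha)).

(** The undershoot is at most the negative part of a single increment, that is
    h^(1/alpha) times a variable whose exponential moments are finite by the
    assumption on the Laplace transform. Apply exp_defect_scaled with rho =
    h^(1/alpha). *)
Lemma undershoot_excess_bound h l n : 0 < h -> h <= 1 -> 0 <= l ->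
  `|undershoot_excess h l n - l * undershoot_excess h 1 n| <=
    undershoot_bound l * (h `^ alpha^-1) ^+ 2.
Proof.
move=> h0 h1 l0; set rho := h `^ alpha^-1.
have rho0 : 0 < rho by rewrite powR_gt0.
have rho1 : rho <= 1.
  have : h `^ alpha^-1 <= 1 `^ alpha^-1.
    by apply: ge0_ler_powR; rewrite ?nnegrE ?invr_ge0 ?(ltW h0) ?(ltW alpha_gt0).
  by rewrite powR1.
have rhoa : rho `^ alpha = h by rewrite /rho -powRrM mulVf ?gt_eqF// powRr1// ltW.
pose K := rho ^+ 2 * (2 * (l ^+ 2 + l)).
have ll : 0 <= l ^+ 2 + l by rewrite addr_ge0// sqr_ge0.
have K0 : 0 <= K by rewrite /K mulr_ge0 ?sqr_ge0// mulr_ge0.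
pose B w := K * ((1 + expR (- ((l + 1) / rho) * incr h 0%N w)) +
                 (1 + expR (- (2 / rho) * incr h 0%N w))).
have bnd w : `|(expR (l * undershoot h n w) - 1) - l * (expR (undershoot h n w) - 1)| <= B w.
  (* The negative part of the increment, rescaled to unit order. *)
  pose eta := Num.max 0 (- (incr h 0%N w / rho)).
  have eta0 : 0 <= eta by rewrite le_max lexx.
  have De : undershoot h n w <= rho * eta.
    rewrite /undershoot /eta maxr_pMr ?(ltW rho0)// mulr0 mulrN mulrCA divff ?gt_eqF// mulr1.
    rewrite ge_max le_max lexx/= le_max lerN2 lerDl lindley_ge0 orbT//.
  have r01 : 0 <= rho <= 1 by rewrite rho1 ltW.
  apply: (le_trans (exp_defect_scaled l0 r01 (undershoot_ge0 h n w) De eta0)).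
  rewrite ler_wpM2l//.
  have exm c : 0 <= c -> expR (c * eta) <= 1 + expR (- (c / rho) * incr h 0%N w).
    move=> c0; rewrite /eta; case: (leP 0 (- (incr h 0%N w / rho))) => _.
      rewrite [leRHS]addrC -[leLHS]addr0 lerD// ler_expR.
      by rewrite mulrN mulNr mulrA mulrAC.
    by rewrite mulr0 expR0 lerDl expR_ge0.
  by rewrite lerD// exm// addr_ge0.
have mI := measurable_incr h 0%N.
have mE c : measurable_fun setT (fun w => expR (- c * incr h 0%N w)).
  apply: measurableT_comp; first exact: measurable_expR.
  exact: measurable_funM.
have mB : measurable_fun setT (EFin \o B).
  apply/measurable_EFinP; apply: measurable_funM => //.
  by apply: measurable_funD; apply: measurable_funD.
have B0 w : 0 <= B w by exact: le_trans (bnd w).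
have lap c : 0 <= c -> (\int[P]_w (expR (- (c / rho) * incr h 0%N w))%:E = (expR (c `^ alpha))%:E)%E.
  move=> c0; rewrite incr_laplace ?(ltW h0)//; last by rewrite divr_ge0// ltW.
  rewrite powRM ?invr_ge0 ?(ltW rho0)// -powR_inv1 ?(ltW rho0)// -powRrM mulN1r powRN rhoa.
  by rewrite mulrCA divff ?mulr1// gt_eqF.
have IB : (\int[P]_w (B w)%:E = (undershoot_bound l * rho ^+ 2)%:E)%E.
  under eq_integral do rewrite EFinM.
  rewrite ge0_integralZl//=; last first.
    by apply/measurable_EFinP; apply: measurable_funD; apply: measurable_funD.
  under eq_integral do rewrite !EFinD.
  have m1 c : measurable_fun setT (fun w => (expR (- c * incr h 0%N w))%:E).
    by apply/measurable_EFinP; exact: mE.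
  have g1 c w : (0 <= (expR (- c * incr h 0%N w))%:E)%E by rewrite lee_fin expR_ge0.
  have g2 c : measurable_fun setT (fun w => (1 + (expR (- c * incr h 0%N w))%:E)%E).
    exact: emeasurable_funD.
  rewrite ge0_integralD//=; try by move=> w _; rewrite adde_ge0.
  rewrite !ge0_integralD//= !lap ?addr_ge0// integral_cst//= probability_setT mule1.
  rewrite -!EFinD -EFinM; congr (_%:E); rewrite /K /undershoot_bound.
  move: (expR ((l + 1) `^ alpha)) (expR (2 `^ alpha)) (rho ^+ 2) => E1 E2 r2.
  ring.
have [el rl] := skeleton_recursion n (ltW h0) l0.
have [e1 r1] := skeleton_recursion n (ltW h0) ler01.
have mU c : measurable_fun setT (fun w => (expR (c * undershoot h n w) - 1)%:E).
  apply/measurable_EFinP; apply: measurable_funB => //.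
  apply: measurableT_comp; first exact: measurable_expR.
  by apply: measurable_funM => //; exact: measurable_undershoot.
have posU c w : 0 <= c -> (0 <= (expR (c * undershoot h n w) - 1)%:E)%E.
  by move=> c0; rewrite lee_fin subr_ge0 -expR0 ler_expR mulr_ge0// undershoot_ge0.
have il1 : (\int[P]_w (l%:E * (expR (1 * undershoot h n w) - 1)%:E) =
    (l * undershoot_excess h 1 n)%:E)%E.
  rewrite ge0_integralZl ?lee_fin//; first by rewrite e1.
  by move=> w _; exact: posU.
have up : undershoot_excess h l n <= l * undershoot_excess h 1 n + undershoot_bound l * rho ^+ 2.
  rewrite -lee_fin -el EFinD -il1 -IB -ge0_integralD//=.
  - apply: ge0_le_integral => //=.
    + by move=> w _; exact: posU.
    + by apply: emeasurable_funD => //; exact: emeasurable_funM.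
    + move=> w _; rewrite lee_fin.
      have := bnd w; rewrite mul1r.
      move: (expR (l * undershoot h n w)) (expR (undershoot h n w)) (B w) => e e' b.
      by rewrite ler_norml => /andP[_]; rewrite lerBlDl.
  - by move=> w _; rewrite mule_ge0 ?lee_fin// -lee_fin; exact: posU.
  - exact: emeasurable_funM.
  - by move=> w _; rewrite lee_fin.
have dn : l * undershoot_excess h 1 n <= undershoot_excess h l n + undershoot_bound l * rho ^+ 2.
  rewrite -lee_fin EFinD -el -il1 -IB -ge0_integralD//=.
  - apply: ge0_le_integral => //=.
    + by move=> w _; rewrite mule_ge0 ?lee_fin// -lee_fin; exact: posU.
    + exact: emeasurable_funM.
    + exact: emeasurable_funD.
    + move=> w _; rewrite lee_fin.
      have := bnd w; rewrite mul1r.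
      move: (expR (l * undershoot h n w)) (expR (undershoot h n w)) (B w) => e e' b.
      move: (e - 1) (l * (e' - 1)) => u v.
      by rewrite ler_distlC lerBlDr => /andP[].
  - by move=> w _; exact: posU.
  - by move=> w _; rewrite lee_fin.
move: (undershoot_excess h l n) (l * undershoot_excess h 1 n) (undershoot_bound l * rho ^+ 2)
  up dn => u v b up dn.
by rewrite ler_norml lerBrDr addrC lerBlDr dn lerBlDl.
Qed.

(** * From the skeleton to continuous time *)

Lemma measurable_lt_skeleton h n (y : R) :
  measurable_fun setT (fun w => (y < skeleton_max h n w)%R%:R : R).
Proof.
rewrite (_ : (fun w => _) = (fun w => if y < skeleton_max h n w then 1 else 0)); last first.
  by apply/funext => w; case: ifP.
apply: measurable_fun_ifT => //; apply: measurable_fun_ltr => //.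
exact: measurable_skeleton_max.
Qed.

Definition skeleton_tail h n (x : R) : \bar R :=
  (\int[P]_w ((expR x < skeleton_max h n w)%R%:R)%:E)%E.

Lemma measurable_skeleton_tail2 h n : measurable_fun setT
  (fun p : R * T => (((expR p.1 < skeleton_max h n p.2)%R)%:R : R)%:E).
Proof.
apply/measurable_EFinP.
rewrite (_ : (fun p : R * T => _) = (fun p => if expR p.1 < skeleton_max h n p.2 then 1 else 0)); last first.
  by apply/funext => p; case: ifP.
apply: measurable_fun_ifT => //; apply: measurable_fun_ltr => //.
  by apply: measurableT_comp => //; exact: measurable_expR.
exact: (measurableT_comp (measurable_skeleton_max h n)).
Qed.

Lemma measurable_skeleton_tail h n : measurable_fun setT (skeleton_tail h n).
Proof.
apply: (@measurable_integral2 _ _ _ _ _ P (fun x w => ((expR x < skeleton_max h n w)%R%:R)%:E)).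
  exact: measurable_skeleton_tail2.
by move=> x w; rewrite lee_fin.
Qed.

Lemma skeleton_tail_ge0 h n x : (0 <= skeleton_tail h n x)%E.
Proof. by apply: integral_ge0 => w _; rewrite lee_fin. Qed.

(** Integration by parts: 1 - exp (- l m) is the integral of the Gumbel density,
    translated by v = log l, up to log m. *)
Lemma skeleton_laplace_tail h n (v : R) :
  ((1 - skeleton_laplace h (expR v) n)%:E =
   \int[mu]_x ((gumbel (x + v))%:E * skeleton_tail h n x))%E.
Proof.
have mg : measurable_fun setT (fun x : R => (gumbel (x + v))%:E).
  apply/measurable_EFinP; apply: (measurableT_comp measurable_gumbel).
  exact: measurable_funD.
transitivity (\int[mu]_x \int[P]_w ((gumbel (x + v) * (expR x < skeleton_max h n w)%R%:R)%:E))%E; last first.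
  apply: eq_integral => x _; rewrite -ge0_integralZl//=.
  - by apply/measurable_EFinP; exact: measurable_lt_skeleton.
  - by rewrite lee_fin gumbel_ge0.
rewrite (@lebesgue_prob_tonelli _ _ _ P (fun x w => (gumbel (x + v) * (expR x < skeleton_max h n w)%R%:R)%:E)); last 2 first.
- under eq_fun do rewrite EFinM; apply: emeasurable_funM.
    exact: (measurableT_comp mg).
  exact: measurable_skeleton_tail2.
- by move=> x w; rewrite lee_fin mulr_ge0// gumbel_ge0.
under eq_integral do rewrite integral_gumbel_tail ?lindley_ge0//.
have [E /andP[L0 L1]] := skeleton_laplaceE h n (expR_ge0 v).
have m1 : measurable_fun setT (fun w => (expR (- expR v * skeleton_max h n w))%:E).
  exact: (measurableT_comp (measurable_expR_mul (- expR v)) (measurable_skeleton_max h n)).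
have m2 : measurable_fun setT (fun w => (1 - expR (- (expR v * skeleton_max h n w)))%:E).
  apply/measurable_EFinP; apply: measurable_funB => //.
  by under eq_fun do rewrite -mulNr; exact/measurable_EFinP.
have p2 w : (0 <= (1 - expR (- (expR v * skeleton_max h n w)))%:E)%E.
  by rewrite lee_fin subr_ge0 expR_le1 oppr_le0 mulr_ge0 ?expR_ge0// lindley_ge0.
have S : (\int[P]_w (1 - expR (- (expR v * skeleton_max h n w)))%:E + (skeleton_laplace h (expR v) n)%:E = 1)%E.
  rewrite -E -ge0_integralD//=.
  rewrite -[RHS](@probability_setT _ _ _ P) -[RHS]mul1e -integral_cst//.
  apply: eq_integral => w _; rewrite -EFinD mulNr subrK//.
move: S; case: (\int[P]_w _)%E => [r| |]//; rewrite -EFinD => -[<-].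
by rewrite addrK.
Qed.

(** The tail of the maximum of X over a geometric number of steps of mean close
    to 1 / h: an approximation of its tail up to an independent exponential
    time. The sum is cut off after N terms. *)
Definition mean_weight h N (x : R) : \bar R :=
  (\sum_(n < N) ((1 - expR (- h)) * expR (- h) ^+ n)%:E * skeleton_tail h n x)%E.

Lemma geo_coef_ge0 (h : R) n : 0 <= h -> 0 <= (1 - expR (- h)) * expR (- h) ^+ n.
Proof.
by move=> h0; rewrite mulr_ge0 ?exprn_ge0 ?expR_ge0// subr_ge0 expR_le1 oppr_le0.
Qed.

Lemma measurable_mean_weight h N : measurable_fun setT (mean_weight h N).
Proof.
apply: emeasurable_sum => n; apply: emeasurable_funM => //.
exact: measurable_skeleton_tail.
Qed.

Lemma mean_weight_ge0 h N x : 0 <= h -> (0 <= mean_weight h N x)%E.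
Proof.
move=> h0; apply: sume_ge0 => n _; rewrite mule_ge0 ?skeleton_tail_ge0// lee_fin.
exact: geo_coef_ge0.
Qed.

Lemma mean_weight_laplace h N (v : R) : 0 <= h ->
  ((\sum_(n < N) (1 - expR (- h)) * expR (- h) ^+ n * (1 - skeleton_laplace h (expR v) n))%:E =
   \int[mu]_x ((gumbel (x + v))%:E * mean_weight h N x))%E.
Proof.
move=> h0.
have mg : measurable_fun setT (fun x : R => (gumbel (x + v))%:E).
  apply/measurable_EFinP; apply: (measurableT_comp measurable_gumbel).
  exact: measurable_funD.
rewrite -sumEFin.
transitivity (\int[mu]_x \sum_(n < N) (((1 - expR (- h)) * expR (- h) ^+ n)%:E *
    ((gumbel (x + v))%:E * skeleton_tail h n x)))%E.
  rewrite ge0_integral_sum//=; last 2 first.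
  - move=> n; apply: emeasurable_funM => //; apply: emeasurable_funM => //.
    exact: measurable_skeleton_tail.
  - move=> n x _; rewrite !mule_ge0 ?skeleton_tail_ge0// lee_fin ?gumbel_ge0//.
    exact: geo_coef_ge0.
  apply: eq_bigr => n _; rewrite EFinM skeleton_laplace_tail ge0_integralZl//=.
  - by apply: emeasurable_funM => //; exact: measurable_skeleton_tail.
  - by move=> x _; rewrite mule_ge0 ?skeleton_tail_ge0// lee_fin gumbel_ge0.
  - by rewrite lee_fin; exact: geo_coef_ge0.
apply: eq_integral => x _; rewrite /mean_weight ge0_sume_distrr; last first.
  by move=> n _; rewrite mule_ge0 ?skeleton_tail_ge0// lee_fin; exact: geo_coef_ge0.
by apply: eq_bigr => n _; rewrite muleCA.
Qed.

Lemma measurable_grid_passage h n :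
  measurable_fun setT (fun w => (grid_passage (X ^~ w) h n)%:R : R).
Proof. exact: measurable_lt_skeleton. Qed.

Lemma measurable_grid_weight q h N :
  measurable_fun setT (fun w => grid_weight (X ^~ w) q h N).
Proof.
apply: measurable_sum => n; apply: measurable_funM => //.
exact: measurable_grid_passage.
Qed.

(** Self-similarity: exceeding exp x on the grid of mesh h amounts in law to
    exceeding 1 on the grid of mesh exp (- alpha x) h. *)
Lemma mean_weightE h N (x : R) : 0 < h ->
  (mean_weight h N x = \int[P]_w (grid_weight (X ^~ w) (expR (alpha * x))
     (expR (- (alpha * x)) * h) N)%:E)%E.
Proof.
move=> h0; set q := expR (alpha * x); set h' := expR (- (alpha * x)) * h.
have h'0 : 0 < h' by rewrite mulr_gt0// expR_gt0.
have qh : q * h' = h by rewrite /q /h' mulrA -expRD subrr expR0 mul1r.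
rewrite /mean_weight /grid_weight qh.
under eq_integral do rewrite -sumEFin.
rewrite ge0_integral_sum//=; last 2 first.
- move=> n; apply/measurable_EFinP; apply: measurable_funM => //.
  exact: measurable_grid_passage.
- by move=> n w _; rewrite lee_fin mulr_ge0// geo_coef_ge0// ltW.
apply: eq_bigr => n _.
under [in RHS]eq_integral do rewrite EFinM.
rewrite ge0_integralZl//=; last 2 first.
- by apply/measurable_EFinP; exact: measurable_grid_passage.
- by rewrite lee_fin geo_coef_ge0// ltW.
congr (_ * _)%E.
have I (f : T -> R) (y : R) : measurable_fun setT f ->
    (\int[P]_w ((y < f w)%R%:R)%:E)%E = P [set w | y < f w].
  move=> mf.
  have mA : measurable [set w | y < f w].
    have := mf measurableT `]y, +oo[%classic (measurable_itv _).
    rewrite setTI; congr (measurable _); apply/seteqP.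
    by split=> w /=; rewrite in_itv/= andbT.
  transitivity (P ([set w | y < f w] `&` setT)); last by rewrite setIT.
  rewrite -integral_indic//.
  by apply: eq_integral => w _; rewrite indicE mem_setE.
rewrite /skeleton_tail I; last exact: measurable_skeleton_max.
transitivity (P [set w | 1 < skeleton_max h' n w]); last first.
  by rewrite -I//; exact: measurable_skeleton_max.
have q0 : 0 < q by exact: expR_gt0.
rewrite -(skeleton_max_scaling n 1 q0 (ltW h'0)) qh mul1r.
rewrite /q mulrC -expRM -mulrA divff ?mulr1// gt_eqF//.
Qed.

Definition weight_limsup w : \bar R :=
  limn_esup (fun j => (grid_weight (X ^~ w) 1 (1 * 2^-1 ^+ j) (4 ^ j))%:E).

(** A measurable version of the first passage time, read off from the limit exp
    (- t) of the grid weights with q = 1. *)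
Definition passage_time w : \bar R :=
  if (0 < weight_limsup w)%E then (Num.max 0 (- ln (fine (weight_limsup w))))%:E else +oo%E.

Lemma measurable_passage_time : measurable_fun setT passage_time.
Proof.
have mW : measurable_fun setT weight_limsup.
  apply: measurable_fun_limn_esup => j; apply/measurable_EFinP.
  exact: measurable_grid_weight.
apply: measurable_fun_ifT.
- by apply: measurable_fun_lte.
- apply/measurable_EFinP; apply: measurable_maxr => //.
  apply: measurableT_comp => //; apply: (measurableT_comp (@measurable_ln R)).
  exact: (measurableT_comp (fine_measurable measurableT)).
- exact: measurable_cst.
Qed.

Lemma passage_time_ge0 w : (0 <= passage_time w)%E.
Proof. by rewrite /passage_time; case: ifP => _; rewrite ?leey// lee_fin le_max lexx. Qed.

(** The part of almost sure regularity which the discretization uses. *)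
Definition regular_path (x : R -> R) : Prop :=
  x 0 = 0 /\ (forall t, 0 <= t -> x u @[u --> t^'+] --> x t).

Lemma ae_regular_path : {ae P, forall w, regular_path (X ^~ w)}.
Proof.
move: (levy_start lX) (levy_cadlag lX); apply: filterS2 => w h1 [h2 _].
by split.
Qed.

Lemma passage_timeE w : regular_path (X ^~ w) -> passage_time w = first_passage X 1 w.
Proof.
move=> [x0 rx]; have C := grid_weight_cvg x0 rx ltr01 ltr01.
have W : weight_limsup w = (fine (expeR (- (1%:E * path_passage (X ^~ w)))))%:E.
  have C' : (grid_weight (X ^~ w) 1 (1 * 2^-1 ^+ j) (4 ^ j))%:E @[j --> \oo] -->
      (fine (expeR (- (1%:E * path_passage (X ^~ w)))))%:E.
    by apply: cvg_EFin; [exact: nearW|exact: C].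
  by rewrite /weight_limsup is_cvg_limn_esupE; [exact: cvg_lim C'|exact: cvgP C'].
have fE : first_passage X 1 w = path_passage (X ^~ w) by [].
rewrite /passage_time W fE mul1e; have := path_passage_ge0 (X ^~ w).
case: (path_passage (X ^~ w)) => [t| |]//=.
  by rewrite !lee_fin lte_fin expR_gt0 expRK opprK => t0; rewrite max_r.
by rewrite ltxx.
Qed.

Definition passage_exp (x : R) w : \bar R := expeR (- ((expR x)%:E * passage_time w)).

Lemma measurable_passage_exp : measurable_fun setT (fun p : R * T => passage_exp p.1 p.2).
Proof.
apply: (measurableT_comp measurable_expeR); apply: measurableT_comp => //.
apply: emeasurable_funM.
  apply/measurable_EFinP; apply: measurableT_comp => //; exact: measurable_expR.
exact: (measurableT_comp measurable_passage_time).
Qed.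

Lemma measurable_passage_exp1 x : measurable_fun setT (passage_exp x).
Proof.
apply: (measurableT_comp measurable_expeR); apply: measurableT_comp => //.
by apply: emeasurable_funM => //; exact: measurable_passage_time.
Qed.

Lemma passage_exp_bounds x w : (0 <= passage_exp x w <= 1)%E.
Proof.
rewrite expeR_ge0 -expeR0 lee_expeR oppe_le0 mule_ge0 ?lee_fin ?expR_ge0//.
exact: passage_time_ge0.
Qed.

Definition passage_laplace (x : R) : \bar R := (\int[P]_w passage_exp x w)%E.

Lemma measurable_passage_laplace : measurable_fun setT passage_laplace.
Proof.
apply: (@measurable_integral2 _ _ _ _ _ P passage_exp); first exact: measurable_passage_exp.
by move=> x w; have /andP[] := passage_exp_bounds x w.
Qed.

Lemma passage_laplace_bounds x : (0 <= passage_laplace x <= 1)%E.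
Proof.
apply/andP; split.
  by apply: integral_ge0 => w _; have /andP[] := passage_exp_bounds x w.
rewrite -[leRHS](@probability_setT _ _ _ P) -[leRHS]mul1e -integral_cst//.
apply: ge0_le_integral => //=.
- by move=> w _; have /andP[] := passage_exp_bounds x w.
- exact: measurable_passage_exp1.
- by move=> w _; have /andP[] := passage_exp_bounds x w.
Qed.

Lemma mean_weight_cvg (x : R) :
  mean_weight (2^-1 ^+ j) (4 ^ j) x @[j --> \oo] --> passage_laplace (alpha * x).
Proof.
have h0 j : 0 < 2^-1 ^+ j :> R by rewrite exprn_gt0.
rewrite (_ : (fun j => _) = (fun j => \int[P]_w (grid_weight (X ^~ w) (expR (alpha * x))
    (expR (- (alpha * x)) * 2^-1 ^+ j) (4 ^ j))%:E)%E); last first.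
  by apply/funext => j; rewrite mean_weightE.
have mE := measurable_passage_exp1 (alpha * x).
have [||||_ _] := @dominated_convergence _ _ _ P setT measurableT
  (fun j w => (grid_weight (X ^~ w) (expR (alpha * x)) (expR (- (alpha * x)) * 2^-1 ^+ j) (4 ^ j))%:E)
  (passage_exp (alpha * x)) (cst 1%E) _ mE.
- by move=> j; apply/measurable_EFinP; exact: measurable_grid_weight.
- apply: filterS ae_regular_path => w rw _.
  have := passage_timeE rw; case: rw => x0 rx TE.
  have C := grid_weight_cvg x0 rx (expR_gt0 (alpha * x)) (expR_gt0 (- (alpha * x))).
  have -> : passage_exp (alpha * x) w =
      (fine (expeR (- ((expR (alpha * x))%:E * path_passage (X ^~ w)))))%:E.
    rewrite /passage_exp TE fineK// ge0_fin_numE ?expeR_ge0//.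
    rewrite (@le_lt_trans _ _ 1%E) ?ltry// -expeR0 lee_expeR oppe_le0.
    by rewrite mule_ge0 ?lee_fin ?expR_ge0// path_passage_ge0.
  by apply: cvg_EFin; [exact: nearW|exact: C].
- exact: finite_measure_integrable_cst.
- apply: aeW => w j _ /=; rewrite lee_fin.
  have hh : 0 < expR (- (alpha * x)) * 2^-1 ^+ j by rewrite mulr_gt0 ?expR_gt0.
  have /andP[a b] := grid_weight_bounds (X ^~ w) (4 ^ j) (expR_gt0 (alpha * x)) hh.
  by rewrite ger0_norm.
- exact.
Qed.

(** Dominated by the Gumbel density, since mean weights are at most 1. *)
Lemma mean_weight_integral_cvg (v : R) :
  (\int[mu]_x ((gumbel (x + v))%:E * mean_weight (2^-1 ^+ j) (4 ^ j) x))%E @[j --> \oo] -->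
  (\int[mu]_x ((gumbel (x + v))%:E * passage_laplace (alpha * x)))%E.
Proof.
have h0 j : 0 < 2^-1 ^+ j :> R by rewrite exprn_gt0.
have mg : measurable_fun setT (fun x : R => (gumbel (x + v))%:E).
  apply/measurable_EFinP; apply: (measurableT_comp measurable_gumbel).
  exact: measurable_funD.
have mL : measurable_fun setT (fun x : R => passage_laplace (alpha * x)).
  by apply: (measurableT_comp measurable_passage_laplace); exact: mulrl_measurable.
have [||||_ _] := @dominated_convergence _ _ _ mu setT measurableT
  (fun j x => ((gumbel (x + v))%:E * mean_weight (2^-1 ^+ j) (4 ^ j) x)%E)
  (fun x => (gumbel (x + v))%:E * passage_laplace (alpha * x))%E
  (fun x => (gumbel (x + v))%:E) _ (emeasurable_funM mg mL).
- by move=> j; apply: emeasurable_funM => //; exact: measurable_mean_weight.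
- apply: aeW => x _; apply: cvgeZl => //; exact: mean_weight_cvg.
- apply/integrableP; split => //.
  under eq_integral do rewrite gee0_abs ?lee_fin ?gumbel_ge0//.
  rewrite (ge0_integral_shift v (f := fun x => (gumbel x)%:E)) ?integral_gumbel ?ltry//.
  - by apply/measurable_EFinP; exact: measurable_gumbel.
  - by move=> x; rewrite lee_fin gumbel_ge0.
- apply: aeW => x j _.
  rewrite gee0_abs; last first.
    by rewrite mule_ge0 ?lee_fin ?gumbel_ge0// mean_weight_ge0// ltW.
  rewrite -[leRHS]mule1 lee_pmul ?lee_fin ?gumbel_ge0// ?(mean_weight_ge0 _ _ (ltW (h0 j)))//.
  rewrite mean_weightE// -[leRHS](@probability_setT _ _ _ P) -[leRHS]mul1e -integral_cst//.
  have hh : 0 < expR (- (alpha * x)) * 2^-1 ^+ j by rewrite mulr_gt0 ?expR_gt0.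
  have B w := grid_weight_bounds (X ^~ w) (4 ^ j) (expR_gt0 (alpha * x)) hh.
  apply: ge0_le_integral => //=.
  - by move=> w _; rewrite lee_fin; have /andP[] := B w.
  - by apply/measurable_EFinP; exact: measurable_grid_weight.
  - by move=> w _; rewrite lee_fin; have /andP[] := B w.
- exact.
Qed.

(** The accumulated error of undershoot_excess_bound is of order h^(2/alpha) /
    h, and alpha < 2. *)
Lemma grid_error_cvg (c : R) :
  c * ((2^-1 ^+ j) `^ alpha^-1) ^+ 2 / 2^-1 ^+ j @[j --> \oo] --> (0 : R).
Proof.
pose theta : R := (2^-1 `^ alpha^-1) ^+ 2 / 2^-1.
have t0 : 0 <= theta by rewrite mulr_ge0// sqr_ge0.
have t1 : theta < 1.
  rewrite /theta ltr_pdivrMr// mul1r -powR_mulrn ?powR_ge0// -powRrM.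
  rewrite /powR gt_eqF// -[ltRHS]lnK ?posrE// ltr_expR -[ltRHS]mul1r ltr_nM2r.
    by rewrite mulrC ltr_pdivlMr ?mul1r.
  by rewrite ln_lt0// invr_gt0 ltr0n/= invf_lt1// ltr1n.
have powX (x : R) j : 0 <= x -> (x ^+ j) `^ alpha^-1 = (x `^ alpha^-1) ^+ j.
  by move=> x0; rewrite -[x ^+ j]powR_mulrn// -powRrM mulrC powRrM powR_mulrn ?powR_ge0.
(* On the dyadic grids the error is a geometric sequence. *)
rewrite (_ : (fun j => _) = (fun j => c * theta ^+ j)); last first.
  apply/funext => j; rewrite /theta exprMn -exprVn -mulrA; congr (_ * (_ * _)).
  rewrite -exprM mulnC exprM; congr (_ ^+ 2).
  exact: powX.
rewrite -[X in _ --> X](mulr0 c); apply: cvgMr; apply: cvg_expr.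
by rewrite ger0_norm.
Qed.

(** The key identity. The left-hand side is the limit of the integrals of
    mean_weight_laplace, that is of 1 - r^N - (1 - r) sum r^n L n with r = exp
    (- h) and l = exp v. By abel_lindley,

        (1 - r w) (1 - r) sum r^n L n = (1 - r) (1 - l) + o(h),   r w = exp (- h (1 - l^alpha)),

    and dividing by h gives (1 - l^alpha) (1 - I) = 1 - l for the limit I. *)
Lemma integral_gumbel_passage_laplace (v : R) : v != 0 ->
  (\int[mu]_x ((gumbel (x + v))%:E * passage_laplace (alpha * x)) =
   ((expR v - expR (alpha * v)) / (1 - expR (alpha * v)))%:E)%E.
Proof.
move=> v0.
pose h j : R := 2^-1 ^+ j.
have h0 j : 0 < h j by rewrite exprn_gt0.
have h1 j : h j <= 1 by rewrite exprn_ile1// invf_le1// ler1n.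
set I := (\int[mu]_x _)%E.
have mg : measurable_fun setT (fun x : R => (gumbel (x + v))%:E).
  apply/measurable_EFinP; apply: (measurableT_comp measurable_gumbel).
  exact: measurable_funD.
have I0 : (0 <= I)%E.
  apply: integral_ge0 => x _; rewrite mule_ge0 ?lee_fin ?gumbel_ge0//.
  by have /andP[] := passage_laplace_bounds (alpha * x).
have I1 : (I <= 1)%E.
  rewrite -integral_gumbel -(ge0_integral_shift v (f := fun x => (gumbel x)%:E)).
  - apply: ge0_le_integral => //=.
    + move=> x _; rewrite mule_ge0 ?lee_fin ?gumbel_ge0//.
      by have /andP[] := passage_laplace_bounds (alpha * x).
    + apply: emeasurable_funM => //.
      apply: (measurableT_comp measurable_passage_laplace); exact: mulrl_measurable.
    + move=> x _; rewrite -[leRHS]mule1 lee_pmul ?lee_fin ?gumbel_ge0//;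
        by have /andP[] := passage_laplace_bounds (alpha * x).
  - by apply/measurable_EFinP; exact: measurable_gumbel.
  - by move=> x; rewrite lee_fin gumbel_ge0.
have fI : I = (fine I)%:E.
  by rewrite fineK// ge0_fin_numE// (le_lt_trans I1)// ltry.
pose l := expR v; pose L j := skeleton_laplace (h j) l.
pose r j := expR (- h j).
pose a j := \sum_(n < (4 ^ j)%N) (1 - r j) * r j ^+ n * (1 - L j n).
have ca : a j @[j --> \oo] --> fine I.
  suff : (a j)%:E @[j --> \oo] --> (fine I)%:E by move/fine_cvg.
  rewrite -fI (_ : (fun j => _) = (fun j => \int[mu]_x ((gumbel (x + v))%:E * mean_weight (2^-1 ^+ j) (4 ^ j) x))%E).
    exact: mean_weight_integral_cvg.
  by apply/funext => j; rewrite -mean_weight_laplace// ltW.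
have Gd j : (1 - r j) * \sum_(n < (4 ^ j)%N) r j ^+ n * L j n = 1 - r j ^+ (4 ^ j) - a j.
  have -> : 1 - r j ^+ (4 ^ j) = (1 - r j) * \sum_(n < (4 ^ j)%N) r j ^+ n.
    by rewrite -[LHS]opprB subrX1 -mulNr opprB.
  rewrite /a mulr_sumr [in RHS]mulr_sumr -sumrB; apply: eq_bigr => n _.
  by rewrite mulrA; move: ((1 - r j) * r j ^+ n) => c; rewrite mulrBr mulr1 subKr.
pose A : R := 1 - l `^ alpha.
(* The limit of abel_lindley divided by h, each factor replaced by its limit. *)
have key : `|A * (1 - 0 - fine I) - 1 * (1 - l)| <= 1 * (1 + l) * 0 + 0.
  have cr : (1 - r j) / h j @[j --> \oo] --> (1 : R).
    rewrite (_ : (fun j => _) = (fun j => - ((expR (- 1 * 2^-1 ^+ j) - 1) / 2^-1 ^+ j))).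
      by rewrite -[X in _ --> X]opprK; apply: cvgN; exact: expR_quotient_cvg.
    by apply/funext => j; rewrite mulN1r -mulNr opprB.
  have cA : (1 - r j * expR (h j * l `^ alpha)) / h j @[j --> \oo] --> A.
    rewrite (_ : (fun j => _) = (fun j => - ((expR (- A * 2^-1 ^+ j) - 1) / 2^-1 ^+ j))).
      by rewrite -[X in _ --> X]opprK; apply: cvgN; exact: expR_quotient_cvg.
    apply/funext => j.
    have -> : r j * expR (h j * l `^ alpha) = expR (- A * 2^-1 ^+ j).
      by rewrite /r -expRD; congr expR; rewrite /A /h; ring.
    by move: (expR _) => e; rewrite -mulNr opprB.
  have cl : (fun j => `|(1 - r j * expR (h j * l `^ alpha)) / h j * (1 - r j ^+ (4 ^ j) - a j) -
       (1 - r j) / h j * (1 - l)|) @ \oo --> `|A * (1 - 0 - fine I) - 1 * (1 - l)|.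
    apply: cvg_norm; apply: cvgB; last by apply: cvgMl.
    apply: cvgM => //; apply: cvgB => //; apply: cvgB; first exact: cvg_cst.
    exact: expR_grid_tail_cvg.
  have cu : (fun j => (1 - r j) / h j * (1 + l) * r j ^+ (4 ^ j) +
      undershoot_bound l * (h j `^ alpha^-1) ^+ 2 / h j) @ \oo --> 1 * (1 + l) * 0 + 0.
    apply: cvgD; last exact: grid_error_cvg.
    by apply: cvgM; [exact: cvgMl|exact: expR_grid_tail_cvg].
  apply: (ler_cvg_to cl cu); apply: nearW => j.
  have l0 : 0 <= l by exact: expR_ge0.
  have S n := skeleton_recursion n (ltW (h0 j)) l0.
  have S1 n := skeleton_recursion n (ltW (h0 j)) ler01.
  have := @abel_lindley R (L j) (skeleton_laplace (h j) 1) (undershoot_excess (h j) l)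
    (undershoot_excess (h j) 1) (expR (h j * l `^ alpha)) (r j) l
    (undershoot_bound l * (h j `^ alpha^-1) ^+ 2) (4 ^ j).
  have st g c : skeleton_laplace g c 0 = 1.
    rewrite /skeleton_laplace /skeleton_max /=.
    under eq_integral do rewrite mulr0 expR0.
    by rewrite integral_cst//= probability_setT mule1.
  have bl c n : 0 <= c -> 0 <= skeleton_laplace (h j) c n <= 1.
    by move=> c0; have [] := skeleton_laplaceE (h j) n c0.
  have r1 : r j <= 1 by rewrite expR_le1 oppr_le0 ltW.
  move=> /(_ (st _ _) (st _ _) (expR_gt0 _) r1 l0 (fun n => (S n).2)) H.
  have S2 n : skeleton_laplace (h j) 1 n.+1 =
      (r j)^-1 * skeleton_laplace (h j) 1 n - undershoot_excess (h j) 1 n.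
    by rewrite (S1 n).2 powR1 mulr1 /r expRN invrK.
  have {}H := H S2 (fun n => bl _ n l0) (fun n => bl _ n ler01)
    (fun n => undershoot_excess_bound n (h0 j) (h1 j) l0).
  have hi : 0 <= (h j)^-1 by rewrite invr_ge0 ltW.
  have := ler_wpM2r hi H; rewrite -{1}(ger0_norm hi) -normrM Gd.
  move: (a j) (r j) (r j ^+ _) (undershoot_bound l * _) (h j)^-1 (r j * expR _) => u3 u4 u1 u2 u5 u6.
  move=> HH; rewrite [X in `|X|](_ : _ = ((1 - u6) * (1 - u1 - u3) - (1 - u4) * (1 - l)) * u5); last by ring.
  by apply: (le_trans HH); rewrite le_eqVlt; apply/orP; left; apply/eqP; ring.
rewrite fI; congr (_%:E).
have Al : A = 1 - expR (alpha * v) by rewrite /A /l -expRM mulrC.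
have A0 : A != 0.
  by rewrite Al subr_eq0 eq_sym -expR0 (inj_eq (@expR_inj R)) mulf_neq0// gt_eqF.
rewrite -Al; move: key; rewrite subr0 mulr0 addr0 mul1r normr_le0 subr_eq0 => /eqP key.
apply: (mulIf A0); rewrite divfK//.
have -> : expR v - expR (alpha * v) = A - (1 - l) by rewrite Al /l; ring.
by rewrite -key; ring.
Qed.

(** * Moments of the passage time *)

Definition passage_mellin (s : R) : \bar R := (\int[P]_w epower (passage_time w) s)%E.

Lemma measurable_epower_passage s : measurable_fun setT (fun w => epower (passage_time w) s).
Proof. exact: (measurableT_comp (measurable_epower s) measurable_passage_time). Qed.

Lemma passage_mellinE s :
  (\int[P]_w epower (first_passage X 1 w) s = passage_mellin s)%E.
Proof.
apply: eq_integral_ae.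
- exact: measurable_epower_passage.
- by move=> w; exact: epower_ge0.
- by move=> w; exact: epower_ge0.
- by apply: filterS ae_regular_path => w /passage_timeE ->.
Qed.

Lemma passage_mellin0 : passage_mellin 0 = 1%E.
Proof.
rewrite /passage_mellin /epower; under eq_integral do rewrite mul0e expeR0.
by rewrite integral_cst//= probability_setT mule1.
Qed.

Lemma mellin_passage_laplace s : s < 0 ->
  (\int[mu]_x ((expR (- s * x))%:E * passage_laplace x) =
   (euler_gamma (- s))%:E * passage_mellin s)%E.
Proof.
move=> s0; have g0 : 0 < euler_gamma (- s) by rewrite euler_gamma_gt0// oppr_gt0.
have p0 x w : (0 <= passage_exp x w)%E by have /andP[] := passage_exp_bounds x w.
rewrite -ge0_integralZl//; last 3 first.
- exact: measurable_epower_passage.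
- by move=> w _; exact: epower_ge0.
- by rewrite lee_fin ltW.
transitivity (\int[mu]_x \int[P]_w ((expR (- s * x))%:E * passage_exp x w))%E.
  apply: eq_integral => x _; rewrite ge0_integralZl//.
  exact: measurable_passage_exp1.
rewrite (@lebesgue_prob_tonelli _ _ _ P (fun x w => (expR (- s * x))%:E * passage_exp x w)%E); last 2 first.
- apply: emeasurable_funM; last exact: measurable_passage_exp.
  exact: (measurableT_comp (measurable_expR_mul (- s))).
- by move=> x w; rewrite mule_ge0// lee_fin expR_ge0.
by apply: eq_integral => w _; rewrite mellin_survival// passage_time_ge0.
Qed.

Lemma passage_laplace_fin x : passage_laplace x \is a fin_num.
Proof.
have /andP[l0 l1] := passage_laplace_bounds x.
by rewrite ge0_fin_numE// (le_lt_trans l1)// ltry.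
Qed.

Lemma passage_laplace_compl x :
  (1 - passage_laplace x = \int[P]_w (1 - passage_exp x w))%E.
Proof.
have b w := passage_exp_bounds x w.
have f w : passage_exp x w \is a fin_num.
  have /andP[b0 b1] := b w.
  by rewrite ge0_fin_numE// (le_lt_trans b1)// ltry.
have b' w : (0 <= 1 - passage_exp x w)%E.
  by have /andP[_ b1] := b w; rewrite sube_ge0// f.
have fl := passage_laplace_fin x.
suff E : (\int[P]_w (1 - passage_exp x w) + passage_laplace x = 1)%E.
  by rewrite -[X in (X - _)%E = _]E addeK.
rewrite -ge0_integralD//.
- under eq_integral do rewrite subeK//.
  by rewrite integral_cst//= probability_setT mule1.
- by apply: emeasurable_funB => //; exact: measurable_passage_exp1.
- by move=> w _; have /andP[] := b w.
- exact: measurable_passage_exp1.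
Qed.

Lemma mellin_passage_laplace_compl s : 0 < s -> s < 1 ->
  (\int[mu]_x ((expR (- s * x))%:E * (1 - passage_laplace x)) =
   (euler_gamma (1 - s) / s)%:E * passage_mellin s)%E.
Proof.
move=> s0 s1.
have g0 : 0 < euler_gamma (1 - s) / s by rewrite divr_gt0// euler_gamma_gt0// subr_gt0.
have p0 x w : (0 <= 1 - passage_exp x w)%E.
  have /andP[b0 b1] := passage_exp_bounds x w.
  by rewrite sube_ge0// ge0_fin_numE// (le_lt_trans b1)// ltry.
rewrite -ge0_integralZl//; last 3 first.
- exact: measurable_epower_passage.
- by move=> w _; exact: epower_ge0.
- by rewrite lee_fin ltW.
transitivity (\int[mu]_x \int[P]_w ((expR (- s * x))%:E * (1 - passage_exp x w)))%E.
  apply: eq_integral => x _; rewrite passage_laplace_compl ge0_integralZl//.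
  by apply: emeasurable_funB => //; exact: measurable_passage_exp1.
rewrite (@lebesgue_prob_tonelli _ _ _ P (fun x w => (expR (- s * x))%:E * (1 - passage_exp x w))%E); last 2 first.
- apply: emeasurable_funM; last by apply: emeasurable_funB => //; exact: measurable_passage_exp.
  exact: (measurableT_comp (measurable_expR_mul (- s))).
- by move=> x w; rewrite mule_ge0// lee_fin expR_ge0.
by apply: eq_integral => w _; rewrite mellin_distribution// passage_time_ge0.
Qed.

Lemma passage_laplace_scaled_ge0 x : (0 <= passage_laplace (alpha * x))%E.
Proof. by have /andP[] := passage_laplace_bounds (alpha * x). Qed.

Lemma measurable_passage_laplace_scaled :
  measurable_fun setT (fun x : R => passage_laplace (alpha * x)).
Proof.
by apply: (measurableT_comp measurable_passage_laplace); exact: mulrl_measurable.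
Qed.

Lemma alphaV_gt0 : 0 < alpha^-1. Proof. by rewrite invr_gt0. Qed.

Lemma alphaV_lt1 : alpha^-1 < 1. Proof. by rewrite invf_lt1. Qed.

Lemma alphaV_gt_half : 1 < 2 * alpha^-1.
Proof. by rewrite mulrC ltr_pdivlMl// mulr1. Qed.

(** The Mellin transform of the key identity at alpha s, in the strip where all
    the integrals converge. *)
Lemma mellin_equation_neg s : - alpha^-1 < s -> s < 0 ->
  ((euler_gamma (1 + alpha * s))%:E * ((euler_gamma (- s))%:E * passage_mellin s) =
   (pi * cot (pi * (s + alpha^-1)) - pi * cot (pi * (s + 1)))%:E)%E.
Proof.
move=> s1 s0; have a0 := alphaV_gt0; have a1 := alphaV_lt1.
have as1 : -1 < alpha * s by rewrite -ltr_pdivrMl// mulrN mulr1.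
rewrite -(mellin_passage_laplace s0) -(integral_gumbel_mellin as1).
rewrite -(@integral_exp_ratio _ (s + alpha^-1) (s + 1)); [|lra..].
have m x : (0 <= passage_laplace x)%E by have /andP[] := passage_laplace_bounds x.
rewrite (@mellin_equation _ alpha s gumbel passage_laplace
  (fun x => (expR (alpha^-1 * x) - expR (1 * x)) / (1 - expR x)))//.
- by apply: eq_integral => x _; rewrite exp_ratio_mul.
- exact: measurable_gumbel.
- exact: measurable_passage_laplace.
- exact: measurable_exp_ratio.
- exact: gumbel_ge0.
- by move=> x; apply: exp_ratio_ge0; lra.
move=> v v0; rewrite integral_gumbel_passage_laplace//; congr (_%:E).
have -> : alpha^-1 * (alpha * v) = v by rewrite mulrA mulVf ?mul1r// gt_eqF.
by rewrite mul1r.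
Qed.

(** To the right of that strip the Laplace transform phi of the passage time is
    replaced by 1 - phi, and the right-hand side F of the key identity by 1 - F. *)
Lemma mellin_equation_pos s : 0 < s -> s < 1 - alpha^-1 ->
  ((euler_gamma (1 + alpha * s))%:E * ((euler_gamma (1 - s) / s)%:E * passage_mellin s) =
   (pi * cot (pi * s) - pi * cot (pi * (s + alpha^-1)))%:E)%E.
Proof.
move=> s0 s1; have a0 := alphaV_gt0; have a1 := alphaV_lt1.
have as1 : -1 < alpha * s by rewrite (lt_trans (ltrN10 R))// mulr_gt0.
rewrite -mellin_passage_laplace_compl//; last by lra.
rewrite -(integral_gumbel_mellin as1).
rewrite -(@integral_exp_ratio _ s (s + alpha^-1)); [|lra..].
have c0 x : (0 <= 1 - passage_laplace x)%E.
  have /andP[l0 l1] := passage_laplace_bounds x.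
  by rewrite sube_ge0// passage_laplace_fin.
have mc : measurable_fun setT (fun x => 1 - passage_laplace x)%E.
  by apply: emeasurable_funB => //; exact: measurable_passage_laplace.
rewrite (@mellin_equation _ alpha s gumbel (fun x => 1 - passage_laplace x)%E
  (fun x => (expR (0 * x) - expR (alpha^-1 * x)) / (1 - expR x)))//.
- by apply: eq_integral => x _; rewrite exp_ratio_mul addr0.
- exact: measurable_gumbel.
- exact: measurable_exp_ratio.
- exact: gumbel_ge0.
- by move=> x; apply: exp_ratio_ge0; lra.
move=> v v0; have av : alpha * v != 0 by rewrite mulf_neq0// gt_eqF.
have S : (\int[mu]_x ((gumbel (x + v))%:E * (1 - passage_laplace (alpha * x))) +
    \int[mu]_x ((gumbel (x + v))%:E * passage_laplace (alpha * x)) = 1)%E.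
  rewrite -[RHS](integral_gumbel_shift v) -ge0_integralD//.
  - apply: eq_integral => x _; rewrite -ge0_muleDr ?subeK ?mule1 ?passage_laplace_fin//.
    exact: passage_laplace_scaled_ge0.
  - by move=> x _; rewrite mule_ge0// lee_fin gumbel_ge0.
  - apply: emeasurable_funM; first exact: measurable_gumbel_shift.
    by apply: emeasurable_funB => //; exact: measurable_passage_laplace_scaled.
  - by move=> x _; rewrite mule_ge0 ?lee_fin ?gumbel_ge0// passage_laplace_scaled_ge0.
  - apply: emeasurable_funM; first exact: measurable_gumbel_shift.
    exact: measurable_passage_laplace_scaled.
move: S; rewrite integral_gumbel_passage_laplace//.
case: (\int[mu]_x _)%E => [r| |]//; rewrite -EFinD => -[E]; congr (_%:E).
have ev : alpha^-1 * (alpha * v) = v by rewrite mulrA mulVf ?mul1r// gt_eqF.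
have n0 := one_sub_expR_neq0 av; rewrite ev mul0r expR0.
have -> : r = 1 - (expR v - expR (alpha * v)) / (1 - expR (alpha * v)) by apply/eqP; rewrite eq_sym subr_eq E.
move: (expR v) (expR (alpha * v)) n0 => e e' n0.
by field.
Qed.

(** The limit of the key identity divided by exp v as v tends to -oo: the Gumbel
    kernel increases to exp x, and the right-hand side tends to 1. *)
Lemma integral_exp_passage_laplace :
  (\int[mu]_x ((expR x)%:E * passage_laplace (alpha * x)) = 1)%E.
Proof.
pose g n (x : R) : \bar R := ((expR x * expR (- expR (x - n.+1%:R)))%:E * passage_laplace (alpha * x))%E.
have mg n : measurable_fun setT (g n).
  apply: emeasurable_funM; last exact: measurable_passage_laplace_scaled.
  apply/measurable_EFinP; apply: measurable_funM; first exact: measurable_expR.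
  apply: measurableT_comp; first exact: measurable_expR.
  apply: measurableT_comp => //; apply: measurableT_comp; first exact: measurable_expR.
  exact: measurable_funB.
have g0 n x : (0 <= g n x)%E.
  by rewrite mule_ge0 ?passage_laplace_scaled_ge0// lee_fin mulr_ge0 ?expR_ge0.
have gn x : {homo g ^~ x : n m / (n <= m)%N >-> (n <= m)%E}.
  move=> n m nm; apply: lee_wpmul2r; first exact: passage_laplace_scaled_ge0.
  rewrite lee_fin ler_wpM2l ?expR_ge0// ler_expR lerN2 ler_expR lerD2l lerN2.
  by rewrite ler_nat.
have gl x : g n x @[n --> \oo] --> ((expR x)%:E * passage_laplace (alpha * x))%E.
  apply: cvgeZr.
    exact: passage_laplace_fin.
  apply: cvg_EFin; first exact: nearW.
  rewrite -[X in _ --> X]mulr1; apply: cvgMr; rewrite -[X in _ --> X]expR0 -oppr0.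
  apply: continuous_cvg; first exact: continuous_expR.
  apply: cvgN; rewrite -[X in _ --> X](mulr0 (expR x)).
  under eq_fun do rewrite expRD -mulN1r.
  by apply: cvgMr; exact: expR_nat_cvg.
have C := @cvg_monotone_convergence _ _ _ mu setT measurableT g mg (fun n x _ => g0 n x) (fun x _ => gn x).
have E n : (\int[mu]_x g n x = ((1 - expR (- (alpha - 1) * n.+1%:R)) / (1 - expR (- alpha * n.+1%:R)))%:E)%E.
  have v0 : - n.+1%:R != 0 :> R by rewrite oppr_eq0 pnatr_eq0.
  have H := integral_gumbel_passage_laplace v0.
  transitivity (\int[mu]_x ((expR n.+1%:R)%:E * ((gumbel (x - n.+1%:R))%:E * passage_laplace (alpha * x))))%E.
    apply: eq_integral => x _; rewrite muleA -EFinM /g /gumbel -!expRD; congr ((expR _)%:E * _)%E.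
    ring.
  rewrite ge0_integralZl//.
  - rewrite H -EFinM mulrA mulrBr -!expRD; congr (((_ - expR _) / (1 - expR _))%:E).
    + by rewrite subrr expR0.
    + ring.
    + ring.
  - apply: emeasurable_funM; first exact: measurable_gumbel_shift.
    exact: measurable_passage_laplace_scaled.
  - by move=> x _; rewrite mule_ge0 ?passage_laplace_scaled_ge0// lee_fin gumbel_ge0.
have L : ((1 - expR (- (alpha - 1) * n.+1%:R)) / (1 - expR (- alpha * n.+1%:R)))%:E @[n --> \oo] --> (1 : R)%:E.
  apply: cvg_EFin; first exact: nearW.
  suff : (1 - expR (- (alpha - 1) * n.+1%:R)) / (1 - expR (- alpha * n.+1%:R)) @[n --> \oo] -->
      ((1 - 0) / (1 - 0) : R) by rewrite subr0 divr1.
  apply: cvgM; first by apply: cvgB; [exact: cvg_cst|by apply: expR_nat_cvg; rewrite subr_gt0].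
  apply: cvgV; first by rewrite subr0 oner_neq0.
  by apply: cvgB; [exact: cvg_cst|exact: expR_nat_cvg].
have C' : (\int[mu]_x g n x)%E @[n --> \oo] --> (1 : R)%:E by under eq_fun do rewrite E.
rewrite -(cvg_lim _ C')// (cvg_lim _ C)//.
by apply: eq_integral => x _; rewrite (cvg_lim _ (gl x)).
Qed.

(** To the left of the strip the Gumbel kernel g is replaced by exp - g, and the
    right-hand side F of the key identity by exp v - F, thanks to
    integral_exp_passage_laplace. *)
Lemma mellin_equation_low s : -1 < s -> s < - alpha^-1 ->
  ((euler_gamma (2 + alpha * s) / - (1 + alpha * s))%:E *
     ((euler_gamma (- s))%:E * passage_mellin s) =
   (pi * cot (pi * (s + 1)) - pi * cot (pi * (s + 1 + alpha^-1)))%:E)%E.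
Proof.
move=> s1 s0; have a0 := alphaV_gt0; have a1 := alphaV_lt1.
have p0 : 0 < - (1 + alpha * s) by rewrite oppr_gt0 -ltrBrDl sub0r -ltr_pdivlMl// mulrN1.
have p1 : - (1 + alpha * s) < 1.
  have : - alpha < alpha * s by rewrite -ltr_pdivrMl// mulrN mulVf// gt_eqF.
  by have := alpha2; lra.
have sn : s < 0 by lra.
rewrite -(mellin_passage_laplace sn).
have := integral_mellin_distribution p0 p1.
rewrite (_ : 1 - - (1 + alpha * s) = 2 + alpha * s); last by ring.
move=> <-.
rewrite -(@integral_exp_ratio _ (s + 1) (s + 1 + alpha^-1)); [|lra..].
have m x : (0 <= passage_laplace x)%E by have /andP[] := passage_laplace_bounds x.
pose h (z : R) := expR z * (1 - expR (- expR z)).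
have h0 z : 0 <= h z by rewrite mulr_ge0 ?expR_ge0// subr_ge0 expR_le1 oppr_le0 expR_ge0.
have mh : measurable_fun setT h.
  apply: measurable_funM; first exact: measurable_expR.
  apply: measurable_funB => //; apply: measurableT_comp; first exact: measurable_expR.
  by apply: measurableT_comp => //; exact: measurable_expR.
transitivity (\int[mu]_z (expR (alpha * s * z) * h z)%:E *
     \int[mu]_x ((expR (- s * x))%:E * passage_laplace x))%E.
  congr (_ * _)%E; apply: eq_integral => z _; rewrite /h mulrA -expRD; congr ((expR _ * _)%:E).
  ring.
rewrite (@mellin_equation _ alpha s h passage_laplace
  (fun x => (expR (1 * x) - expR ((1 + alpha^-1) * x)) / (1 - expR x)))//.
- by apply: eq_integral => x _; rewrite exp_ratio_mul addrA.
- exact: measurable_passage_laplace.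
- exact: measurable_exp_ratio.
- by move=> x; apply: exp_ratio_ge0; lra.
move=> v v0; have av : alpha * v != 0 by rewrite mulf_neq0// gt_eqF.
have S : (\int[mu]_x ((h (x + v)%R)%:E * passage_laplace (alpha * x)) +
    \int[mu]_x ((gumbel (x + v))%:E * passage_laplace (alpha * x)) = (expR v)%:E)%E.
  rewrite -ge0_integralD//.
  - rewrite -[RHS]mule1 -integral_exp_passage_laplace -ge0_integralZl//.
    + apply: eq_integral => x _; rewrite -muleDl//; last first.
        exact: passage_laplace_fin.
      rewrite muleA -!EFinM -EFinD; congr (_%:E * _)%E.
      rewrite /h /gumbel mulrBr mulr1 -!expRD subrK; congr expR; ring.
    + apply: emeasurable_funM; last exact: measurable_passage_laplace_scaled.
      by apply/measurable_EFinP; exact: measurable_expR.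
    + by move=> x _; rewrite mule_ge0// lee_fin expR_ge0.
  - by move=> x _; rewrite mule_ge0// lee_fin.
  - apply: emeasurable_funM; last exact: measurable_passage_laplace_scaled.
    apply/measurable_EFinP; apply: (measurableT_comp mh); exact: measurable_funD.
  - by move=> x _; rewrite mule_ge0// lee_fin gumbel_ge0.
  - apply: emeasurable_funM; first exact: measurable_gumbel_shift.
    exact: measurable_passage_laplace_scaled.
move: S; rewrite integral_gumbel_passage_laplace//.
case: (\int[mu]_x _)%E => [r| |]//; rewrite -EFinD => -[E]; congr (_%:E).
have ev : (1 + alpha^-1) * (alpha * v) = alpha * v + v.
  by rewrite mulrDl mul1r mulrA mulVf ?mul1r// gt_eqF.
have n0 := one_sub_expR_neq0 av; rewrite ev mul1r expRD.
have -> : r = expR v - (expR v - expR (alpha * v)) / (1 - expR (alpha * v)) by apply/eqP; rewrite eq_sym subr_eq E.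
move: (expR v) (expR (alpha * v)) n0 => e e' n0.
by field.
Qed.

Lemma passage_mellin_low s : -1 < s -> s < - alpha^-1 ->
  passage_mellin s = (passage_moment alpha s)%:E.
Proof.
move=> s1 s0; have a0 := alphaV_gt0; have a1 := alphaV_lt1.
have A : 0 < sin (pi * (s + 1)) by apply: sinpi_gt0; lra.
have B : 0 < sin (pi * (s + 1 + alpha^-1)) by apply: sinpi_gt0; lra.
have sn : s < 0 by lra.
have refl := gamma_reflection s1 sn.
have G2 : 0 < euler_gamma (- s) by rewrite euler_gamma_gt0// oppr_gt0.
have q0 : 1 + alpha * s < 0 by rewrite -ltrBrDl sub0r -ltr_pdivlMl// mulrN1.
have q1 : -1 < 1 + alpha * s.
  have : - alpha < alpha * s by rewrite -ltr_pdivrMl// mulrN mulVf// gt_eqF.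
  by have := alpha2; lra.
have G3 : 0 < euler_gamma (2 + alpha * s) by apply: euler_gamma_gt0; lra.
have G1 : 0 < euler_gamma (1 + s) by rewrite euler_gamma_gt0// -ltrBlDl sub0r.
have c0 : 0 < euler_gamma (2 + alpha * s) / - (1 + alpha * s).
  by rewrite divr_gt0// oppr_gt0.
rewrite (ereal_divisor c0 G2 (mellin_equation_low s1 s0)); congr (_%:E).
have BE : sin (pi * (s + alpha^-1)) = - sin (pi * (s + 1 + alpha^-1)).
  by rewrite (_ : s + 1 + alpha^-1 = s + alpha^-1 + 1) ?mulrDr ?mulr1 ?sinDpi ?opprK//; ring.
rewrite -mulrBr cot_sub ?gt_eqF// -mulrBr (_ : s + 1 + alpha^-1 - (s + 1) = alpha^-1); last by ring.
rewrite /passage_moment Gamma_pos; last by rewrite -ltrBlDl sub0r.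
rewrite [s * alpha]mulrC (Gamma_neg q1 q0) (_ : 1 + alpha * s + 1 = 2 + alpha * s); last by ring.
rewrite BE [X in X * (_ / _)]refl.
move: (sin (pi / alpha)) (sin (pi * (s + 1))) (sin (pi * (s + 1 + alpha^-1)))
  (euler_gamma (1 + s)) (euler_gamma (- s)) (euler_gamma (2 + alpha * s)) (1 + alpha * s)
  A B G1 G2 G3 q0 => S sA sB g1 g2 g3 q A B G1 G2 G3 q0.
have qn := lt_eqF q0.
by field; rewrite ?qn ?(gt_eqF A) ?(gt_eqF B) ?(gt_eqF G1) ?(gt_eqF G2) ?(gt_eqF G3).
Qed.

Lemma passage_mellin_neg s : - alpha^-1 < s -> s < 0 ->
  passage_mellin s = (passage_moment alpha s)%:E.
Proof.
move=> s1 s0; have a0 := alphaV_gt0; have a1 := alphaV_lt1.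
have A : 0 < sin (pi * (s + 1)) by apply: sinpi_gt0; lra.
have B : 0 < sin (pi * (s + alpha^-1)) by apply: sinpi_gt0; lra.
have ns : -1 < s by lra.
have refl := gamma_reflection ns s0.
have G2 : 0 < euler_gamma (- s) by rewrite euler_gamma_gt0// oppr_gt0.
have q0 : 0 < 1 + alpha * s.
  have : -1 < alpha * s by rewrite -ltr_pdivrMl// mulrN mulr1.
  by lra.
have G3 : 0 < euler_gamma (1 + alpha * s) by apply: euler_gamma_gt0; lra.
have G1 : 0 < euler_gamma (1 + s) by rewrite euler_gamma_gt0// -ltrBlDl sub0r.
rewrite (ereal_divisor G3 G2 (mellin_equation_neg s1 s0)); congr (_%:E).
rewrite -mulrBr cot_sub ?gt_eqF// -mulrBr (_ : s + 1 - (s + alpha^-1) = 1 - alpha^-1); last by ring.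
rewrite sinpi_compl /passage_moment [s * alpha]mulrC (Gamma_pos q0) Gamma_pos; last by rewrite -ltrBlDl sub0r.
rewrite [X in X * (_ / _)]refl.
move: (sin (pi / alpha)) (sin (pi * (s + 1))) (sin (pi * (s + alpha^-1)))
  (euler_gamma (1 + s)) (euler_gamma (- s)) (euler_gamma (1 + alpha * s))
  A B G1 G2 G3 => S sA sB g1 g2 g3 A B G1 G2 G3.
by field; rewrite !gt_eqF.
Qed.

Lemma passage_mellin_pos s : 0 < s -> s < 1 - alpha^-1 ->
  passage_mellin s = (passage_moment alpha s)%:E.
Proof.
move=> s0 s1; have a0 := alphaV_gt0; have a1 := alphaV_lt1.
have A : 0 < sin (pi * s) by apply: sinpi_gt0; lra.
have B : 0 < sin (pi * (s + alpha^-1)) by apply: sinpi_gt0; lra.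
have G2 : 0 < euler_gamma (1 - s) by apply: euler_gamma_gt0; lra.
have s01 : 0 < s < 1 by lra.
have q0 : 0 < 1 + alpha * s by rewrite addr_gt0// mulr_gt0.
have G3 : 0 < euler_gamma (1 + alpha * s) by exact: euler_gamma_gt0.
have G1 : 0 < euler_gamma s by exact: euler_gamma_gt0.
have c0 := divr_gt0 G2 s0.
rewrite (ereal_divisor G3 c0 (mellin_equation_pos s0 s1)); congr (_%:E).
have refl : pi = euler_gamma s * euler_gamma (1 - s) * sin (pi * s) :> R.
  by rewrite euler_gamma_reflection// divfK// gt_eqF.
rewrite -mulrBr cot_sub ?gt_eqF// -mulrBr (_ : s + alpha^-1 - s = alpha^-1); last by ring.
rewrite /passage_moment [s * alpha]mulrC (Gamma_pos q0) (Gamma_pos (addr_gt0 ltr01 s0)).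
rewrite (euler_gammaS s0) [X in X * (_ / _)]refl.
move: (sin (pi / alpha)) (sin (pi * s)) (sin (pi * (s + alpha^-1)))
  (euler_gamma s) (euler_gamma (1 - s)) (euler_gamma (1 + alpha * s))
  A B G1 G2 G3 => S sA sB g1 g2 g3 A B G1 G2 G3.
by field; rewrite !gt_eqF.
Qed.

Lemma passage_mellin_formula s : -1 < s -> s < 1 - alpha^-1 -> s != - alpha^-1 ->
  passage_mellin s = (passage_moment alpha s)%:E.
Proof.
move=> s1 s2 sn; case: (ltgtP s (- alpha^-1)) => [sl|sg|se].
- exact: passage_mellin_low.
- case: (ltgtP s 0) => [s0|s0|->]; [exact: passage_mellin_neg|exact: passage_mellin_pos|].
  rewrite passage_mellin0 /passage_moment mul0r !addr0 add0r divff// mulf_neq0//.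
    by rewrite Gamma_pos// gt_eqF// euler_gamma_gt0.
  by rewrite gt_eqF// sinpi_gt0// alphaV_gt0 alphaV_lt1.
- by move: sn; rewrite se eqxx.
Qed.

(** E T^u is given by the formula on both sides of the singularity and is
    continuous in u by dominated convergence; epower_le provides the dominating
    function. *)
Lemma passage_moment_cvg : (passage_moment alpha u)%:E @[u --> (- alpha^-1)^'] -->
  passage_mellin (- alpha^-1).
Proof.
have a0 := alphaV_gt0; have a1 := alphaV_lt1; have a2 := alphaV_gt_half.
pose e := (1 - alpha^-1) / 2.
have e0 : 0 < e by rewrite /e; lra.
pose a := - alpha^-1 - e; pose b := - alpha^-1 + e.
have ma : passage_mellin a = (passage_moment alpha a)%:E.
  by apply: passage_mellin_low; rewrite /a /e; lra.
have mb : passage_mellin b = (passage_moment alpha b)%:E.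
  by apply: passage_mellin_neg; rewrite /b /e; lra.
have an : a < 0 by rewrite /a /e; lra.
have bn : b < 0 by rewrite /b /e; lra.
pose g w := (epower (passage_time w) a + epower (passage_time w) b)%E.
have mg : measurable_fun setT g by apply: emeasurable_funD; exact: measurable_epower_passage.
have Ig : (\int[P]_w g w = passage_mellin a + passage_mellin b)%E.
  rewrite ge0_integralD//.
  - by move=> w _; exact: epower_ge0.
  - exact: measurable_epower_passage.
  - by move=> w _; exact: epower_ge0.
  - exact: measurable_epower_passage.
have g0 w : (0 <= g w)%E by rewrite adde_ge0 ?epower_ge0.
have ig : P.-integrable setT g.
  apply/integrableP; split => //.
  under eq_integral do rewrite gee0_abs//.
  by rewrite Ig ma mb -EFinD ltry.
have dom u w : a <= u <= b -> (epower (passage_time w) u <= g w)%E.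
  exact: epower_le.
have fs : passage_mellin (- alpha^-1) \is a fin_num.
  rewrite ge0_fin_numE; last by apply: integral_ge0 => w _; exact: epower_ge0.
  apply: (@le_lt_trans _ _ (\int[P]_w g w)%E); last by rewrite Ig ma mb -EFinD ltry.
  apply: ge0_le_integral => //.
  - by move=> w _; exact: epower_ge0.
  - exact: measurable_epower_passage.
  - by move=> w _; apply: dom; rewrite /a /b; lra.
rewrite -(fineK fs); apply: cvg_EFin; first exact: nearW.
apply/cvgr_dnbhsP => u [un ucv].
have [N _ HN] : \forall n \near \oo, `|- alpha^-1 - u n| < e.
  by move/cvgrPdist_lt : ucv; apply.
rewrite -(cvg_shiftn N).
have bu n : a <= u (n + N)%N <= b.
  have := HN (n + N)%N (leq_addl _ _); rewrite /= ltr_norml /a /b => /andP[h1 h2].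
  by apply/andP; split; lra.
have u0 n : u (n + N)%N < 0 by have /andP[_ h] := bu n; exact: le_lt_trans h bn.
have ucv' : u (n + N)%N @[n --> \oo] --> - alpha^-1 by rewrite (cvg_shiftn N).
have E n : passage_mellin (u (n + N)%N) = (passage_moment alpha (u (n + N)%N))%:E.
  have /andP[h1 h2] := bu n; move: h1 h2; rewrite /a /b /e => h1 h2.
  by apply: passage_mellin_formula => //; lra.
suff : passage_mellin (u (n + N)%N) @[n --> \oo] --> passage_mellin (- alpha^-1).
  by rewrite -{1}(fineK fs) => /fine_cvg; under eq_fun do rewrite /= E /=.
have [||||_ _] := @dominated_convergence _ _ _ P setT measurableT
  (fun n w => epower (passage_time w) (u (n + N)%N))
  (fun w => epower (passage_time w) (- alpha^-1)) g _ (measurable_epower_passage (- alpha^-1)).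
- by move=> n; exact: measurable_epower_passage.
- by apply: aeW => w _; apply: epower_cvg => //; rewrite oppr_lt0.
- exact: ig.
- by apply: aeW => w n _; rewrite gee0_abs ?epower_ge0//; exact: dom.
- exact.
Qed.

End levy.

Theorem proposition4 (R : realType) (d : measure_display)
    (T : measurableType d) (P : probability T R)
    (alpha : R) (X : R -> {RV P >-> R}) :
  1 < alpha -> alpha < 2 ->
  levy_process X -> stable alpha X -> spectrally_positive X ->
  (forall t lambda : R, 0 <= t -> 0 <= lambda ->
    'E_P[fun w => expR (- lambda * X t w)]%E =
      (expR (t * lambda `^ alpha))%:E) ->
  forall s : R, -1 < s -> s < 1 - alpha^-1 ->
    (s <> - alpha^-1 ->
      (\int[P]_w epower (first_passage X 1 w) s)%E =
        (passage_moment alpha s)%:E) /\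
    (s = - alpha^-1 ->
      (passage_moment alpha u)%:E @[u --> s^'] -->
        (\int[P]_w epower (first_passage X 1 w) s)%E).
Proof.
move=> alpha1 alpha2 lX sX _ laplaceX s s1 s2; rewrite (passage_mellinE lX).
split=> [/eqP sn|->].
  exact: (passage_mellin_formula alpha1 alpha2 lX sX laplaceX).
exact: (passage_moment_cvg alpha1 alpha2 lX sX laplaceX).
Qed.
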